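(* Let $G$ be a connected Lie group with Lie algebra $\mathfrak{g}$ and let $\Gamma$ be an invariant second-order differential equation field on $TG$. An invariant multiplier for $\Gamma$ determines a cohomology class in $H^1(\mathfrak{g})$ and one in $H^2(\mathfrak{g})$. The field $\Gamma$ is derivable from an invariant Lagrangian if and only if the corresponding cohomology classes vanish.
   Context: All objects are smooth; summation convention is used. $\tau:TG\to G$ is the projection, $(q^i)$ are local coordinates on $G$ and $(q^i,\dot q^i)$ the induced coordinates on $TG$. ''Invariant'' means left-invariant throughout. Lifts: for a vector field $X=X^i(q)\,\partial/\partial q^i$ on $G$, its vertical lift is $X^{V}=X^i\,\partial/\partial\dot q^i$ and its complete lift is $X^{C}=X^i\,\partial/\partial q^i+\frac{\partial X^i}{\partial q^j}\dot q^j\,\partial/\partial\dot q^i$; both are vector fields on $TG$. A second-order differential equation field is a vector field on $TG$ of the form $\Gamma=\dot q^i\,\partial/\partial q^i+f^i(q,\dot q)\,\partial/\partial\dot q^i$. It is invariant if it is invariant under the diffeomorphisms $T\lambda_h$ of $TG$ for all $h\in G$, $\lambda_h$ being left multiplication. A function $F$ on $TG$ is invariant if $F\circ T\lambda_h=F$ for all $h\in G$. A Lagrangian $L\in C^\infty(TG)$ is regular if $(\partial^2L/\partial\dot q^i\partial\dot q^j)$ is everywhere non-singular; $\Gamma$ is the Euler-Lagrange field of a regular $L$ (and $L$ is a Lagrangian for $\Gamma$) if $\Gamma(X^{V}(L))=X^{C}(L)$ for all vector fields $X$ on $G$. $\Gamma$ is derivable from an invariant Lagrangian if it is the Euler-Lagrange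 field of some invariant regular Lagrangian on $TG$. A type $(0,2)$ tensor field along $\tau$ is $g=g_{ij}(q,\dot q)\,dq^i\otimes dq^j$ (a smoothly varying bilinear form on $T_{\tau(v)}G$ for each $v\in TG$). It satisfies the Helmholtz conditions for $\Gamma$ if in local coordinates (1) $\det(g_{ij})\ne0$ and $g_{ij}=g_{ji}$; (2) $\Gamma(g_{ij})+\frac12\frac{\partial f^k}{\partial\dot q^j}g_{ik}+\frac12\frac{\partial f^k}{\partial\dot q^i}g_{kj}=0$; (3) $g_{ik}P^k_j=g_{jk}P^k_i$, where $P^k_j=\Gamma\big(\frac{\partial f^k}{\partial\dot q^j}\big)-2\frac{\partial f^k}{\partial q^j}-\frac12\frac{\partial f^l}{\partial\dot q^j}\frac{\partial f^k}{\partial\dot q^l}$; (4) $\frac{\partial g_{ij}}{\partial\dot q^k}=\frac{\partial g_{ik}}{\partial\dot q^j}$. Fix a basis $\{E_i\}$ of $\mathfrak{g}=T_eG$; let $\hat E_i$ and $\tilde E_i$ be the left-invariant, respectively right-invariant, vector fields on $G$ with value $E_i$ at the identity $e$. Structure constants: $[\hat E_i,\hat E_j]=C_{ij}^k\hat E_k$ (so $[\tilde E_i,\tilde E_j]=-C_{ij}^k\tilde E_k$). The functions $w^i$ on $TG$ are defined by $v=w^i(v)\hat E_i(\tau(v))$. The tensor field $g$ is invariant if all functions $g(\hat E_i,\hat E_j)$ on $TG$ are invariant. An invariant multiplier for $\Gamma$ is an invariant $g$ satisfying the Helmholtz conditions for $\Gamma$. Cohomology: $H^\ast(\mathfrak{g})$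 is the Lie algebra cohomology of $\mathfrak g$ with values in $\mathbf{R}$. A linear map $b=(b_i):\mathfrak{g}\to\mathbf{R}$ is a 1-cocycle if $b_kC^k_{ij}=0$ (1-coboundaries are zero). An alternating bilinear map $\alpha=(\alpha_{ij})$ is a 2-cocycle if $\alpha_{il}C^l_{jk}+\alpha_{jl}C^l_{ki}+\alpha_{kl}C^l_{ij}=0$, and a 2-coboundary if $\alpha_{ij}=\theta_kC^k_{ij}$ for some constants $\theta_k$. The corresponding classes: given an invariant multiplier $g$, there is a regular Lagrangian $L$ for $\Gamma$ (not necessarily invariant) such that $g(\hat E_i,\hat E_j)=\hat E_i^{V}\hat E_j^{V}(L)$. For it there are functions $f_i$ on $G$, determined up to additive constants, and constants $b_i$ with $$\tilde E_i^{C}(L)=w^j\hat E_j(f_i)+b_i ,$$ and the functions $$\alpha_{ij}=\tilde E_i(f_j)-\tilde E_j(f_i)+C_{ij}^lf_l$$ are constant. The cohomology classes are those of the cocycles $b=(b_i)$ and $\alpha=(\alpha_{ij})$.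
   Formalization: The Lagrangian L and functions f_i defining the classes are taken over connected open sets of G (G allowed), as global ones may not exist (magnetic force on a torus); ''derivable iff the classes vanish'' is read for a given multiplier, and for Γ as ''some invariant multiplier has vanishing classes''. *)

(* Defs.v *)
From HB Require Import structures.
From mathcomp Require Import all_boot all_order all_algebra.
From mathcomp Require Import all_classical all_reals all_analysis.

Set Implicit Arguments.
Unset Strict Implicit.
Unset Printing Implicit Defensive.

Import Order.TTheory GRing.Theory Num.Theory.
Import numFieldNormedType.Exports.

Local Open Scope classical_set_scope.
Local Open Scope ring_scope.

(* Only the two structures on a common carrier; continuity of the operations
   is required in [lie_group]. *)
#[short(type="topGroupType")]
HB.structure Definition TopGroup := {G of Group G & Topological G}.

(* For k > 0, "f is differentiable on U and all its directional derivatives are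
   C^(k-1) on U"; in finite dimension and for open U this is C^k. *)
Fixpoint C_on (R : realType) (V W : normedModType R) (k : nat) (U : set V)
    (f : V -> W) : Prop :=
  if k is k'.+1 then
    (forall x, U x -> differentiable f x) /\
    (forall v, C_on k' U (fun x => 'd f x v))
  else forall x, U x -> {for x, continuous f}.

Definition smooth_on (R : realType) (V W : normedModType R) (U : set V)
    (f : V -> W) : Prop :=
  forall k, C_on k U f.

(* Outside [dom], resp. outside the image of [dom], the values of [cmap], resp.
   [cinv], are irrelevant. *)
Record chart (V M : Type) := Chart {
  dom : set M;
  cmap : M -> V;
  cinv : V -> M }.

Definition img (V M : Type) (c : chart V M) (U : set M) : set V :=
  cmap c @` (dom c `&` U).

(* [chart_at q] is a preferred chart around q. It serves to encode the tangent
   space at q: T_qM is the model space V, a vector at q being given by its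
   components in the chart [chart_at q]. *)
Record atlas (V M : Type) := Atlas {
  charts : set (chart V M);
  chart_at : M -> chart V M }.

Definition manifold (R : realType) (V : normedModType R) (M : topologicalType)
    (A : atlas V M) : Prop :=
  [/\ hausdorff_space M, @second_countable M,
      forall q, charts A (chart_at A q) /\ dom (chart_at A q) q,
      forall c, charts A c ->
        [/\ open (dom c), open (img c setT),
            forall q, dom c q -> cinv c (cmap c q) = q,
            forall q, dom c q -> {for q, continuous (cmap c)} &
            forall x, img c setT x -> {for x, continuous (cinv c)}] &
      forall c c', charts A c -> charts A c' ->
        smooth_on (img c (dom c')) (cmap c' \o cinv c)].

Definition smooth_fun (R : realType) (V W : normedModType R) (M : Type)
    (A : atlas V M) (U : set M) (f : M -> W) : Prop :=
  forall c, charts A c -> smooth_on (img c U) (f \o cinv c).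

Definition smooth_map (R : realType) (V W : normedModType R) (M N : Type)
    (A : atlas V M) (B : atlas W N) (F : M -> N) : Prop :=
  forall c c', charts A c -> charts B c' ->
    smooth_on (img c (F @^-1` dom c')) (cmap c' \o F \o cinv c).

Definition prod_chart (V W M N : Type) (c : chart V M) (d : chart W N) :
    chart (V * W) (M * N) :=
  Chart [set p | dom c p.1 /\ dom d p.2]
        (fun p => (cmap c p.1, cmap d p.2)) (fun z => (cinv c z.1, cinv d z.2)).

Definition prod_atlas (V W M N : Type) (A : atlas V M) (B : atlas W N) :
    atlas (V * W) (M * N) :=
  Atlas [set e | exists c d, [/\ charts A c, charts B d & e = prod_chart c d]]
        (fun p => prod_chart (chart_at A p.1) (chart_at B p.2)).

Definition lie_group (R : realType) (n : nat) (G : topGroupType)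
    (A : atlas 'rV[R]_n G) : Prop :=
  [/\ manifold A,
      continuous (fun p : G * G => (p.1 * p.2)%g),
      continuous (fun x : G => (x^-1)%g),
      smooth_map (prod_atlas A A) A (fun p : G * G => (p.1 * p.2)%g) &
      smooth_map A A (fun x : G => (x^-1)%g)].

Section Tangent.
Variables (R : realType) (V : normedModType R) (M : Type) (A : atlas V M).

(* The chart (q, qdot) of TM induced by the chart c of M. A point (q, u) of TM
   has u = components of a tangent vector in [chart_at A q]; they are converted
   to components in c by the derivative of the change of coordinates. *)
Definition tchart (c : chart V M) : chart (V * V) (M * V) :=
  Chart [set v | dom c v.1]
        (fun v => (cmap c v.1,
                   'd (cmap c \o cinv (chart_at A v.1))
                      (cmap (chart_at A v.1) v.1) v.2))
        (fun z => (cinv c z.1,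
                   'd (cmap (chart_at A (cinv c z.1)) \o cinv c) (z.1 : V) z.2)).

Definition tatlas : atlas (V * V) (M * V) :=
  Atlas [set tchart c | c in charts A] (fun v => tchart (chart_at A v.1)).

(* A vector field is a map X : M -> V, with X q in T_qM = V. *)
Definition vcomp (X : M -> V) (c : chart V M) (x : V) : V :=
  (cmap (tchart c) (cinv c x, X (cinv c x))).2.

Definition smooth_field (U : set M) (X : M -> V) : Prop :=
  forall c, charts A c -> smooth_on (img c U) (vcomp X c).

(* X(f) *)
Definition lieD (X : M -> V) (f : M -> R) (q : M) : R :=
  'd (f \o cinv (chart_at A q) : V -> R^o) (cmap (chart_at A q) q) (X q).

Definition bracket (X Y : M -> V) (q : M) : V :=
  let c := chart_at A q in let x := cmap c q in
  'd (vcomp Y c) x (X q) - 'd (vcomp X c) x (Y q).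

(* Vector fields on TM are maps M * V -> V * V, expressed at v in the chart
   [chart_at tatlas v], which is induced by [chart_at A v.1]. *)
Definition vlift (X : M -> V) : M * V -> V * V :=
  fun v => (0, X v.1).

Definition clift (X : M -> V) : M * V -> V * V :=
  fun v => let c := chart_at A v.1 in
           (X v.1, 'd (vcomp X c) (cmap c v.1) v.2).

End Tangent.

Definition tmap (R : realType) (V W : normedModType R) (M N : Type)
    (A : atlas V M) (B : atlas W N) (F : M -> N) : M * V -> N * W :=
  fun v => let c := chart_at A v.1 in
           (F v.1,
            'd (cmap (chart_at B (F v.1)) \o F \o cinv c) (cmap c v.1) v.2).

Definition tau_preim (M V : Type) (U : set M) : set (M * V) := [set v | U v.1].

Definition basis_vec (R : realType) (n : nat) (i : 'I_n) : 'rV[R]_n :=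
  delta_mx 0 i.

Definition sode (R : realType) (V : normedModType R) (M : Type)
    (A : atlas V M) (Gam : M * V -> V * V) : Prop :=
  smooth_field (tatlas A) setT Gam /\
  forall c z, charts A c -> img (tchart A c) setT z ->
    (vcomp (tatlas A) Gam (tchart A c) z).1 = z.2.

Section Coordinates.
Variables (R : realType) (n : nat) (M : Type) (A : atlas 'rV[R]_n M).
Local Notation V := 'rV[R]_n.

(* d phi / d q^i and d phi / d qdot^i, for phi a function of z = (q, qdot) *)
Definition dq (i : 'I_n) (phi : V * V -> R) (z : V * V) : R :=
  'd (phi : V * V -> R^o) z (basis_vec R i, 0).
Definition dv (i : 'I_n) (phi : V * V -> R) (z : V * V) : R :=
  'd (phi : V * V -> R^o) z (0, basis_vec R i).

(* f^i *)
Definition force (Gam : M * V -> V * V) (c : chart V M) (i : 'I_n)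
    (z : V * V) : R :=
  (vcomp (tatlas A) Gam (tchart A c) z).2 0 i.

(* Gam(phi), for phi a function of the coordinates z = (q, qdot) of tchart c *)
Definition sodeD (Gam : M * V -> V * V) (c : chart V M) (phi : V * V -> R)
    (z : V * V) : R :=
  \sum_i z.2 0 i * dq i phi z + \sum_i force Gam c i z * dv i phi z.

Definition regular (U : set M) (L : M * V -> R) : Prop :=
  forall c z, charts A c -> img (tchart A c) (tau_preim U) z ->
    \matrix_(i, j) dv i (dv j (L \o cinv (tchart A c))) z \in unitmx.

(* L is a regular Lagrangian, defined over the open set U of M, and Gam is its
   Euler-Lagrange field there. *)
Definition lagrangian (Gam : M * V -> V * V) (U : set M) (L : M * V -> R) :
    Prop :=
  [/\ smooth_fun (tatlas A) (tau_preim U) (L : M * V -> R^o),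
      regular U L &
      forall X, smooth_field A U X -> forall v, U v.1 ->
        lieD (tatlas A) Gam (lieD (tatlas A) (vlift X) L) v =
        lieD (tatlas A) (clift A X) L v].

(* A type (0,2) tensor field along tau is a map g : TM -> 'M_n, where [g v] is
   the matrix of a bilinear form on T_(tau v)M = 'rV_n. *)
Definition form (g : M * V -> 'M[R]_n) (v : M * V) (X Y : V) : R :=
  (X *m g v *m Y^T) 0 0.

(* The coordinate vector field d/dq^i of the chart c, at the point of
   coordinates x *)
Definition coord_field (c : chart V M) (i : 'I_n) (x : V) : V :=
  (cinv (tchart A c) (x, basis_vec R i)).2.

Definition gcoef (g : M * V -> 'M[R]_n) (c : chart V M) (i j : 'I_n)
    (z : V * V) : R :=
  form g (cinv (tchart A c) z) (coord_field c i z.1) (coord_field c j z.1).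

Definition smooth_tensor (g : M * V -> 'M[R]_n) : Prop :=
  forall c i j, charts A c ->
    smooth_on (img (tchart A c) setT) (gcoef g c i j : V * V -> R^o).

Definition Pcoef (Gam : M * V -> V * V) (c : chart V M) (k j : 'I_n)
    (z : V * V) : R :=
  sodeD Gam c (dv j (force Gam c k)) z - 2 * dq j (force Gam c k) z
  - 2^-1 * \sum_l dv j (force Gam c l) z * dv l (force Gam c k) z.

Definition helmholtz (Gam : M * V -> V * V) (g : M * V -> 'M[R]_n) : Prop :=
  forall c z, charts A c -> img (tchart A c) setT z ->
  let f := force Gam c in let g_ := gcoef g c in
  [/\ \det (\matrix_(i, j) g_ i j z) != 0 /\
        (forall i j, g_ i j z = g_ j i z),
      forall i j, sodeD Gam c (g_ i j) z
        + 2^-1 * \sum_k dv j (f k) z * g_ i k z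
        + 2^-1 * \sum_k dv i (f k) z * g_ k j z = 0,
      forall i j, \sum_k g_ i k z * Pcoef Gam c k j z =
                  \sum_k g_ j k z * Pcoef Gam c k i z &
      forall i j k, dv k (g_ i j) z = dv j (g_ i k) z].

End Coordinates.

(* C i j k stands for C_{ij}^k. *)

Section Cohomology.
Variables (R : realType) (n : nat) (C : 'I_n -> 'I_n -> 'I_n -> R).

Definition cocycle1 : set 'rV[R]_n :=
  [set b | forall i j, \sum_k b 0 k * C i j k = 0].

Definition coboundary1 : set 'rV[R]_n := [set 0].

Definition cocycle2 : set 'M[R]_n :=
  [set a | a^T = - a /\
     forall i j k, \sum_l (a i l * C j k l + a j l * C k i l + a k l * C i j l)
                   = 0].

Definition coboundary2 : set 'M[R]_n :=
  [set a | exists t : 'rV[R]_n, forall i j, a i j = \sum_k t 0 k * C i j k].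

Definition class1 (b : 'rV[R]_n) : set 'rV[R]_n :=
  [set b' | cocycle1 b' /\ coboundary1 (b' - b)].

Definition class2 (a : 'M[R]_n) : set 'M[R]_n :=
  [set a' | cocycle2 a' /\ coboundary2 (a' - a)].

(* The quotients Z^k / B^k, as sets of cosets *)
Definition H1 : set (set 'rV[R]_n) := class1 @` cocycle1.
Definition H2 : set (set 'M[R]_n) := class2 @` cocycle2.

End Cohomology.

Section LieGroup.
Variables (R : realType) (n : nat) (G : topGroupType) (A : atlas 'rV[R]_n G).
Local Notation V := 'rV[R]_n.

Definition Tlambda (h : G) : G * V -> G * V :=
  tmap A A (fun x : G => (h * x)%g).
Definition Trho (h : G) : G * V -> G * V :=
  tmap A A (fun x : G => (x * h)%g).

Definition invariant_fun (F : G * V -> R) : Prop :=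
  forall h v, F (Tlambda h v) = F v.

Definition invariant_sode (Gam : G * V -> V * V) : Prop :=
  sode A Gam /\
  forall h v, tmap (tatlas A) (tatlas A) (Tlambda h) (v, Gam v)
              = (Tlambda h v, Gam (Tlambda h v)).

Definition derivable_from_invariant (Gam : G * V -> V * V) : Prop :=
  exists L, invariant_fun L /\ lagrangian A Gam setT L.

(* The rows of E are the vectors E_i of T_eG = 'rV_n. *)
Variable E : 'M[R]_n.

Definition Ehat (i : 'I_n) : G -> V := fun q => (Tlambda q (1%g, row i E)).2.
Definition Etilde (i : 'I_n) : G -> V := fun q => (Trho q (1%g, row i E)).2.

Definition structure_constants (C : 'I_n -> 'I_n -> 'I_n -> R) : Prop :=
  forall i j q, bracket A (Ehat i) (Ehat j) q = \sum_k C i j k *: Ehat k q.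

(* The components of v in the frame (Ehat i), i.e. v = w^i(v) Ehat_i(tau v) *)
Definition qvel (i : 'I_n) (v : G * V) : R :=
  (v.2 *m invmx (\matrix_j Ehat j v.1)) 0 i.

Definition invariant_tensor (g : G * V -> 'M[R]_n) : Prop :=
  forall i j, invariant_fun (fun v => form g v (Ehat i v.1) (Ehat j v.1)).

Definition invariant_multiplier (Gam : G * V -> V * V) (g : G * V -> 'M[R]_n) :
    Prop :=
  [/\ smooth_tensor A g, invariant_tensor g & helmholtz A Gam g].

(* g(Ehat_i, Ehat_j) = Ehat_i^V Ehat_j^V (L) tau_preim U *)
Definition has_multiplier (U : set G) (L : G * V -> R) (g : G * V -> 'M[R]_n) :
    Prop :=
  forall i j v, U v.1 ->
    form g v (Ehat i v.1) (Ehat j v.1) =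
    lieD (tatlas A) (vlift (Ehat i)) (lieD (tatlas A) (vlift (Ehat j)) L) v.

(* A Lagrangian L for Gam with multiplier g, together with functions f_i and
   constants b_i such that Etilde_i^C (L) = w^j Ehat_j(f_i) + b_i, all over a
   connected open set U. U = G is allowed but cannot be imposed: if G is not
   simply connected there may be no L, or no f_i, defined over the whole of G.
   (On the torus T^2, a constant magnetic force has no global Lagrangian whose
   multiplier is the flat metric.) The cohomology classes do not depend on U. *)
Definition class_data (Gam : G * V -> V * V) (g : G * V -> 'M[R]_n)
    (U : set G) (L : G * V -> R) (f : 'I_n -> G -> R) (b : V) : Prop :=
  [/\ [/\ open U, connected U & U !=set0],
      lagrangian A Gam U L,
      has_multiplier U L g,
      forall i, smooth_fun A U (f i : G -> R^o) &
      forall i v, U v.1 ->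
        lieD (tatlas A) (clift A (Etilde i)) L v =
        \sum_j qvel j v * lieD A (Ehat j) (f i) v.1 + b 0 i].

Definition alpha (C : 'I_n -> 'I_n -> 'I_n -> R) (f : 'I_n -> G -> R)
    (i j : 'I_n) (q : G) : R :=
  lieD A (Etilde i) (f j) q - lieD A (Etilde j) (f i) q
  + \sum_l C i j l * f l q.

(* (c1, c2) in H^1 x H^2 is the pair of cohomology classes determined by g:
   data exist near every point and, whatever the choice of U, L, f and b, the
   functions alpha_ij are constant, b represents c1 and alpha represents c2. *)
Definition determines (C : 'I_n -> 'I_n -> 'I_n -> R) (Gam : G * V -> V * V)
    (g : G * V -> 'M[R]_n) (c1 : set V) (c2 : set 'M[R]_n) : Prop :=
  [/\ H1 C c1, H2 C c2,
      forall p, exists U L f b, U p /\ class_data Gam g U L f b &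
      forall U L f b, class_data Gam g U L f b ->
        exists a : 'M[R]_n,
          [/\ forall i j q, U q -> alpha C f i j q = a i j, c1 b & c2 a]].

Definition classes_vanish (C : 'I_n -> 'I_n -> 'I_n -> R)
    (c1 : set V) (c2 : set 'M[R]_n) : Prop :=
  c1 = class1 C 0 /\ c2 = class2 C 0.

End LieGroup.

(* Main.v *)
Require Import Defs.
From HB Require Import structures.
From mathcomp Require Import all_boot all_order all_algebra.
From mathcomp Require Import all_classical all_reals all_analysis.
From mathcomp Require Import ring lra.
Set Implicit Arguments.
Unset Strict Implicit.
Unset Printing Implicit Defensive.
Import Order.TTheory GRing.Theory Num.Theory.
Import numFieldNormedType.Exports.
Local Open Scope classical_set_scope.
Local Open Scope ring_scope.

(* In the left-invariant frame an invariant multiplier g has components that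
   depend on the fibre coordinates w = (w^1, ..., w^n) only, and condition (4)
   makes them the Hessian of a function K(w). The Euler-Lagrange expressions of
   K(w) against the frame are functions eps_i(w), and the Helmholtz conditions (2)
   and (3) force eps_i(w) = s_i + beta_ij w^j, where s is a 1-cocycle and beta a
   skew-symmetric 2-cocycle. The Lagrangians for Gam with multiplier g are
   therefore the functions L = K(w) + a_j(q) w^j + phi(q) with d a = beta and
   d phi = s, which exist locally by the Poincare lemma. For such an L one has
   Etilde_i^C(L) = w^j Etilde_i(a_j) + Etilde_i(phi), so b = s, Ehat_j(f_i) =
   Etilde_i(a_j), and alpha equals minus the adjoint transform of beta up to a
   coboundary; since the adjoint action of a connected group is trivial on
   cohomology, the two classes are those of s and -beta. When they vanish,
   phi = 0 and constant a_j give an invariant L. Conversely an invariant L has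
   f = 0 and b = 0, and it is a function of w whose Hessian is a multiplier. *)

(** * Smooth functions on normed spaces *)

(** The components of s and beta in the left-invariant frame are constant, so both are
    left-invariant forms on G. Such forms are closed exactly when they are cocycles, and have a
    left-invariant potential exactly when they are coboundaries; this is how Lie algebra cohomology
    enters. The shape of eps comes from index symmetry: condition (2) makes its Jacobian in w skew,
    and second derivatives that are antisymmetric in one pair of indices and symmetric in another
    vanish. With eps affine, condition (3) becomes an identity affine in the velocity, whose parts
    of degree zero and one say that s and beta are closed. The obstacle is topological: a, phi and
    the f_i may exist on small open sets only. What makes the classes independent of these sets is
    that K is global: it is produced by the Poincare lemma on a fibre, which is a vector space, and
    spread over G by invariance. K is unique up to affine functions of w; adding t_k w^k leaves s
    alone and adds to beta the coboundary of t. This matches the freedom of adding constants to a_j,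
    whose exterior derivative is -C_ij^k a_k. *)

Lemma near_is_diff (R : realType) (V W : normedModType R) (f g : V -> W) x :
  (\near x, f x = g x) -> differentiable f x -> is_diff x g ('d f x).
Proof.
move=> fg df; have /diff_locallyP[dfc dfo] := df.
have dgo : g \o shift x = cst (g x) + 'd f x +o_ 0 id.
  apply/eqaddoP => e e0; move/eqaddoP : dfo => /(_ e e0) dfo.
  rewrite -(nbhs_singleton fg); near=> y.
  suff -> : (g \o shift x - (cst (f x) + 'd f x)) y =
            (f \o shift x - (cst (f x) + 'd f x)) y by near: y.
  rewrite !fctE /=; congr (_ - _); apply/esym; near: y.
  by move: fg; rewrite (near_shift 0 x) /=; apply: filterS => y; rewrite subr0.
have dgE : 'd g x = 'd f x :> (V -> W) by apply: diff_unique.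
apply: DiffDef; last exact: dgE.
by apply/diff_locallyP; rewrite dgE; split; [exact: dfc|exact: dgo].
Unshelve. all: by end_near. Qed.

Section Smooth.
Variable R : realType.
Implicit Types V W X : normedModType R.

Lemma near_open V (U : set V) x : open U -> U x -> \near x, U x.
Proof. by move=> oU Ux; apply: open_nbhs_nbhs. Qed.

Lemma open_is_diff V W (U : set V) (f g : V -> W) x :
  open U -> (forall y, U y -> f y = g y) -> U x -> differentiable f x ->
  is_diff x g ('d f x).
Proof.
move=> oU fg Ux df; apply: near_is_diff => //.
by apply: filterS (near_open oU Ux) => y /fg.
Qed.

Lemma C_onS V W k (U U' : set V) (f : V -> W) :
  U' `<=` U -> C_on k U f -> C_on k U' f.
Proof.
elim: k f => [|k IH] f sU /=; first by move=> cf x /sU /cf.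
by move=> [df cf]; split=> [x /sU /df|v] //; apply: IH.
Qed.

Lemma C_on_cont V W k (U : set V) (f : V -> W) x :
  C_on k U f -> U x -> {for x, continuous f}.
Proof.
case: k => [|k] /=; first by move=> cf /cf.
by move=> [df _] Ux; apply: differentiable_continuous; apply: df.
Qed.

Lemma C_onW V W k (U : set V) (f : V -> W) : C_on k.+1 U f -> C_on k U f.
Proof.
elim: k f => [|k IH] f; first by move=> cf x; apply: C_on_cont cf.
by move=> [df cf]; split => // v; apply: IH.
Qed.

Lemma C_on_eq V W k (U : set V) (f g : V -> W) : open U ->
  (forall x, U x -> f x = g x) -> C_on k U f -> C_on k U g.
Proof.
move=> oU; elim: k f g => [|k IH] f g fg /=.
  move=> cf x Ux.
  have nfg : \near x, f x = g x by apply: filterS (near_open oU Ux) => y /fg.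
  have := cf x Ux; rewrite /prop_for /continuous_at (fg x Ux); apply: cvg_trans.
  by apply: near_eq_cvg; apply: filterS nfg => y ->.
move=> [df cf]; split=> [x Ux|v].
  by case: (open_is_diff oU fg Ux (df _ Ux)).
apply: IH (cf v) => x Ux.
have dgx := open_is_diff oU fg Ux (df _ Ux).
by rewrite diff_val.
Qed.

Lemma smooth_onP V W (U : set V) (f : V -> W) :
  smooth_on U f <-> (forall x, U x -> differentiable f x) /\
    (forall v, smooth_on U (fun x => 'd f x v)).
Proof.
split=> [sf|[df sf] [|k]].
- by split=> [|v k]; [have [] := sf 1%N|have [_ +] := sf k.+1; exact].
- by move=> x Ux; apply: differentiable_continuous; apply: df.
- by split => // v; apply: sf.
Qed.

Lemma smooth_diff V W (U : set V) (f : V -> W) x :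
  smooth_on U f -> U x -> differentiable f x.
Proof. by move=> /smooth_onP[df _] /df. Qed.

Lemma smooth_dir V W (U : set V) (f : V -> W) v :
  smooth_on U f -> smooth_on U (fun x => 'd f x v).
Proof. by move=> /smooth_onP[_]. Qed.

Lemma smooth_cont V W (U : set V) (f : V -> W) x :
  smooth_on U f -> U x -> {for x, continuous f}.
Proof. by move=> sf Ux; apply/differentiable_continuous/(smooth_diff sf). Qed.

Lemma smoothS V W (U U' : set V) (f : V -> W) :
  U' `<=` U -> smooth_on U f -> smooth_on U' f.
Proof. by move=> sU sf k; apply: C_onS (sf k). Qed.

Lemma smooth_eq V W (U : set V) (f g : V -> W) : open U ->
  (forall x, U x -> f x = g x) -> smooth_on U f -> smooth_on U g.
Proof. by move=> oU fg sf k; apply: C_on_eq fg (sf k). Qed.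

Lemma C_on_cst V W k (U : set V) (a : W) : C_on k U (fun=> a).
Proof.
elim: k a => [|k IH] a /=; first by move=> x _; apply: cst_continuous.
split=> [x _|v]; first exact: differentiable_cst.
rewrite (_ : (fun x => _) = fun=> 0) //.
by apply/funext => x; rewrite (_ : (fun=> a) = cst a) // diff_cst.
Qed.

Lemma smooth_cst V W (U : set V) (a : W) : smooth_on U (fun=> a).
Proof. by move=> k; apply: C_on_cst. Qed.

Lemma smooth_lin V W (U : set V) (f : {linear V -> W}) : continuous f ->
  smooth_on U f.
Proof.
move=> cf; apply/smooth_onP; split=> [x _|v].
  exact: linear_differentiable.
rewrite (_ : (fun x => _) = fun=> f v); first exact: smooth_cst.
by apply/funext => x; rewrite diff_lin.
Qed.

Lemma C_onD V W k (U : set V) (f g : V -> W) : open U ->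
  C_on k U f -> C_on k U g -> C_on k U (fun x => f x + g x).
Proof.
move=> oU; elim: k f g => [|k IH] f g /=.
  by move=> cf cg x Ux; apply: cvgD; [apply: cf|apply: cg].
move=> [df cf] [dg cg]; split=> [x Ux|v].
  by apply: differentiableD; [apply: df|apply: dg].
apply: C_on_eq (IH _ _ (cf v) (cg v)) => // x Ux.
by rewrite [in RHS](@diffD _ _ _ f g) //; [apply: df|apply: dg].
Qed.

Lemma smoothD V W (U : set V) (f g : V -> W) : open U ->
  smooth_on U f -> smooth_on U g -> smooth_on U (fun x => f x + g x).
Proof. by move=> oU sf sg k; apply: C_onD. Qed.

Lemma C_onM V k (U : set V) (f g : V -> R^o) : open U ->
  C_on k U f -> C_on k U g -> C_on k U (fun x => f x * g x : R^o).
Proof.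
move=> oU; elim: k f g => [|k IH] f g.
  by move=> cf cg x Ux; apply: cvgM; [apply: cf|apply: cg].
move=> cf1 cg1; have [df cf] := cf1; have [dg cg] := cg1.
split=> [x Ux|v].
  by apply: (@differentiableM _ _ f g); [apply: df|apply: dg].
have := C_onD oU (IH _ _ (C_onW cf1) (cg v)) (IH _ _ (C_onW cg1) (cf v)).
apply: C_on_eq => // x Ux.
by rewrite [in RHS](@diffM _ _ f g) //; [apply: df|apply: dg].
Qed.

Lemma smoothM V (U : set V) (f g : V -> R^o) : open U ->
  smooth_on U f -> smooth_on U g -> smooth_on U (fun x => f x * g x : R^o).
Proof. by move=> oU sf sg k; apply: C_onM. Qed.

Lemma C_on_lin_comp V W X k (U : set V) (f : V -> W) (l : {linear W -> X}) :
  continuous l -> C_on k U f -> open U -> C_on k U (fun x => l (f x)).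
Proof.
move=> cl + oU; elim: k f => [|k IH] f /=.
  by move=> cf x Ux; apply: (@continuous_comp _ _ _ f l); [exact: cf|exact: cl].
move=> [df cf]; split=> [x Ux|v].
  by apply: (@differentiable_comp _ _ _ _ f l); [exact: df|exact: linear_differentiable].
apply: C_on_eq (IH _ (cf v)) => // x Ux.
rewrite (@diff_comp _ _ _ _ f l) /=; [|exact: df|exact: linear_differentiable].
by rewrite diff_lin.
Qed.

Lemma smooth_lin_comp V W X (U : set V) (f : V -> W) (l : {linear W -> X}) :
  continuous l -> open U -> smooth_on U f -> smooth_on U (fun x => l (f x)).
Proof. by move=> cl oU sf k; apply: C_on_lin_comp. Qed.

Lemma smoothN V W (U : set V) (f : V -> W) : open U ->
  smooth_on U f -> smooth_on U (fun x => - f x).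
Proof.
by move=> oU sf; apply: (@smooth_lin_comp _ _ _ _ _ -%R) => // x; exact: continuousN.
Qed.

Lemma smoothB V W (U : set V) (f g : V -> W) : open U ->
  smooth_on U f -> smooth_on U g -> smooth_on U (fun x => f x - g x).
Proof. by move=> oU sf sg; apply: smoothD => //; apply: smoothN. Qed.

Lemma smooth_scaler V W (U : set V) (f : V -> R^o) (w : W) : open U ->
  smooth_on U f -> smooth_on U (fun x => f x *: w).
Proof.
have sx_lin : linear ( *:%R ^~ w : R^o -> W).
  by move=> u y z; rewrite scalerDl scalerA.
pose sxlM := GRing.isLinear.Build _ _ _ _ _ sx_lin.
pose sxL : {linear R^o -> W} := HB.pack ( *:%R ^~ w) sxlM.
by move=> oU sf; apply: (@smooth_lin_comp _ _ _ _ _ sxL) => //; exact: scalel_continuous.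
Qed.

Lemma smooth_sum V W I (r : seq I) (P : pred I) (U : set V) (f : I -> V -> W) :
  open U -> (forall i, P i -> smooth_on U (f i)) ->
  smooth_on U (fun x => \sum_(i <- r | P i) f i x).
Proof.
move=> oU sf; elim: r => [|i r IH].
  by apply: smooth_eq (@smooth_cst _ _ U 0) => // x _; rewrite big_nil.
case Pi : (P i); last first.
  by apply: smooth_eq IH => // x _; rewrite big_cons Pi.
apply: smooth_eq (smoothD oU (sf _ Pi) IH) => // x _.
by rewrite big_cons Pi.
Qed.

Lemma smooth_prod V I (r : seq I) (U : set V) (f : I -> V -> R^o) :
  open U -> (forall i, smooth_on U (f i)) ->
  smooth_on U (fun x => \prod_(i <- r) f i x : R^o).
Proof.
move=> oU sf; elim: r => [|i r IH].
  by apply: smooth_eq (@smooth_cst _ _ U (1 : R^o)) => // x _; rewrite big_nil.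
by apply: smooth_eq (smoothM oU (sf i) IH) => // x _; rewrite big_cons.
Qed.

Lemma smoothV V (U : set V) (f : V -> R^o) : open U ->
  (forall x, U x -> f x != 0) -> smooth_on U f ->
  smooth_on U (fun x => (f x)^-1 : R^o).
Proof.
move=> oU f0 sf k; elim: k => [|k IH].
  by move=> x Ux; apply: cvgV; [exact: f0|exact: smooth_cont sf Ux].
split=> [x Ux|v].
  by apply: (@differentiableV _ _ f); [exact: smooth_diff sf Ux|exact: f0].
have := C_onM oU (C_onM oU IH IH) (smoothN oU (smooth_dir v sf) k).
apply: C_on_eq => // x Ux.
rewrite (@diffV _ _ f) //; [|exact: smooth_diff sf Ux|exact: f0].
rewrite /= expr2 invfM mulrN -mulNr; exact: erefl.
Qed.

Lemma smooth_pair V W X (U : set V) (f : V -> W) (g : V -> X) : open U ->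
  smooth_on U f -> smooth_on U g -> smooth_on U (fun x => (f x, g x)).
Proof.
move=> oU sf sg k; elim: k f g sf sg => [|k IH] f g sf sg.
  by move=> x Ux; apply: cvg_pair; [apply: smooth_cont sf Ux|apply: smooth_cont sg Ux].
split=> [x Ux|v].
  by apply: differentiable_pair; [apply: smooth_diff sf Ux|apply: smooth_diff sg Ux].
have := IH _ _ (smooth_dir v sf) (smooth_dir v sg).
apply: C_on_eq => // x Ux.
by rewrite diff_pair //; [apply: smooth_diff sf Ux|apply: smooth_diff sg Ux].
Qed.

(** A finite spanning family with continuous coordinate functionals. [C_on] controls derivatives in
    fixed directions only; expanding in [b] is what controls a derivative taken in a moving
    direction, as in the chain rule. *)
Definition findim V := exists (I : finType) (b : I -> V) (l : I -> {linear V -> R^o}),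
  (forall i, continuous (l i)) /\ forall x, x = \sum_i l i x *: b i.

Lemma findim_smooth V W (U : set V) (f : V -> W) (I : finType) (b : I -> W)
    (l : I -> {linear W -> R^o}) : open U ->
  (forall i, continuous (l i)) -> (forall x, x = \sum_i l i x *: b i) ->
  (forall i, smooth_on U (fun x => l i (f x))) -> smooth_on U f.
Proof.
move=> oU cl lE sf.
have := smooth_sum (index_enum _) oU (fun i (_ : xpredT i) => smooth_scaler (b i) oU (sf i)).
by apply: smooth_eq => // x _; rewrite -lE.
Qed.

Lemma C_on_comp V W k (U : set V) (O : set W) (f : V -> W) (g : W -> R^o) :
  findim W -> open U -> (forall x, U x -> O (f x)) ->
  smooth_on U f -> smooth_on O g -> C_on k U (fun x => g (f x)).
Proof.
move=> [m [b [l [cl lE]]]] oU fO sf; elim: k g => [|k IH] g sg.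
  move=> x Ux; apply: continuous_comp; first exact: smooth_cont sf Ux.
  by apply: smooth_cont sg _; apply: fO.
split=> [x Ux|v].
  by apply: (differentiable_comp (smooth_diff sf Ux)); apply: smooth_diff sg (fO _ Ux).
have h i : C_on k U (fun x => l i ('d f x v) * 'd g (f x) (b i) : R^o).
  apply: C_onM => //; last by apply: (IH (fun y => 'd g y (b i))); apply: smooth_dir.
  by apply: C_on_lin_comp => //; apply: smooth_dir.
have : C_on k U (fun x => \sum_i l i ('d f x v) * 'd g (f x) (b i) : R^o).
  elim: (index_enum _) => [|i r IHr].
    by apply: C_on_eq (@C_on_cst _ _ _ U 0) => // x _; rewrite big_nil.
  by apply: C_on_eq (C_onD oU (h i) IHr) => // x _; rewrite big_cons.
apply: C_on_eq => // x Ux.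
rewrite (@diff_comp _ _ _ _ f g) /=; [|exact: smooth_diff sf Ux|exact: smooth_diff sg (fO _ Ux)].
rewrite {2}(lE ('d f x v)) linear_sum /=; apply: eq_bigr => i _.
by rewrite linearZ.
Qed.

Lemma smooth_comp V W X (U : set V) (O : set W) (f : V -> W) (g : W -> X) :
  findim W -> findim X -> open U -> open O -> (forall x, U x -> O (f x)) ->
  smooth_on U f -> smooth_on O g -> smooth_on U (fun x => g (f x)).
Proof.
move=> fW [m [b [l [cl lE]]]] oU oO fO sf sg.
apply: (findim_smooth oU cl lE) => i k.
apply: (C_on_comp (g := fun y => l i (g y)) _ fW oU fO sf).
exact: smooth_lin_comp.
Qed.

Lemma smooth_dirfield V W X (U : set V) (O : set W) (h Y : V -> W) (f : W -> X) :
  findim W -> findim X -> open U -> open O -> (forall x, U x -> O (h x)) ->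
  smooth_on U h -> smooth_on U Y -> smooth_on O f ->
  smooth_on U (fun x => 'd f (h x) (Y x)).
Proof.
move=> fW fX oU oO hO sh sY sf; have [m [b [l [cl lE]]]] := fX.
have [p [b' [l' [cl' lE']]]] := fW.
apply: (findim_smooth oU cl lE) => i.
have : smooth_on U (fun x => \sum_j l' j (Y x) * l i ('d f (h x) (b' j)) : R^o).
  apply: smooth_sum => // j _; apply: smoothM => //; first exact: smooth_lin_comp.
  apply: smooth_lin_comp => //.
  apply: (smooth_comp (g := fun y => 'd f y (b' j)) fW fX oU oO hO sh).
  exact: smooth_dir.
apply: smooth_eq => // x Ux; rewrite {2}(lE' (Y x)) !linear_sum.
by apply: eq_bigr => j _; rewrite !linearZ.
Qed.

Lemma findimR : findim R^o.
Proof.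
exists 'I_1, (fun=> 1), (fun=> idfun); split => [i x|x]; first exact: cvg_id.
by rewrite big_ord1 /= [RHS]mulr1.
Qed.

Lemma findim_rV n : findim 'rV[R]_n.
Proof.
have lin i : linear (fun x : 'rV[R]_n => x 0 i : R^o).
  by move=> a u v; rewrite !mxE.
pose lM i := GRing.isLinear.Build _ _ _ _ _ (lin i).
pose l i : {linear 'rV[R]_n -> R^o} := HB.pack (fun x : 'rV[R]_n => x 0 i : R^o) (lM i).
exists 'I_n, (@basis_vec R n), l; split => [i|x]; first exact: coord_continuous.
exact: row_sum_delta.
Qed.

Lemma findim_prod V W : findim V -> findim W -> findim (V * W)%type.
Proof.
move=> [m [b [l [cl lE]]]] [p [b' [l' [cl' lE']]]].
pose B (i : m + p) := match i with inl j => (b j, 0 : W) | inr j => (0 : V, b' j) end.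
pose L (i : m + p) : {linear (V * W)%type -> R^o} :=
  match i with inl j => l j \o fst | inr j => l' j \o snd end.
exists (m + p)%type, B, L; split => [[j|j] z|[x y]].
- by apply: continuous_comp; [exact: cvg_fst|exact: cl].
- by apply: continuous_comp; [exact: cvg_snd|exact: cl'].
rewrite big_sumType /= {1}(lE x) {1}(lE' y).
have E1 : \sum_i l i x *: (b i, 0 : W) = (\sum_i l i x *: b i, 0).
  elim/big_rec2: _ => // i c d _ ->; congr (_, _) => /=.
  by rewrite scaler0 addr0.
have E2 : \sum_i l' i y *: (0 : V, b' i) = (0, \sum_i l' i y *: b' i).
  elim/big_rec2: _ => // i c d _ ->; congr (_, _) => /=.
  by rewrite scaler0 addr0.
by rewrite E1 E2; congr (_, _) => /=; rewrite ?addr0 ?add0r.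
Qed.

Lemma smooth_rVP V n (U : set V) (f : V -> 'rV[R]_n) : open U ->
  (forall i, smooth_on U (fun x => f x 0 i : R^o)) <-> smooth_on U f.
Proof.
move=> oU.
have lin i : linear (fun x : 'rV[R]_n => x 0 i : R^o).
  by move=> a u v; rewrite !mxE.
pose lM i := GRing.isLinear.Build _ _ _ _ _ (lin i).
pose l i : {linear 'rV[R]_n -> R^o} := HB.pack (fun x : 'rV[R]_n => x 0 i : R^o) (lM i).
have cl i : continuous (l i) by exact: coord_continuous.
split=> [sf|sf i]; last exact: (smooth_lin_comp (cl i)).
apply: (@findim_smooth _ _ _ _ _ (@basis_vec R n) l) => // x; exact: row_sum_delta.
Qed.

Lemma diff_rV V n (f : V -> 'rV[R]_n) x v i : differentiable f x ->
  ('d f x v) 0 i = 'd (fun y => f y 0 i : R^o) x v.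
Proof.
move=> df.
have lin : linear (fun x : 'rV[R]_n => x 0 i : R^o).
  by move=> a u w; rewrite !mxE.
pose lM := GRing.isLinear.Build _ _ _ _ _ lin.
pose l : {linear 'rV[R]_n -> R^o} := HB.pack (fun x : 'rV[R]_n => x 0 i : R^o) lM.
have cl : continuous l by exact: coord_continuous.
have dl : differentiable l (f x) by apply: (@linear_differentiable R _ _ l (f x) cl).
have E : 'd (l \o f) x v = l ('d f x v) by rewrite diff_comp // [LHS]/comp diff_lin.
exact: esym E.
Qed.

Lemma smooth_det V n (U : set V) (f : V -> 'M[R]_n) : open U ->
  (forall i j, smooth_on U (fun x => f x i j : R^o)) ->
  smooth_on U (fun x => \det (f x) : R^o).
Proof.
move=> oU sf; apply: smooth_sum => // s _; apply: smoothM => //.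
  exact: smooth_cst.
exact: smooth_prod.
Qed.

(** Cramer's rule: the entries of the inverse are cofactors divided by the determinant. *)
Lemma smooth_invmx V n (U : set V) (f : V -> 'M[R]_n) i j : open U ->
  (forall i j, smooth_on U (fun x => f x i j : R^o)) ->
  (forall x, U x -> f x \in unitmx) ->
  smooth_on U (fun x => invmx (f x) i j : R^o).
Proof.
move=> oU sf uf.
have : smooth_on U (fun x => (\det (f x))^-1 * ((-1) ^+ (j + i) * \det (row' j (col' i (f x)))) : R^o).
  apply: smoothM => //.
    apply: smoothV => // [x /uf|]; last exact: smooth_det.
    by rewrite unitmxE unitfE.
  apply: smoothM => //; first exact: smooth_cst.
  apply: smooth_det => // k l; apply: smooth_eq (sf (lift j k) (lift i l)) => // x _.
  by rewrite !mxE.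
by apply: smooth_eq => // x Ux; rewrite /invmx (uf x Ux) !mxE /cofactor.
Qed.

Lemma is_derive_line V W (f : V -> W) x v (t : R) : differentiable f (x + t *: v) ->
  is_derive t (1 : R) (fun s : R => f (x + s *: v)) ('d f (x + t *: v) v).
Proof.
move=> df.
have dl : is_diff t (fun s : R => x + s *: v) (fun s => s *: v).
  have := is_diffD (is_diff_cst x t) (is_diff_scalel t v).
  by rewrite add0r; exact.
have dc : differentiable (f \o (fun s : R => x + s *: v)) t.
  by apply: differentiable_comp => //; apply: ex_diff.
apply: DeriveDef; first exact/derivable1_diffP.
have dd : differentiable (fun s : R => x + s *: v) t by apply: ex_diff.
rewrite deriveE // diff_comp //.
by rewrite [LHS]/comp diff_val scale1r.
Qed.

Lemma MVT_line V (f : V -> R^o) x v : (forall t : R, 0 <= t <= 1 -> differentiable f (x + t *: v)) ->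
  exists2 t : R, 0 <= t <= 1 & f (x + v) - f x = 'd f (x + t *: v) v.
Proof.
move=> df.
have [||t tI] := @MVT_segment R (fun s => f (x + s *: v)) (fun s => 'd f (x + s *: v) v) 0 1 ler01.
- by move=> t; rewrite in_itv /= => /andP[t0 t1]; apply: is_derive_line; apply: df; rewrite !ltW.
- apply: derivable_within_continuous => t; rewrite in_itv /= => tI.
  by have [] := is_derive_line (df t tI).
by rewrite scale1r scale0r addr0 subr0 mulr1 => ->; exists t.
Qed.

End Smooth.

(** * Symmetry of second derivatives *)

Section Schwarz.
Variables (R : realType) (V : normedModType R).
Implicit Types (f : V -> R^o) (x v w : V).

(* Both mixed derivatives are limits of the same second difference. *)
Lemma second_difference (U : set V) f x v w : open U -> smooth_on U f ->
  (forall t u : R, 0 <= t <= 1 -> 0 <= u <= 1 -> U (x + t *: v + u *: w)) ->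
  exists t u : R, [/\ 0 <= t <= 1, 0 <= u <= 1 &
    f (x + v + w) - f (x + v) - (f (x + w) - f x) =
    'd (fun y => 'd f y v) (x + t *: v + u *: w) w].
Proof.
move=> oU sf Uxvw.
have o01 : (0 : R) <= (1 : R) <= (1 : R) by rewrite ler01 lexx.
have z01 : (0 : R) <= (0 : R) <= (1 : R) by rewrite lexx ler01.
have Ux0 (t : R) : 0 <= t <= 1 -> U (x + t *: v).
  by move=> t01; have := Uxvw t 0 t01 z01; rewrite scale0r addr0.
have Ux1 (t : R) : 0 <= t <= 1 -> U (x + t *: v + w).
  by move=> t01; have := Uxvw t 1 t01 o01; rewrite scale1r.
pose sh := fun y : V => y + w.
have dsh y : is_diff y sh id.
  have := is_diffD (is_diff_id y) (is_diff_cst w y).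
  by rewrite addr0; exact.
have dfsh y : U (y + w) -> is_diff y (f \o sh) ('d f (y + w)).
  move=> Uy; have dy : differentiable f (sh y) by apply: smooth_diff sf _.
  exact: (is_diff_comp (dsh y) (differentiableP dy)).
have dg (t : R) : 0 <= t <= 1 ->
    is_diff (x + t *: v) ((f \o sh) - f) (('d f (x + t *: v + w) : V -> R^o) - ('d f (x + t *: v) : V -> R^o)).
  move=> t01; apply: (is_diffB (dfsh _ _)); first exact: Ux1.
  by apply: differentiableP; apply: smooth_diff sf _; exact: Ux0.
(* The mean value theorem is applied to [f (y + w) - f y] along v and then to ['d f _ v] along w;
   each use turns one of the two differences into a derivative. *)
have [|t t01 E1] := @MVT_line _ _ ((f \o sh) - f) x v.
  by move=> t t01; have [] := dg t t01.
have [|u u01 E2] := @MVT_line _ _ (fun y => 'd f y v) (x + t *: v) w.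
  by move=> u u01; apply: smooth_diff (smooth_dir v sf) _; exact: Uxvw.
exists t, u; split => //; rewrite -E2.
move: E1; rewrite (@diff_val _ _ _ _ _ _ _ (dg t t01)).
exact.
Qed.

(** If the mixed derivatives at x were 2e apart, both would stay within e of their values at x on a
    small ball. The second difference over the parallelogram with sides s v and s w is s^2 times
    each of them at some point of that ball, which is a contradiction. *)
Lemma diff_sym (U : set V) f x v w : open U -> smooth_on U f -> U x ->
  'd (fun y => 'd f y v) x w = 'd (fun y => 'd f y w) x v.
Proof.
move=> oU sf Ux.
apply/eqP/negPn/negP => neq.
set a := fun y => 'd (fun y => 'd f y v) y w.
set b := fun y => 'd (fun y => 'd f y w) y v.
pose e := `|a x - b x| / 2.
have e0 : 0 < e by rewrite divr_gt0 // normr_gt0 subr_eq0.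
have ca : {for x, continuous a}.
  by apply: smooth_cont Ux; do 2 apply: smooth_dir.
have cb : {for x, continuous b}.
  by apply: smooth_cont Ux; do 2 apply: smooth_dir.
have : \forall y \near x, [/\ U y, `|a x - a y| < e & `|b x - b y| < e].
  near=> y; split.
  - by near: y; apply: open_nbhs_nbhs.
  - by near: y; move/cvgrPdist_lt : ca; apply.
  - by near: y; move/cvgrPdist_lt : cb; apply.
move=> /nbhs_ballP[d /= d0 dP].
pose c := 1 + `|v| + `|w|.
have c0 : 0 < c by rewrite /c -addrA ltr_wpDr ?ltr01 // addr_ge0.
(* Points x + t s v + u s w with t and u in [0, 1] are at distance at most s (|v| + |w|) <= s c < d
   from x; the summand 1 in c keeps it positive. *)
have [s s0 Hs] : exists2 s : R, 0 < s & s * c < d.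
  exists (d / c / 2); first by rewrite !divr_gt0.
  by rewrite mulrAC divfK ?gt_eqF // ltr_pdivrMr // ltr_pMr // ltr1n.
have inb (t u : R) : 0 <= t <= 1 -> 0 <= u <= 1 ->
    ball x d (x + t *: (s *: v) + u *: (s *: w)).
  move=> /andP[t0 t1] /andP[u0 u1]; rewrite -ball_normE /=.
  rewrite -addrA opprD addrA subrr sub0r normrN.
  apply: (le_lt_trans (ler_normD _ _)); rewrite !normrZ (ger0_norm t0) (ger0_norm u0) (ger0_norm (ltW s0)).
  apply: le_lt_trans Hs.
  have h r (z : V) : 0 <= r <= 1 -> r * (s * `|z|) <= s * `|z|.
    by move=> /andP[r0 r1]; rewrite -[leRHS]mul1r ler_wpM2r // mulr_ge0 // ltW.
  have ht := h t v; have hu := h u w; rewrite t0 t1 in ht; rewrite u0 u1 in hu.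
  apply: (le_trans (lerD (ht isT) (hu isT))).
  by rewrite -mulrDr ler_wpM2l ?(ltW s0) // /c -addrA lerDr ler01.
have scl v' w' : (forall y, ball x d y -> differentiable (fun y => 'd f y v') y) ->
   forall y, ball x d y ->
    'd (fun y => 'd f y (s *: v')) y (s *: w') =
    s * s * 'd (fun y => 'd f y v') y w'.
  move=> df y By.
  have -> : (fun y => 'd f y (s *: v')) = s *: (fun y => 'd f y v').
    by apply/funext => z; rewrite linearZ.
  rewrite (diffZ s (df y By)) -[LHS]/(s * 'd (fun y => 'd f y v') y (s *: w')).
  by rewrite linearZ -mulrA.
have dfU v' y : ball x d y -> differentiable (fun y => 'd f y v') y.
  by move=> /dP[Uy _ _]; apply: smooth_diff Uy; apply: smooth_dir.
have inb' : forall p q : R, 0 <= p <= 1 -> 0 <= q <= 1 ->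
    ball x d (x + p *: (s *: w) + q *: (s *: v)).
  by move=> p q p1 q1; rewrite addrAC; apply: inb.
have [|t [u [t01 u01 E1]]] := @second_difference U f x (s *: v) (s *: w) oU sf.
  by move=> t u t01 u01; have [] := dP _ (inb t u t01 u01).
have [|t' [u' [t01' u01' E2]]] := @second_difference U f x (s *: w) (s *: v) oU sf.
  by move=> t1 u1 t11 u11; have [] := dP _ (inb' t1 u1 t11 u11).
rewrite scl in E1; [|exact: dfU|exact: inb].
rewrite scl in E2; [|exact: dfU|exact: inb'].
have ab : a (x + t *: (s *: v) + u *: (s *: w)) = b (x + t' *: (s *: w) + u' *: (s *: v)).
  have ss : s * s != 0 by rewrite mulf_neq0 ?gt_eqF.
  apply: (mulfI ss); rewrite -E1 -E2 [x + s *: v + s *: w]addrAC.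
  have aux (p q r o : R) : p - q - (r - o) = p - r - (q - o) by ring.
  exact: aux.
have [_ Ha _] := dP _ (inb t u t01 u01).
have [_ _ Hb] := dP _ (inb' t' u' t01' u01').
rewrite -ab in Hb.
have : `|a x - b x| < e + e.
  apply: le_lt_trans (ltrD Ha Hb).
  by rewrite (distrC (b x)) -[X in `|X|](subrKA (a (x + t *: (s *: v) + u *: (s *: w)))) ler_normD.
by rewrite /e -splitr ltxx.
Unshelve. all: by end_near. Qed.

End Schwarz.

(** * Poincare lemmas *)

Section UnitIntegral.
Variable R : realType.
Implicit Types (u v : R -> R^o).

Definition int01 u : R := (\int[@lebesgue_measure R]_(t in `[0%R, 1%R]) u t)%R.

(** Continuity is two-sided even at 0 and 1: the integrands are taken along rays that run a little
    past the unit interval inside an open set. *)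
Definition cont01 u := forall t : R, 0 <= t <= 1 -> {for t, continuous u}.

Lemma cont01_integrable u : cont01 u ->
  (@lebesgue_measure R).-integrable `[0%R, 1%R] (EFin \o u).
Proof.
move=> cu; apply: continuous_compact_integrable; first exact: segment_compact.
apply: continuous_in_subspaceT => t; rewrite inE /= in_itv /= => tI.
exact: cu.
Qed.

Lemma cont01D u v : cont01 u -> cont01 v -> cont01 (fun t => u t + v t).
Proof. by move=> cu cv t tI; apply: cvgD; [exact: cu|exact: cv]. Qed.

Lemma cont01B u v : cont01 u -> cont01 v -> cont01 (fun t => u t - v t).
Proof. by move=> cu cv t tI; apply: cvgB; [exact: cu|exact: cv]. Qed.

Lemma cont01M u v : cont01 u -> cont01 v -> cont01 (fun t => u t * v t).
Proof. by move=> cu cv t tI; apply: cvgM; [exact: cu|exact: cv]. Qed.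

Lemma cont01_cst c : cont01 (fun=> c).
Proof. by move=> t _; apply: cst_continuous. Qed.

Lemma int01D u v : cont01 u -> cont01 v ->
  int01 (fun t => u t + v t) = int01 u + int01 v.
Proof. by move=> cu cv; apply: RintegralD => //; apply: cont01_integrable. Qed.

Lemma int01B u v : cont01 u -> cont01 v ->
  int01 (fun t => u t - v t) = int01 u - int01 v.
Proof. by move=> cu cv; apply: RintegralB => //; apply: cont01_integrable. Qed.

Lemma int01Z c u : cont01 u -> int01 (fun t => c * u t) = c * int01 u.
Proof. by move=> cu; apply: RintegralZl => //; apply: cont01_integrable. Qed.

Lemma eq_int01 u v : (forall t : R, 0 <= t <= 1 -> u t = v t) -> int01 u = int01 v.
Proof.
by move=> uv; apply: eq_Rintegral => t; rewrite inE /= in_itv /=; apply: uv.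
Qed.

Lemma int01_le c u : cont01 u -> (forall t : R, 0 <= t <= 1 -> `|u t| <= c) ->
  `|int01 u| <= c.
Proof.
move=> cu uc; apply: le_trans (le_normr_Rintegral _ _) _ => //.
  exact: cont01_integrable.
have -> : c = int01 (fun=> c).
  rewrite /int01 Rintegral_cst //= lebesgue_measure_itv /= lte_fin ltr01.
  by rewrite oppr0 adde0 mulr1.
apply: le_Rintegral => //.
- apply: (@cont01_integrable (fun t => `|u t|)) => t tI.
  by apply: cvg_norm; exact: cu.
- by apply: cont01_integrable; exact: cont01_cst.
Qed.

Lemma int01_FTC (F f : R -> R^o) : cont01 f ->
  (forall t : R, 0 <= t <= 1 -> is_derive t (1 : R) F (f t)) ->
  int01 f = F 1 - F 0.
Proof.
move=> cf dF; rewrite /int01 /Rintegral.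
have cF t : 0 <= t <= 1 -> {for t, continuous F}.
  move=> tI; have [d _] := dF t tI.
  by apply: differentiable_continuous; apply/derivable1_diffP.
rewrite (@continuous_FTC2 _ f F) //.
- apply: continuous_in_subspaceT => t; rewrite inE /= in_itv /=; exact: cf.
- split.
  + by move=> t; rewrite in_itv /= => /andP[t0 t1]; have [|] := dF t; rewrite ?ltW.
  + by apply: cvg_at_right_filter; apply: cF; rewrite lexx ler01.
  + by apply: cvg_at_left_filter; apply: cF; rewrite ler01 lexx.
- move=> t; rewrite in_itv /= => /andP[t0 t1]; rewrite derive1E.
  by have [|] := dF t; rewrite ?ltW.
Qed.

End UnitIntegral.

Section Ray.
Variables (R : realType) (V : normedModType R).
Hypothesis fV : findim V.
Implicit Types (f g : V -> R^o) (U : set V).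

Definition starshaped U := forall x (t : R), U x -> 0 <= t <= 1 -> U (t *: x).

(** The integral in the homotopy operator of the Poincare lemma. The weight t^k is t^(p-1) for forms
    of degree p, and by the chain rule each derivative in x raises k by one. *)
Definition ray k f (x : V) : R^o := int01 (fun t => t ^+ k * f (t *: x)).

(** Continuity gives the estimate near each pair (t0, 0); compactness of [0, 1] makes it uniform in
    t. *)
Lemma star_unif U g x e : open U -> starshaped U -> smooth_on U g -> U x -> 0 < e ->
  \forall h \near (0 : V), forall t : R, 0 <= t <= 1 ->
    U (t *: (x + h)) /\ `|g (t *: (x + h)) - g (t *: x)| < e.
Proof.
move=> oU sU sg Ux e0.
have /compact_near_coveringP cI : compact `[0%R, 1%R : R] by exact: segment_compact.
have h2 : \forall h \near (0 : V), `[0%R, 1%R] `<=` (fun t : R =>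
   0 <= t <= 1 -> U (t *: (x + h)) /\ `|g (t *: (x + h)) - g (t *: x)| < e).
  apply: cI => /= t0; rewrite /= in_itv /= => t01.
  have cg : {for t0 *: x, continuous g} by apply: smooth_cont sg _; apply: sU.
  have m1 : (fun p : R * V => p.1 *: (x + p.2)) @ (t0, 0 : V) --> t0 *: x.
    rewrite -{2}[x]addr0; apply: cvgZ; first exact: cvg_fst.
    by apply: cvgD; [exact: cvg_cst|exact: cvg_snd].
  have m2 : (fun p : R * V => p.1 *: x) @ (t0, 0 : V) --> t0 *: x.
    by apply: cvgZ; [exact: cvg_fst|exact: cvg_cst].
  have e20 : 0 < e / 2 by rewrite divr_gt0.
  have U1 : nbhs (t0 *: x) U by apply: open_nbhs_nbhs; split=> //; apply: sU.
  have g1 : \forall y \near t0 *: x, `|g (t0 *: x) - g y| < e / 2.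
    by move/cvgrPdist_lt : cg; apply.
  have n1 : \forall p \near (t0, 0 : V), U (p.1 *: (x + p.2)) /\
      `|g (t0 *: x) - g (p.1 *: (x + p.2))| < e / 2.
    have UI : nbhs (t0 *: x) (U `&` [set y | `|g (t0 *: x) - g y| < e / 2]) by exact: filterI.
    exact: m1 _ UI.
  have n2 : \forall p \near (t0, 0 : V), `|g (t0 *: x) - g (p.1 *: x)| < e / 2 := m2 _ g1.
  have : \forall p \near (t0, 0 : V), 0 <= p.1 <= 1 ->
      U (p.1 *: (x + p.2)) /\ `|g (p.1 *: (x + p.2)) - g (p.1 *: x)| < e; last exact.
  near=> p => _.
  have [Up Hp] : U (p.1 *: (x + p.2)) /\
      `|g (t0 *: x) - g (p.1 *: (x + p.2))| < e / 2 by near: p.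
  have Hp2 : `|g (t0 *: x) - g (p.1 *: x)| < e / 2 by near: p.
  split => //.
  rewrite -(subrKA (g (t0 *: x))) (splitr e); apply: le_lt_trans (ler_normD _ _) _.
  by rewrite ltrD // distrC.
by apply: filterS h2 => h H t tI; apply: H => //=; rewrite in_itv.
Unshelve. all: by end_near. Qed.

Lemma cont01_ray U f x k : open U -> starshaped U -> smooth_on U f -> U x ->
  cont01 (fun t => t ^+ k * f (t *: x)).
Proof.
move=> oU sU sf Ux t tI; apply: cvgM; first exact: exprn_continuous.
apply: (@continuous_comp _ _ _ (fun t : R => t *: x) f); first exact: scalel_continuous.
by apply: smooth_cont sf _; apply: sU.
Qed.

(** Both terms together are the integral over [0, 1] of the derivative of t^(k+1) f(t x), whose
    value at 0 vanishes. *)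
Lemma ray_euler U f x k : open U -> starshaped U -> smooth_on U f -> U x ->
  k.+1%:R * ray k f x + ray k.+1 (fun y => 'd f y x) x = f x.
Proof.
move=> oU sU sf Ux.
have c1 := cont01_ray (k := k) oU sU sf Ux.
have c2 := cont01_ray (k := k.+1) oU sU (smooth_dir x sf) Ux.
have c3 : cont01 (fun t => k.+1%:R * (t ^+ k * f (t *: x))).
  by apply: cont01M => //; exact: cont01_cst.
rewrite /ray -int01Z // -int01D //.
transitivity ((1 : R) ^+ k.+1 * f ((1 : R) *: x) - (0 : R) ^+ k.+1 * f ((0 : R) *: x));
  last by rewrite expr1n mul1r scale1r expr0n mul0r subr0.
apply: (@int01_FTC _ (fun t => t ^+ k.+1 * f (t *: x))); first exact: cont01D.
move=> t tI.
have d1 : is_derive t (1 : R) (fun s : R => f (s *: x)) ('d f (t *: x) x).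
  have := @is_derive_line R V _ f 0 x t; rewrite add0r => H.
  have -> : (fun s : R => f (s *: x)) = (fun s => f (0 + s *: x)).
    by apply/funext => s; rewrite add0r.
  by apply: H; apply: smooth_diff sf _; apply: sU.
have d2 : is_derive t (1 : R) (fun s : R => s ^+ k.+1) (k.+1%:R * t ^+ k).
  have := @is_deriveX _ _ id k.+1 t (1 : R) 1 (is_derive_id _ _).
  by rewrite [_ *: _]mulr1 exprfctE; exact.
have := is_deriveM d2 d1.
rewrite [X in is_derive _ _ _ X]addrC; congr is_derive; congr (_ + _).
by rewrite /GRing.scale /= mulrC mulrA.
Qed.

End Ray.

Section RayDiff.
Variables (R : realType) (V : normedModType R).
Hypothesis fV : findim V.
Implicit Types (f g : V -> R^o) (U : set V).

Lemma int01_sum (I : Type) (r : seq I) (c : I -> R) (u : I -> R -> R^o) :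
  (forall i, cont01 (u i)) ->
  cont01 (fun t => \sum_(i <- r) c i * u i t) /\
  int01 (fun t => \sum_(i <- r) c i * u i t) = \sum_(i <- r) c i * int01 (u i).
Proof.
move=> cu; have cM i : cont01 (fun t => c i * u i t).
  by apply: cont01M => //; exact: cont01_cst.
elim: r => [|i r [IHc IH]].
  rewrite (_ : (fun t => _) = fun=> 0); last by apply/funext => t; rewrite big_nil.
  split; first exact: cont01_cst.
  rewrite big_nil; apply: normr0_eq0; apply/le_anti; rewrite normr_ge0 andbT.
  by apply: int01_le => [|t _]; [exact: cont01_cst | rewrite normr0].
rewrite (_ : (fun t => _) = fun t => c i * u i t + \sum_(j <- r) c j * u j t); last first.
  by apply/funext => t; rewrite big_cons.
by split; [exact: cont01D | rewrite int01D // IH int01Z // big_cons].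
Qed.

Lemma ray_sum U (I : Type) (r : seq I) (c : I -> R) (g : I -> V -> R^o) x k :
  open U -> starshaped U -> U x -> (forall i, smooth_on U (g i)) ->
  ray k (fun y => \sum_(i <- r) c i * g i y) x = \sum_(i <- r) c i * ray k (g i) x.
Proof.
move=> oU sU Ux sg; rewrite /ray.
have [_ <-] := int01_sum r c (fun i => cont01_ray (k := k) oU sU (sg i) Ux).
apply: eq_int01 => t _; rewrite mulr_sumr; apply: eq_bigr => i _.
by rewrite mulrCA.
Qed.

Lemma eq_ray U f g x k : starshaped U -> U x -> (forall y, U y -> f y = g y) ->
  ray k f x = ray k g x.
Proof. by move=> sU Ux fg; apply: eq_int01 => t tI; rewrite fg //; apply: sU. Qed.

(** Differentiation under the integral sign. The candidate differential D is linear in the direction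
    through finitely many partial derivatives, and [star_unif] bounds the error of the first-order
    expansion uniformly along the ray. *)
Lemma ray_diff U f x k v : open U -> starshaped U -> smooth_on U f -> U x ->
  differentiable (ray k f) x /\ 'd (ray k f) x v = ray k.+1 (fun y => 'd f y v) x.
Proof.
move=> oU sU sf Ux; have [I [b [l [cl lE]]]] := fV.
pose p i y := 'd f y (b i).
have sp i : smooth_on U (p i) by exact: smooth_dir.
have dfE y h : 'd f y h = \sum_i l i h * p i y.
  by rewrite {1}(lE h) linear_sum; apply: eq_bigr => i _; rewrite linearZ.
pose D h : R^o := \sum_i ray k.+1 (p i) x * l i h.
have linD : linear D.
  move=> a u w; rewrite /D scaler_sumr -big_split; apply: eq_bigr => i _ /=.
  by rewrite linearP mulrDr /GRing.scale /= mulrCA.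
pose DM := GRing.isLinear.Build _ _ _ _ _ linD.
pose DL : {linear V -> R^o} := HB.pack D DM.
have cD : continuous D.
  move=> h; apply: (@smooth_cont _ _ _ setT) => //; apply: smooth_sum => [|i _].
    exact: openT.
  apply: smoothM; [exact: openT|exact: smooth_cst|exact: smooth_lin].
have rayE h : ray k.+1 (fun y => 'd f y h) x = D h.
  rewrite (_ : (fun y => _) = fun y => \sum_i l i h * p i y); last exact/funext.
  by rewrite (ray_sum _ _ _ oU) //; apply: eq_bigr => i _; rewrite mulrC.
have Do : ray k f \o shift x = cst (ray k f x) + D +o_ 0 id.
  apply/eqaddoP => e e0.
  have /choice[K KP] : forall i, exists c : R, 0 < c /\ forall h, `|l i h| <= c * `|h|.
    by move=> i; have [c c0 cP] := linear_lipschitz (cl i); exists c.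
  (* Sum of the Lipschitz constants of the coordinate functionals: errors below e / M in every
     partial derivative add up to at most e |h|. *)
  pose M := 1 + \sum_i K i.
  have M0 : 0 < M by rewrite ltr_pwDl // sumr_ge0 // => i _; case: (KP i) => /ltW.
  have d0 : 0 < e / M by rewrite divr_gt0.
  have unif : \forall h \near (0 : V), forall i, forall t : R, 0 <= t <= 1 ->
      U (t *: (x + h)) /\ `|p i (t *: (x + h)) - p i (t *: x)| < e / M.
    by apply: filter_forall => i; apply: star_unif.
  have nU : \forall h \near (0 : V), U (x + h).
    have c : (fun h : V => x + h) @ (0 : V) --> x.
      by rewrite -{2}[x]addr0; apply: cvgD; [exact: cvg_cst|exact: cvg_id].
    by apply: c; exact: open_nbhs_nbhs.
  have := filterI unif nU => /(_ _)/nbhs_ballP[r /= r0 rP].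
  apply/nbhs_ballP; exists r => //= h Bh.
  have inr (s : R) : 0 <= s <= 1 -> ball (0 : V) r (s *: h).
    move=> /andP[s0 s1]; move: Bh; rewrite -!ball_normE /= !sub0r !normrN normrZ.
    by apply: le_lt_trans; rewrite ger0_norm // ler_piMl.
  have [_ Uh] := rP _ Bh.
  rewrite !fctE /= [h + x]addrC opprD addrA -rayE.
  have c1 := cont01_ray (k := k) oU sU sf Uh.
  have c2 := cont01_ray (k := k) oU sU sf Ux.
  have c3 := cont01_ray (k := k.+1) oU sU (smooth_dir h sf) Ux.
  rewrite /ray -int01B // -int01B //; last exact: cont01B.
  apply: int01_le; first by apply: cont01B => //; apply: cont01B.
  move=> t tI; have /andP[t0 t1] := tI.
  (* For each t the increment of f is a derivative at some t (x + s h) in the direction t h; the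
     factor t extracted from the direction raises the weight from t^k to t^(k+1). *)
  have [|s sI E] := @MVT_line _ _ f (t *: x) (t *: h).
    move=> s sI; apply: smooth_diff sf _.
    have [_ Us] := rP _ (inr s sI).
    by have := sU _ t Us tI; rewrite scalerDr scalerA mulrC -scalerA.
  rewrite scalerDr -mulrBr E exprSr -mulrA -mulrBr.
  rewrite (scalerA s) (mulrC s) -scalerA -scalerDr linearZ /= -mulrBr !normrM.
  rewrite normrX (ger0_norm t0).
  apply: (@le_trans _ _ `|'d f (t *: (x + s *: h)) h - 'd f (t *: x) h|).
    rewrite mulrA ler_piMl // mulr_ile1 ?exprn_ge0 ?exprn_ile1 //.
  rewrite !dfE -sumrB; apply: le_trans (ler_norm_sum _ _ _) _.
  apply: (@le_trans _ _ (\sum_i K i * `|h| * (e / M))).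
    apply: ler_sum => i _; rewrite -mulrBr normrM ler_pM //; first by case: (KP i).
    by apply: ltW; have [H _] := rP _ (inr s sI); have [] := H i t tI.
  rewrite -mulr_suml -mulr_suml mulrAC ler_wpM2r // mulrCA ler_piMr ?(ltW e0) //.
  by rewrite ler_pdivrMr // mul1r /M lerDr ler01.
have dE : 'd (ray k f) x = D :> (V -> R^o).
  exact: (@diff_unique R V R^o (ray k f) DL x cD Do).
split; last by rewrite rayE dE.
by apply/diff_locallyP; rewrite dE; split; [exact: cD|exact: Do].
Qed.

Lemma smooth_ray U f k : open U -> starshaped U -> smooth_on U f ->
  smooth_on U (ray k f).
Proof.
move=> oU sU sf m; elim: m f k sf => [|m IH] f k sf.
  by move=> x Ux; apply: differentiable_continuous; have [] := ray_diff k 0 oU sU sf Ux.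
split=> [x Ux|v]; first by have [] := ray_diff k 0 oU sU sf Ux.
apply: C_on_eq (IH _ k.+1 (smooth_dir v sf)) => // x Ux.
by have [_ ->] := ray_diff k v oU sU sf Ux.
Qed.

End RayDiff.

(* Made opaque below: comparing terms ['d f x v] with different [f] unfolds
   [diff], which is prohibitively slow. *)
Definition dd (R : realType) (V W : normedModType R) (f : V -> W) (x v : V) : W :=
  'd f x v.

Section DiffRules.
Variables (R : realType) (V W : normedModType R).
Implicit Types (F G : V -> W) (f g : V -> R^o) (x v : V) (U : set V).

Lemma ddE F x v : dd F x v = 'd F x v.
Proof. by []. Qed.

Lemma ddvD F x u v : dd F x (u + v) = dd F x u + dd F x v.
Proof. exact: linearD. Qed.

Lemma ddvB F x u v : dd F x (u - v) = dd F x u - dd F x v.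
Proof. exact: linearB. Qed.

Lemma ddv0 F x : dd F x 0 = 0.
Proof. exact: linear0. Qed.

Lemma ddvZ F x a v : dd F x (a *: v) = a *: dd F x v.
Proof. exact: linearZ. Qed.

Lemma ddv_sum F x (I : Type) (r : seq I) (v : I -> V) :
  dd F x (\sum_(i <- r) v i) = \sum_(i <- r) dd F x (v i).
Proof. exact: linear_sum. Qed.

Lemma dd_near F G x v : (\near x, F x = G x) -> differentiable F x -> dd G x v = dd F x v.
Proof. by move=> FG dF; have [_] := near_is_diff FG dF; rewrite /dd => ->. Qed.

Lemma dd_eq U F G x v : open U -> (forall y, U y -> F y = G y) -> U x ->
  differentiable F x -> dd G x v = dd F x v.
Proof.
by move=> oU FG Ux; apply: dd_near; apply: filterS (near_open oU Ux) => y /FG.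
Qed.

Lemma ddD F G x v : differentiable F x -> differentiable G x ->
  dd (fun y => F y + G y) x v = dd F x v + dd G x v.
Proof. move=> df dg; exact: (f_equal (fun h : V -> W => h v) (diffD df dg)). Qed.

Lemma ddB F G x v : differentiable F x -> differentiable G x ->
  dd (fun y => F y - G y) x v = dd F x v - dd G x v.
Proof. move=> df dg; exact: (f_equal (fun h : V -> W => h v) (diffB df dg)). Qed.

Lemma ddM f g x v : differentiable f x -> differentiable g x ->
  dd (fun y => f y * g y : R^o) x v = f x * dd g x v + g x * dd f x v.
Proof. move=> df dg; exact: (f_equal (fun h : V -> R => h v) (diffM df dg)). Qed.

Lemma ddC (a : W) x v : dd (fun=> a) x v = 0.
Proof. by rewrite /dd (_ : (fun=> a) = cst a) ?diff_cst. Qed.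

Lemma smooth_dd U F v : smooth_on U F -> smooth_on U (fun x => dd F x v).
Proof. exact: smooth_dir. Qed.

Lemma dd_sym U f x v w : open U -> smooth_on U f -> U x ->
  dd (fun y => dd f y v) x w = dd (fun y => dd f y w) x v.
Proof. exact: diff_sym. Qed.

Lemma ray_dd U f x k v : findim V -> open U -> starshaped U -> smooth_on U f -> U x ->
  dd (ray k f) x v = ray k.+1 (fun y => dd f y v) x.
Proof. by move=> fV oU sU sf Ux; have [] := ray_diff fV k v oU sU sf Ux. Qed.

Lemma ray_euler_dd U f x k : open U -> starshaped U -> smooth_on U f -> U x ->
  k.+1%:R * ray k f x + ray k.+1 (fun y => dd f y x) x = f x.
Proof. exact: ray_euler. Qed.

Lemma dd_MVT f x v : (forall t : R, 0 <= t <= 1 -> differentiable f (x + t *: v)) ->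
  exists2 t : R, 0 <= t <= 1 & f (x + v) - f x = dd f (x + t *: v) v.
Proof. exact: MVT_line. Qed.

Lemma dd_rV n (f : V -> 'rV[R]_n) x v i : differentiable f x ->
  (dd f x v) 0 i = dd (fun y => f y 0 i : R^o) x v.
Proof. exact: diff_rV. Qed.

Lemma dd_lin (l : {linear V -> W}) x v : continuous l -> dd l x v = l v.
Proof. by move=> cl; rewrite /dd diff_lin. Qed.

Lemma dd_id x v : dd (fun y : V => y) x v = v.
Proof. by have [_] := is_diff_id x; rewrite /dd => ->. Qed.

End DiffRules.

Lemma dd_comp (R : realType) (V W X : normedModType R) (f : V -> W) (g : W -> X) x v :
  differentiable f x -> differentiable g (f x) ->
  dd (fun y => g (f y)) x v = dd g (f x) (dd f x v).
Proof. move=> df dg; exact: (f_equal (fun h : V -> X => h v) (diff_comp df dg)). Qed.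

Lemma dd_pair (R : realType) (V W X : normedModType R) (f : V -> W) (g : V -> X) x v :
  differentiable f x -> differentiable g x ->
  dd (fun y => (f y, g y)) x v = (dd f x v, dd g x v).
Proof.
move=> df dg; exact: (f_equal (fun h : V -> (W * X)%type => h v) (diff_pair df dg)).
Qed.

Lemma smooth_dd_field (R : realType) (V W X : normedModType R) (U : set V) (O : set W)
    (h Y : V -> W) (f : W -> X) :
  findim W -> findim X -> open U -> open O -> (forall x, U x -> O (h x)) ->
  smooth_on U h -> smooth_on U Y -> smooth_on O f ->
  smooth_on U (fun x => dd f (h x) (Y x)).
Proof. exact: smooth_dirfield. Qed.

Opaque dd.

Section DiffRulesR.
Variables (R : realType) (V : normedModType R).
Implicit Types (f g : V -> R^o) (x v : V).

Lemma ddZ (a : R) f x v : differentiable f x ->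
  dd (fun y => a * f y : R^o) x v = a * dd f x v.
Proof.
move=> df; have dc : differentiable (fun=> a : R^o) x by exact: differentiable_cst.
by apply: (etrans (ddM v dc df)); rewrite ddC mulr0 addr0.
Qed.

Lemma ddN f x v : differentiable f x -> dd (fun y => - f y : R^o) x v = - dd f x v.
Proof.
move=> df; rewrite -mulN1r -(ddZ (-1) v df); congr (dd _ x v).
by apply/funext => y; rewrite mulN1r.
Qed.

Lemma differentiable_dsum (I : Type) (r : seq I) (f : I -> V -> R^o) x :
  (forall i, differentiable (f i) x) ->
  differentiable (fun y => \sum_(i <- r) f i y : R^o) x.
Proof.
move=> df; elim: r => [|i r IHd].
  rewrite (_ : (fun y => _) = fun=> 0); last by apply/funext => t; rewrite big_nil.
  exact: differentiable_cst.
rewrite (_ : (fun t => _) = fun t => f i t + \sum_(j <- r) f j t); last first.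
  by apply/funext => t; rewrite big_cons.
exact: (@differentiableD _ _ _ (f i) (fun t => \sum_(j <- r) f j t)).
Qed.

Lemma ddsum (I : Type) (r : seq I) (f : I -> V -> R^o) x v :
  (forall i, differentiable (f i) x) ->
  dd (fun y => \sum_(i <- r) f i y : R^o) x v = \sum_(i <- r) dd (f i) x v.
Proof.
move=> df; elim: r => [|i r IH].
  rewrite (_ : (fun y => _) = fun=> 0); last by apply/funext => t; rewrite big_nil.
  by rewrite big_nil ddC.
rewrite (_ : (fun t => _) = fun t => f i t + \sum_(j <- r) f j t); last first.
  by apply/funext => t; rewrite big_cons.
by rewrite (ddD v (df i) (differentiable_dsum _ df)) IH big_cons.
Qed.

End DiffRulesR.

Section Poincare.
Variables (R : realType) (n : nat).
Local Notation V := 'rV[R]_n.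
Implicit Types (f g : V -> R^o) (U : set V) (x v : V).

Definition pd (i : 'I_n) f x : R^o := dd f x (basis_vec R i).

Definition coord_lin (i : 'I_n) (x : V) : R^o := x 0 i.

Lemma coord_lin_linear i : linear (coord_lin i).
Proof. by move=> a u w; rewrite /coord_lin !mxE. Qed.

HB.instance Definition _ i := GRing.isLinear.Build _ _ _ _ (coord_lin i) (coord_lin_linear i).

Lemma dd_coord x v (i : 'I_n) : dd (fun y : V => y 0 i : R^o) x v = v 0 i.
Proof. exact: (@dd_lin _ _ _ (coord_lin i) x v (@coord_continuous R 1 n 0 i)). Qed.

Lemma smooth_coord U (i : 'I_n) : smooth_on U (fun y : V => y 0 i : R^o).
Proof. by apply: (@smooth_lin R V R^o U (coord_lin i)); exact: coord_continuous. Qed.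

Lemma dd_pd (W : normedModType R) (f : V -> W) x v :
  dd f x v = \sum_i v 0 i *: dd f x (basis_vec R i).
Proof.
rewrite {1}(row_sum_delta v) ddv_sum; apply: eq_bigr => i _.
by rewrite ddvZ.
Qed.

Lemma smooth_pd U f i : smooth_on U f -> smooth_on U (pd i f).
Proof. exact: smooth_dd. Qed.

Lemma pd_sym U f i j x : open U -> smooth_on U f -> U x ->
  pd i (pd j f) x = pd j (pd i f) x.
Proof. by move=> oU sf Ux; apply: dd_sym sf Ux. Qed.

Let fV : findim V := @findim_rV R n.

Lemma pd_coord_sum U (h : 'I_n -> V -> R^o) i x : open U ->
  (forall j, smooth_on U (h j)) -> U x ->
  pd i (fun y => \sum_j y 0 j * h j y : R^o) x = h i x + \sum_j x 0 j * pd i (h j) x.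
Proof.
move=> oU sh Ux; have dh j := smooth_diff (sh j) Ux.
have dc j := smooth_diff (@smooth_coord U j) Ux.
have dch j : differentiable (fun y : V => y 0 j * h j y : R^o) x.
  exact: (@differentiableM _ _ (fun y : V => y 0 j) (h j)).
rewrite /pd (ddsum _ _ dch).
under eq_bigr => j _ do rewrite (ddM (basis_vec R i) (dc j) (dh j)) dd_coord.
rewrite big_split /= addrC; congr (_ + _).
rewrite (bigD1 i) //= big1 => [|j ji]; first by rewrite mxE !eqxx mulr1 addr0.
by rewrite mxE eqxx /= (negPf ji) mulr0.
Qed.

(** The potential is the integral of the form along the ray from 0 to x. Closedness exchanges the
    indices in its derivative, which then is the left-hand side of the Euler formula with k = 0. *)
Lemma poincare1 U (om : 'I_n -> V -> R^o) : open U -> starshaped U ->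
  (forall i, smooth_on U (om i)) ->
  (forall i j x, U x -> pd i (om j) x = pd j (om i) x) ->
  exists phi : V -> R^o, smooth_on U phi /\ forall i x, U x -> pd i phi x = om i x.
Proof.
move=> oU sU som closed.
exists (fun x => \sum_j x 0 j * ray 0 (om j) x); split.
  apply: smooth_sum => // j _; apply: smoothM => //; first exact: smooth_coord.
  exact: smooth_ray.
move=> i x Ux; rewrite (pd_coord_sum _ oU) // => [|j]; last exact: smooth_ray.
rewrite -(ray_euler_dd 0 oU sU (som i) Ux) mul1r; congr (_ + _).
have -> : ray 1 (fun y => dd (om i) y x) x = ray 1 (fun y => \sum_j x 0 j * pd i (om j) y : R^o) x.
  apply: (eq_ray _ sU Ux) => y Uy; rewrite dd_pd; apply: eq_bigr => j _.
  by rewrite (closed i j y).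
rewrite (ray_sum _ _ _ oU) // => [|j]; last exact: smooth_pd.
by apply: eq_bigr => j _; rewrite /pd (ray_dd 0 _ fV oU sU (som j) Ux).
Qed.

(** The homotopy operator in degree two, hence the weight t. The curl of the potential consists of
    twice the ray integral of B and of derivatives of B, which closedness combines into the radial
    derivative; this is the Euler formula with k = 1. *)
Lemma poincare2 U (B : 'I_n -> 'I_n -> V -> R^o) : open U -> starshaped U ->
  (forall i j, smooth_on U (B i j)) ->
  (forall i j x, U x -> B i j x = - B j i x) ->
  (forall i j k x, U x -> pd k (B i j) x + pd i (B j k) x + pd j (B k i) x = 0) ->
  exists a : 'I_n -> V -> R^o, (forall i, smooth_on U (a i)) /\
    forall i j x, U x -> pd i (a j) x - pd j (a i) x = B i j x.
Proof.
move=> oU sU sB antiB closed.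
exists (fun j x => \sum_i x 0 i * ray 1 (B i j) x); split.
  move=> j; apply: smooth_sum => // i _; apply: smoothM => //; first exact: smooth_coord.
  exact: smooth_ray.
move=> c b x Ux.
have pdB i j k y : U y -> pd k (B i j) y = - pd k (B j i) y.
  move=> Uy; rewrite /pd -(ddN _ (smooth_diff (sB j i) Uy)).
  apply: (dd_eq _ oU _ Uy) => [z Uz|]; first by rewrite antiB ?opprK.
  exact: smooth_diff (smoothN oU (sB j i)) Uy.
rewrite !(pd_coord_sum _ oU) // => [|j|j]; [|exact: smooth_ray|exact: smooth_ray].
have E j k l : pd l (ray 1 (B j k)) x = ray 2 (pd l (B j k)) x.
  exact: (ray_dd 1 _ fV oU sU (sB j k) Ux).
under eq_bigr => j _ do rewrite E.
under [X in _ - (_ + X)]eq_bigr => j _ do rewrite E.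
rewrite -!(ray_sum _ _ _ oU) //; try by move=> j; exact: smooth_pd.
have cS i j k : smooth_on U (fun y => x 0 i * pd k (B i j) y : R^o).
  by apply: smoothM => //; [exact: smooth_cst|exact: smooth_pd].
have -> : ray 1 (B b c) x = - ray 1 (B c b) x.
  rewrite /ray -mulN1r -int01Z; last exact: (cont01_ray oU sU (sB c b) Ux).
  by apply: eq_int01 => t tI; rewrite (antiB b c _ (sU x t Ux tI)) mulN1r mulrN.
(* By skew-symmetry both product-rule terms are [ray 1 (B c b) x]; they supply the factor 2 of the
   Euler formula. *)
rewrite opprD opprK addrACA -mulr2n -mulr_natl.
rewrite -(ray_euler_dd 1 oU sU (sB c b) Ux); congr (_ + _).
have cR j k : cont01 (fun t : R => t ^+ 2 * \sum_i x 0 i * pd k (B i j) (t *: x)).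
  exact: (cont01_ray (f := fun y => \sum_i x 0 i * pd k (B i j) y) oU sU
           (smooth_sum (index_enum _) oU (fun i (_ : xpredT i) => cS i j k)) Ux).
rewrite /ray -int01B; [|exact: cR|exact: cR].
apply: eq_int01 => t tI; rewrite -mulrBr; congr (_ * _).
have Ut := sU x t Ux tI.
rewrite -sumrB dd_pd; apply: eq_bigr => a _; rewrite -mulrBr; congr (_ * _).
have := closed a b c _ Ut; rewrite (pdB a c b _ Ut) -[dd (B c b) _ _]/(pd a (B c b) _) (pdB c b a _ Ut) opprK.
move=> H.
by rewrite -[RHS]add0r -H; ring.
Qed.

End Poincare.

(** * Charts and tangent bundles *)

Lemma smooth_fst (R : realType) (V W : normedModType R) (U : set (V * W)) :
  smooth_on U (fst : V * W -> V).
Proof. by apply: (@smooth_lin R _ _ U fst) => x; exact: cvg_fst. Qed.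

Lemma smooth_snd (R : realType) (V W : normedModType R) (U : set (V * W)) :
  smooth_on U (snd : V * W -> W).
Proof. by apply: (@smooth_lin R _ _ U snd) => x; exact: cvg_snd. Qed.

(** Leibniz rule for the derivative of f along a field Y: one term freezes Y at x, the other
    differentiates Y. The second kind of term is what survives in a bracket. *)
Lemma dd_dd_field (R : realType) (V : normedModType R) (U : set V) (f : V -> R^o)
    (Y : V -> V) x u : findim V -> open U -> smooth_on U f -> smooth_on U Y -> U x ->
  dd (fun y => dd f y (Y y)) x u = dd (fun y => dd f y (Y x)) x u + dd f x (dd Y x u).
Proof.
move=> [I [b [l [cl lE]]]] oU sf sY Ux.
have slY i : smooth_on U (fun y => l i (Y y)) by apply: smooth_lin_comp.
have sfb i : smooth_on U (fun y => dd f y (b i)) by apply: smooth_dd.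
have dfE y v : dd f y v = \sum_i l i v * dd f y (b i).
  by rewrite {1}(lE v) ddv_sum; apply: eq_bigr => i _; rewrite ddvZ.
have dlY := smooth_diff (slY _) Ux; have dfb := smooth_diff (sfb _) Ux.
have dt i : differentiable (fun y => l i (Y y) * dd f y (b i) : R^o) x.
  exact: (smooth_diff (smoothM oU (slY i) (sfb i)) Ux).
have dt' i : differentiable (fun y => l i (Y x) * dd f y (b i) : R^o) x.
  exact: (smooth_diff (smoothM oU (@smooth_cst _ _ _ U (l i (Y x) : R^o)) (sfb i)) Ux).
have -> : (fun y => dd f y (Y y)) = fun y => \sum_i l i (Y y) * dd f y (b i).
  exact/funext.
have -> : (fun y => dd f y (Y x)) = fun y => \sum_i l i (Y x) * dd f y (b i).
  exact/funext.
rewrite (ddsum _ _ dt) (ddsum _ _ dt') (dfE x) -big_split /=; apply: eq_bigr => i _.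
rewrite (ddM _ (dlY i) (dfb i)) (ddZ _ _ (dfb i)); congr (_ + _).
rewrite [LHS]mulrC; congr (_ * _).
have dY := smooth_diff sY Ux.
have dl : differentiable (l i) (Y x) by apply: linear_differentiable; exact: cl.
by rewrite (dd_comp (g := l i) _ dY dl) dd_lin.
Qed.

Section Premanifold.
Variables (R : realType) (V : normedModType R) (M : Type) (A : atlas V M).
Hypothesis fV : findim V.
Implicit Types (c : chart V M) (q : M) (u : V) (U : set M).

(* The part of [manifold] used for calculus; it also holds for [tatlas]. *)
Definition premanifold :=
  [/\ forall q, charts A (chart_at A q) /\ dom (chart_at A q) q,
      forall c q, charts A c -> dom c q -> cinv c (cmap c q) = q &
      forall c c', charts A c -> charts A c' ->
        open (img c (dom c')) /\ smooth_on (img c (dom c')) (cmap c' \o cinv c)].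

Hypothesis pA : premanifold.

Let ca q : charts A (chart_at A q). Proof. by have [/(_ q)[]] := pA. Qed.
Let da q : dom (chart_at A q) q. Proof. by have [/(_ q)[]] := pA. Qed.

Lemma cmapK c q : charts A c -> dom c q -> cinv c (cmap c q) = q.
Proof. by have [_ + _] := pA; apply. Qed.

Lemma imgP c U x : charts A c -> img c U x ->
  [/\ dom c (cinv c x), U (cinv c x) & cmap c (cinv c x) = x].
Proof. by move=> cc [q [dq Uq] <-]; rewrite cmapK. Qed.

Lemma img_cmap c U q : dom c q -> U q -> img c U (cmap c q).
Proof. by move=> dq Uq; exists q. Qed.

Lemma imgS c U U' : U `<=` U' -> img c U `<=` img c U'.
Proof. by move=> sU _ [q [dq Uq] <-]; exists q => //; split => //; apply: sU. Qed.

Definition tr c c' : V -> V := cmap c' \o cinv c.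

Lemma open_tr c c' : charts A c -> charts A c' -> open (img c (dom c')).
Proof. by move=> cc cc'; have [_ _ /(_ c c' cc cc')[]] := pA. Qed.

Lemma smooth_tr c c' : charts A c -> charts A c' -> smooth_on (img c (dom c')) (tr c c').
Proof. by move=> cc cc'; have [_ _ /(_ c c' cc cc')[]] := pA. Qed.

Lemma diff_tr c c' x : charts A c -> charts A c' -> img c (dom c') x ->
  differentiable (tr c c') x.
Proof. by move=> cc cc'; apply: smooth_diff; apply: smooth_tr. Qed.

(* components in the chart c of the tangent vector u at q *)
Definition tcomp c q u : V := dd (tr (chart_at A q) c) (cmap (chart_at A q) q) u.

Lemma tcomp_chain c c' q u : charts A c -> charts A c' -> dom c q -> dom c' q ->
  dd (tr c c') (cmap c q) (tcomp c q u) = tcomp c' q u.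
Proof.
move=> cc cc' dq dq'; rewrite /tcomp.
set c0 := chart_at A q; set x := cmap c0 q.
have c0c : charts A c0 := ca q.
have xc : img c0 (dom c) x by apply: img_cmap => //; exact: da.
have xc' : img c0 (dom c') x by apply: img_cmap => //; exact: da.
have trx : tr c0 c x = cmap c q by rewrite /tr /= cmapK //; exact: da.
have dtr : differentiable (tr c c') (tr c0 c x).
  by rewrite trx; apply: diff_tr => //; apply: img_cmap.
rewrite -trx -(dd_comp u (diff_tr c0c cc xc) dtr).
have oI : open (img c0 (dom c) `&` img c0 (dom c')) by apply: openI; apply: open_tr.
apply: (dd_eq u oI) => [y [/(imgP c0c)[d1 d2 e] _]|//|]; last exact: diff_tr.
by rewrite /tr /= cmapK.
Qed.

Lemma tcomp_at q u : tcomp (chart_at A q) q u = u.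
Proof.
rewrite /tcomp -[RHS](dd_id (cmap (chart_at A q) q)).
apply: (dd_eq u (open_tr (ca q) (ca q))) => [y /(imgP (ca q))[_ _ e]||].
- by rewrite /tr /= e.
- by apply: img_cmap; exact: da.
- exact: ex_diff.
Qed.

Lemma tcomp_at_chart c q u : charts A c -> dom c q ->
  dd (tr c (chart_at A q)) (cmap c q) (tcomp c q u) = u.
Proof. by move=> cc dq; rewrite tcomp_chain ?tcomp_at. Qed.

Lemma tcomp_inj c q u v : charts A c -> dom c q -> tcomp c q u = tcomp c q v -> u = v.
Proof. by move=> cc dq E; rewrite -(tcomp_at_chart u cc dq) E tcomp_at_chart. Qed.

Lemma tcomp_surj c q w : charts A c -> dom c q ->
  tcomp c q (dd (tr c (chart_at A q)) (cmap c q) w) = w.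
Proof.
move=> cc dq; rewrite /tcomp.
set c0 := chart_at A q; set x := cmap c q.
have c0c : charts A c0 := ca q.
have xc : img c (dom c0) x by apply: img_cmap => //; exact: da.
have trx : tr c c0 x = cmap c0 q by rewrite /tr /= cmapK.
have dtr : differentiable (tr c0 c) (tr c c0 x).
  by rewrite trx; apply: diff_tr => //; apply: img_cmap => //; exact: da.
rewrite -trx -(dd_comp w (diff_tr cc c0c xc) dtr) -[RHS](dd_id x).
apply: (dd_eq w (open_tr cc c0c)) => [y /(imgP cc)[d1 d2 e]|//|]; last exact: ex_diff.
by rewrite /tr /= cmapK.
Qed.

Lemma vcompE (X : M -> V) c x : vcomp A X c x = tcomp c (cinv c x) (X (cinv c x)).
Proof. by rewrite /tcomp ddE. Qed.

(** Openness measured in charts. The carrier has no topology here, so that the notion also applies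
    to the tangent bundle, which is known through its atlas only. *)
Definition copen U := forall c, charts A c -> open (img c U).

Lemma copen_dom c : charts A c -> copen (dom c).
Proof. by move=> cc c' cc'; exact: open_tr. Qed.

Lemma copenI U U' : copen U -> copen U' -> copen (U `&` U').
Proof.
move=> oU oU' c cc; have := openI (oU c cc) (oU' c cc); congr open.
apply/seteqP; split; last by move=> _ [q [dq [Uq Uq']] <-]; split; apply: img_cmap.
move=> x [/(imgP cc)[d Ux e] /(imgP cc)[_ Ux' _]]; rewrite -e; exact: img_cmap.
Qed.

(* derivative of f : M -> W at q along the tangent vector u *)
Definition Dv (W : normedModType R) q u (f : M -> W) : W :=
  dd (f \o cinv (chart_at A q)) (cmap (chart_at A q) q) u.

Lemma lieDE X (f : M -> R) q : lieD A X f q = Dv q (X q) (f : M -> R^o).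
Proof. by rewrite /Dv ddE. Qed.

Lemma tcomp_Dv c q u : tcomp c q u = Dv q u (cmap c).
Proof. by []. Qed.

Section W.
Variable W : normedModType R.
Implicit Types f g : M -> W.

Lemma smooth_at c U f q : copen U -> smooth_fun A U f -> charts A c -> dom c q -> U q ->
  differentiable (f \o cinv c) (cmap c q).
Proof.
by move=> oU sf cc dq Uq; apply: (smooth_diff (sf c cc)); apply: img_cmap.
Qed.

(** The preferred chart of q may vary with q in an arbitrary way, so smoothness in q can be read
    only after the derivative has been moved to a fixed chart by the chain rule. *)
Lemma Dv_chart c U f q u : copen U -> smooth_fun A U f -> charts A c -> dom c q ->
  U q -> Dv q u f = dd (f \o cinv c) (cmap c q) (tcomp c q u).
Proof.
move=> oU sf cc dq Uq; rewrite /Dv /tcomp.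
set c0 := chart_at A q; set x := cmap c0 q.
have c0c : charts A c0 := ca q.
have xc : img c0 (dom c) x by apply: img_cmap => //; exact: da.
have trx : tr c0 c x = cmap c q by rewrite /tr /= cmapK //; exact: da.
have df : differentiable (f \o cinv c) (tr c0 c x).
  by rewrite trx; exact: smooth_at sf cc dq Uq.
rewrite -trx -(dd_comp u (diff_tr c0c cc xc) df).
apply: (dd_eq u (open_tr c0c cc)) => //.
  by move=> y /(imgP c0c)[d1 d2 e]; rewrite /tr /= cmapK.
by apply: (differentiable_comp (diff_tr c0c cc xc) df).
Qed.

Lemma Dv_eq U f g q u : copen U -> U q -> (forall p, U p -> f p = g p) ->
  smooth_fun A U f -> Dv q u g = Dv q u f.
Proof.
move=> oU Uq fg sf; rewrite /Dv.
apply: (dd_eq u (oU _ (ca q))) => [x /(imgP (ca q))[_ /fg]||] //.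
  by apply: img_cmap => //; exact: da.
by apply: (smooth_at oU sf (ca q)) => //; exact: da.
Qed.

Lemma smooth_fun_eq U f g : copen U -> (forall p, U p -> f p = g p) ->
  smooth_fun A U f -> smooth_fun A U g.
Proof.
move=> oU fg sf c cc; apply: smooth_eq (sf c cc); first exact: oU.
by move=> x /(imgP cc)[_ /fg].
Qed.

Lemma smooth_funS U U' f : U' `<=` U -> smooth_fun A U f -> smooth_fun A U' f.
Proof. by move=> sU sf c cc; apply: smoothS (sf c cc); exact: imgS. Qed.

Lemma smooth_fun_cst U (a : W) : smooth_fun A U (fun=> a).
Proof. by move=> c cc; exact: smooth_cst. Qed.

Lemma smooth_funD U f g : copen U -> smooth_fun A U f -> smooth_fun A U g ->
  smooth_fun A U (fun q => f q + g q).
Proof. by move=> oU sf sg c cc; apply: smoothD (oU c cc) (sf c cc) (sg c cc). Qed.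

Lemma Dv0 q f : Dv q 0 f = 0. Proof. exact: ddv0. Qed.
Lemma DvvD q u v f : Dv q (u + v) f = Dv q u f + Dv q v f. Proof. exact: ddvD. Qed.
Lemma DvvZ q a u f : Dv q (a *: u) f = a *: Dv q u f. Proof. exact: ddvZ. Qed.
Lemma Dvv_sum q (I : Type) (r : seq I) (u : I -> V) f :
  Dv q (\sum_(i <- r) u i) f = \sum_(i <- r) Dv q (u i) f.
Proof. exact: ddv_sum. Qed.

Lemma DvD U f g q u : copen U -> smooth_fun A U f -> smooth_fun A U g -> U q ->
  Dv q u (fun q => f q + g q) = Dv q u f + Dv q u g.
Proof.
by move=> oU sf sg Uq; apply: ddD; apply: smooth_at; eauto; exact: da.
Qed.

Lemma DvC q u (a : W) : Dv q u (fun=> a) = 0.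
Proof. exact: ddC. Qed.

End W.

Section Real.
Implicit Types f g : M -> R^o.

Lemma smooth_funM U f g : copen U -> smooth_fun A U f -> smooth_fun A U g ->
  smooth_fun A U (fun q => f q * g q : R^o).
Proof. by move=> oU sf sg c cc; apply: smoothM (oU c cc) (sf c cc) (sg c cc). Qed.

Lemma smooth_funB U f g : copen U -> smooth_fun A U f -> smooth_fun A U g ->
  smooth_fun A U (fun q => f q - g q : R^o).
Proof. by move=> oU sf sg c cc; apply: smoothB (oU c cc) (sf c cc) (sg c cc). Qed.

Lemma smooth_fun_sum U (I : Type) (r : seq I) (f : I -> M -> R^o) : copen U ->
  (forall i, smooth_fun A U (f i)) -> smooth_fun A U (fun q => \sum_(i <- r) f i q : R^o).
Proof.
move=> oU sf c cc.
exact: (smooth_sum r (oU c cc) (fun i (_ : xpredT i) => sf i c cc)).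
Qed.

Lemma smooth_fun_comp (W : normedModType R) U (f : M -> W) (O : set W) (K : W -> R^o) :
  findim W -> copen U -> open O -> (forall q, U q -> O (f q)) ->
  smooth_fun A U f -> smooth_on O K -> smooth_fun A U (fun q => K (f q) : R^o).
Proof.
move=> fW oU oO fO sf sK c cc.
apply: (smooth_comp fW (@findimR R) (oU c cc) oO _ (sf c cc) sK).
by move=> x /(imgP cc)[_ /fO].
Qed.

Lemma DvM U f g q u : copen U -> smooth_fun A U f -> smooth_fun A U g -> U q ->
  Dv q u (fun q => f q * g q : R^o) = f q * Dv q u g + g q * Dv q u f.
Proof.
move=> oU sf sg Uq; have df := smooth_at oU sf (ca q) (da q) Uq.
have dg := smooth_at oU sg (ca q) (da q) Uq.
by apply: (etrans (ddM u df dg)); rewrite /= cmapK.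
Qed.

Lemma DvB U f g q u : copen U -> smooth_fun A U f -> smooth_fun A U g -> U q ->
  Dv q u (fun q => f q - g q : R^o) = Dv q u f - Dv q u g.
Proof.
move=> oU sf sg Uq; have df := smooth_at oU sf (ca q) (da q) Uq.
have dg := smooth_at oU sg (ca q) (da q) Uq.
exact: ddB.
Qed.

Lemma DvZ U (a : R) f q u : copen U -> smooth_fun A U f -> U q ->
  Dv q u (fun q => a * f q : R^o) = a * Dv q u f.
Proof. by move=> oU sf Uq; apply: ddZ; exact: (smooth_at oU sf (ca q) (da q) Uq). Qed.

Lemma Dv_sum U (I : Type) (r : seq I) (f : I -> M -> R^o) q u : copen U ->
  (forall i, smooth_fun A U (f i)) -> U q ->
  Dv q u (fun q => \sum_(i <- r) f i q : R^o) = \sum_(i <- r) Dv q u (f i).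
Proof.
move=> oU sf Uq.
exact: (ddsum r u (fun i => smooth_at oU (sf i) (ca q) (da q) Uq)).
Qed.

Lemma Dv_comp (W : normedModType R) U (f : M -> W) (K : W -> R^o) q u :
  copen U -> smooth_fun A U f -> U q -> differentiable K (f q) ->
  Dv q u (fun q => K (f q) : R^o) = dd K (f q) (Dv q u f).
Proof.
move=> oU sf Uq dK; have df := smooth_at oU sf (ca q) (da q) Uq.
have E : (f \o cinv (chart_at A q)) (cmap (chart_at A q) q) = f q by rewrite /= cmapK.
rewrite -E in dK.
by apply: (etrans (dd_comp u df dK)); rewrite E.
Qed.

Lemma smooth_lieD U X f : copen U -> smooth_field A U X -> smooth_fun A U f ->
  smooth_fun A U (fun q => Dv q (X q) f).
Proof.
move=> oU sX sf c cc.
have := smooth_dd_field fV (@findimR R) (oU c cc) (oU c cc) (fun x h => h)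
  (h := fun x => x) _ (sX c cc) (sf c cc).
move=> /(_ _)H.
apply: smooth_eq (H _) => [|x Ux|]; first exact: oU.
  have [dx Ux' e] := imgP cc Ux.
  by rewrite /= (Dv_chart _ oU sf cc dx Ux') e vcompE.
by apply: (@smooth_lin R V V _ idfun) => y; exact: cvg_id.
Qed.

(** In each iterated derivative one term is a second derivative of f with frozen fields; these
    cancel by symmetry. The remaining terms differentiate the components of the fields, as in the
    coordinate definition of [bracket]. *)
Lemma bracketE U X Y f q : copen U -> smooth_field A U X -> smooth_field A U Y ->
  smooth_fun A U f -> U q ->
  Dv q (bracket A X Y q) f =
  Dv q (X q) (fun p => Dv p (Y p) f : R^o) - Dv q (Y q) (fun p => Dv p (X p) f : R^o).
Proof.
move=> oU sX sY sf Uq; set c := chart_at A q.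
have cc : charts A c := ca q.
have oi := oU c cc; set x := cmap c q.
have Ux : img c U x by apply: img_cmap => //; exact: da.
have cx : cinv c x = q by apply: cmapK => //; exact: da.
have key Z Z' : smooth_field A U Z -> Dv q (Z' q) (fun p => Dv p (Z p) f : R^o) =
    dd (fun y => dd (f \o cinv c) y (Z q)) x (Z' q) +
    dd (f \o cinv c) x (dd (vcomp A Z c) x (Z' q)).
  move=> sZ; have E := dd_dd_field (Z' q) fV oi (sf c cc) (sZ c cc) Ux.
  rewrite [vcomp A Z c x]vcompE cx tcomp_at in E; rewrite -E.
  rewrite -[LHS]/(dd ((fun p => Dv p (Z p) f : R^o) \o cinv c) x (Z' q)).
  apply: (dd_eq _ oi _ Ux) => [y Uy|].
    have [dy Uy' e] := imgP cc Uy.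
    by rewrite /= (Dv_chart _ oU sf cc dy Uy') e vcompE.
  apply: smooth_diff Ux.
  apply: (smooth_dd_field fV (@findimR R) oi oi (fun x h => h) _ (sZ c cc) (sf c cc)).
  by apply: (@smooth_lin R V V _ idfun) => y; exact: cvg_id.
rewrite !key // (dd_sym (X q) (Y q) oi (sf c cc) Ux) opprD addrACA subrr add0r.
by rewrite -ddvB /bracket !ddE.
Qed.

End Real.

End Premanifold.

(** * Induced charts of the tangent bundle and tangent maps *)

Section TangentBundle.
Variables (R : realType) (V : normedModType R) (M : Type) (A : atlas V M).
Hypothesis fV : findim V.
Hypothesis pA : premanifold A.
Implicit Types (c : chart V M) (q : M) (u : V) (U : set M).

Let ca q : charts A (chart_at A q). Proof. by have [/(_ q)[]] := pA. Qed.
Let da q : dom (chart_at A q) q. Proof. by have [/(_ q)[]] := pA. Qed.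

Lemma cmap_tchart c v : cmap (tchart A c) v = (cmap c v.1, tcomp A c v.1 v.2).
Proof. by rewrite /tcomp ddE. Qed.

Lemma cinv_tchart c z : cinv (tchart A c) z =
  (cinv c z.1, dd (tr c (chart_at A (cinv c z.1))) z.1 z.2).
Proof. by rewrite ddE. Qed.

Lemma img_tchartP c U z : charts A c ->
  img (tchart A c) (tau_preim U) z <-> img c U z.1.
Proof.
move=> cc; split=> [[v [dv Uv] <-]|Uz].
  by rewrite cmap_tchart; exact: img_cmap.
have [d1 d2 e] := imgP pA cc Uz.
exists (cinv (tchart A c) z); first by rewrite cinv_tchart; split.
rewrite cmap_tchart cinv_tchart /= e; case: z e Uz d1 d2 => x w /= e Ux d1 d2.
by have := tcomp_surj pA w cc d1; rewrite e => ->.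
Qed.

Lemma tchartK c v : charts A c -> dom c v.1 ->
  cinv (tchart A c) (cmap (tchart A c) v) = v.
Proof.
move=> cc dv; rewrite cmap_tchart cinv_tchart /= (cmapK pA) // (tcomp_at_chart pA) //.
by case: v {dv}.
Qed.

Lemma open_fst (W : normedModType R) (O : set V) : open O -> open [set z : V * W | O z.1].
Proof. by move=> oO; apply: open_comp oO => z _; exact: cvg_fst. Qed.

Lemma open_img_tchart c U : charts A c -> copen A U ->
  open (img (tchart A c) (tau_preim U)).
Proof.
move=> cc oU; have := @open_fst V _ (oU c cc); congr open.
by apply/seteqP; split => z /(img_tchartP U z cc).
Qed.

(** Both induced charts convert components through the preferred chart of the base point;
    [tcomp_chain] eliminates it. *)
Lemma tr_tchart c c' z : charts A c -> charts A c' -> img c (dom c') z.1 ->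
  tr (tchart A c) (tchart A c') z = (tr c c' z.1, dd (tr c c') z.1 z.2).
Proof.
move=> cc cc' /(imgP pA cc)[d1 d2 e].
rewrite -[LHS]/(cmap (tchart A c') (cinv (tchart A c) z)).
rewrite cinv_tchart cmap_tchart; congr (_, _).
rewrite -(tcomp_chain pA _ cc cc' d1 d2) e; congr (dd _ _ _).
by have := tcomp_surj pA z.2 cc d1; rewrite e.
Qed.

Lemma premanifold_tatlas : premanifold (tatlas A).
Proof.
split.
- by move=> v; split; [exists (chart_at A v.1)|exact: da].
- by move=> _ v [c cc <-]; exact: tchartK.
- move=> _ _ [c cc <-] [c' cc' <-].
  have oi : open (img (tchart A c) (dom (tchart A c'))).
    exact: (open_img_tchart cc (copen_dom pA cc')).
  split => //.
  have sI z : img (tchart A c) (dom (tchart A c')) z -> img c (dom c') z.1.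
    by move=> /(img_tchartP (dom c') z cc).
  have sT := smooth_tr pA cc cc'; have oT := open_tr pA cc cc'.
  apply: smooth_eq (smooth_pair oi (smooth_comp fV fV oi oT sI _ sT)
     (smooth_dd_field fV fV oi oT sI _ _ sT)) => //.
  + by move=> z /sI h; exact: (esym (tr_tchart cc cc' h)).
  + exact: smooth_fst.
  + exact: smooth_fst.
  + exact: smooth_snd.
Qed.

Lemma copen_tau U : copen A U -> copen (tatlas A) (tau_preim U).
Proof. by move=> oU _ [c cc <-]; exact: open_img_tchart. Qed.

Lemma smooth_fun_tau (W : normedModType R) U (f : M -> W) : findim W ->
  copen A U -> smooth_fun A U f ->
  smooth_fun (tatlas A) (tau_preim U) (fun v => f v.1).
Proof.
move=> fW oU sf _ [c cc <-].
have sI z : img (tchart A c) (tau_preim U) z -> img c U z.1.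
  by move=> /(img_tchartP U z cc).
exact: (smooth_comp fV fW (open_img_tchart cc oU) (oU c cc) sI (@smooth_fst _ _ _ _) (sf c cc)).
Qed.

Lemma Dv_tau (W : normedModType R) U (f : M -> W) v Z :
  copen A U -> smooth_fun A U f -> U v.1 ->
  Dv (tatlas A) v Z (fun v => f v.1) = Dv A v.1 Z.1 f.
Proof.
move=> oU sf Uv; have df := smooth_at oU sf (ca v.1) (da v.1) Uv.
set x := cmap (chart_at A v.1) v.1 in df.
have d1 : differentiable (fst : V * V -> V) (cmap (tchart A (chart_at A v.1)) v).
  exact: (smooth_diff (@smooth_fst R V V setT)).
have E := dd_comp (f := fst) (g := f \o cinv (chart_at A v.1)) Z d1 df.
rewrite -[LHS]/(dd (fun z : V * V => (f \o cinv (chart_at A v.1)) z.1)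
  (cmap (tchart A (chart_at A v.1)) v) Z) E /Dv; congr (dd _ _ _).
by rewrite (@dd_lin R (V * V)%type V fst) // => z; exact: cvg_fst.
Qed.

End TangentBundle.

Section TangentMap.
Variables (R : realType) (V W : normedModType R) (M N : Type).
Variables (A : atlas V M) (B : atlas W N) (F : M -> N).
Hypotheses (pA : premanifold A) (pB : premanifold B) (fV : findim V) (fW : findim W).
Hypothesis oF : forall c, charts B c -> copen A (F @^-1` dom c).
Hypothesis sF : smooth_map A B F.

Lemma tmapE q u : tmap A B F (q, u) =
  (F q, Dv A q u (cmap (chart_at B (F q)) \o F)).
Proof. by rewrite /Dv ddE. Qed.

Let ca q : charts A (chart_at A q). Proof. by have [/(_ q)[]] := pA. Qed.
Let da q : dom (chart_at A q) q. Proof. by have [/(_ q)[]] := pA. Qed.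
Let cb q : charts B (chart_at B q). Proof. by have [/(_ q)[]] := pB. Qed.
Let db q : dom (chart_at B q) q. Proof. by have [/(_ q)[]] := pB. Qed.

Lemma Dv_tmap (X : normedModType R) U (f : N -> X) q u :
  copen B U -> smooth_fun B U f -> U (F q) ->
  Dv B (F q) (tmap A B F (q, u)).2 f = Dv A q u (fun p => f (F p)).
Proof.
move=> oU sf UF; rewrite tmapE /= /Dv.
set c := chart_at A q; set c' := chart_at B (F q).
have cc : charts A c := ca q; have cc' : charts B c' := cb (F q).
have dF : differentiable (cmap c' \o F \o cinv c) (cmap c q).
  apply: (smooth_diff (sF cc cc')); apply: img_cmap; [exact: da|exact: db].
have xE : (cmap c' \o F \o cinv c) (cmap c q) = cmap c' (F q).
  by rewrite /= (cmapK pA) //; exact: da.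
have df := smooth_at oU sf cc' (db _) UF.
rewrite -xE in df *; rewrite -(dd_comp u dF df).
apply/esym; apply: (dd_eq u (oF cc' cc)) => [x|//|].
- by move=> /(imgP pA cc)[_ d _]; rewrite /= (cmapK pB).
- by apply: img_cmap; [exact: da|exact: db].
- exact: (differentiable_comp dF df).
Qed.

Lemma smooth_local (X Y : normedModType R) (U : set X) (f : X -> Y) :
  (forall x, U x -> exists O, O x /\ smooth_on O f) -> smooth_on U f.
Proof.
move=> loc k; elim: k f loc => [|k IH] f loc.
  by move=> x /loc[U0 [Ox sf]]; exact: smooth_cont sf Ox.
split=> [x /loc[U0 [Ox sf]]|v]; first exact: smooth_diff sf Ox.
by apply: IH => x /loc[U0 [Ox sf]]; exists U0; split => //; exact: smooth_dir.
Qed.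

Lemma smooth_fun_map (X : normedModType R) U (f : N -> X) : findim X ->
  copen B U -> copen A (F @^-1` U) -> smooth_fun B U f ->
  smooth_fun A (F @^-1` U) (fun p => f (F p)).
Proof.
move=> fX oU oFU sf c cc; apply: smooth_local => x Ux.
have [dx Ux' e] := imgP pA cc Ux.
set c' := chart_at B (F (cinv c x)).
have cc' : charts B c' := cb _.
exists (img c (F @^-1` dom c' `&` F @^-1` U)); split.
  by rewrite -e; apply: img_cmap => //; split => //; exact: db.
have oI : open (img c (F @^-1` dom c' `&` F @^-1` U)).
  exact: (copenI pA (oF cc') oFU cc).
have sF' : smooth_on (img c (F @^-1` dom c' `&` F @^-1` U)) (cmap c' \o F \o cinv c).
  by apply: smoothS (sF cc cc'); apply: imgS => p [].
have h y : img c (F @^-1` dom c' `&` F @^-1` U) y -> img c' U ((cmap c' \o F \o cinv c) y).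
  by move=> /(imgP pA cc)[d [d1 d2] _]; exact: img_cmap.
apply: (smooth_eq oI _ (smooth_comp fW fX oI (oU c' cc') h sF' (sf c' cc'))).
by move=> y /(imgP pA cc)[d [d1 d2] _]; rewrite /= (cmapK pB).
Qed.

Lemma tau_preim_tmap (c : chart W N) :
  tmap A B F @^-1` dom (tchart B c) = tau_preim (F @^-1` dom c).
Proof. by []. Qed.

Lemma smooth_cmap (c : chart W N) : charts B c -> smooth_fun B (dom c) (cmap c).
Proof. by move=> cc c' cc'; exact: (smooth_tr pB cc' cc). Qed.

Lemma smooth_tmap : smooth_map (tatlas A) (tatlas B) (tmap A B F).
Proof.
move=> _ _ [c cc <-] [c' cc' <-]; rewrite tau_preim_tmap.
have oI := open_img_tchart pA cc (oF cc').
have sI z : img (tchart A c) (tau_preim (F @^-1` dom c')) z -> img c (F @^-1` dom c') z.1.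
  by move=> /(img_tchartP pA (F @^-1` dom c') z cc).
apply: (smooth_eq oI _ (smooth_pair oI
   (smooth_comp fV fW oI (oF cc' cc) sI (@smooth_fst _ _ _ _) (sF cc cc'))
   (smooth_dd_field fV fW oI (oF cc' cc) sI (@smooth_fst _ _ _ _) (@smooth_snd _ _ _ _) (sF cc cc')))).
move=> z Iz; have [d1 d2 e] := imgP pA cc (sI z Iz).
rewrite -[RHS]/(cmap (tchart B c') (tmap A B F (cinv (tchart A c) z))).
rewrite cmap_tchart cinv_tchart.
set q := cinv c z.1; set u := dd (tr c _) _ _.
have -> : (tmap A B F (q, u)).1 = F q by [].
congr (_, _).
have sFc : smooth_fun A (F @^-1` dom c') (cmap c' \o F) by move=> c1 cc1; exact: sF.
rewrite tcomp_Dv (Dv_tmap u (copen_dom pB cc') (smooth_cmap cc')) //.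
rewrite (Dv_chart pA u (oF cc') sFc cc d1 d2) e; congr (dd _ _ _).
by have := tcomp_surj pA z.2 cc d1; rewrite e => ->.
Qed.

End TangentMap.

(** * Invariant frames *)

Section LieGroup.
Variables (R : realType) (n : nat) (G : topGroupType) (A : atlas 'rV[R]_n G).
Local Notation V := 'rV[R]_n.
Hypothesis hL : lie_group A.
Let fV : findim V := @findim_rV R n.

Let cc_at q : charts A (chart_at A q).
Proof. by have [[_ _ /(_ q)[]]] := hL. Qed.
Let dd_at q : dom (chart_at A q) q.
Proof. by have [[_ _ /(_ q)[]]] := hL. Qed.

Let chartP c : charts A c ->
  [/\ open (dom c), open (img c setT),
      forall q, dom c q -> cinv c (cmap c q) = q,
      forall q, dom c q -> {for q, continuous (cmap c)} &
      forall x, img c setT x -> {for x, continuous (cinv c)}].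
Proof. by have [[_ _ _ H _] _ _ _ _] := hL; apply: H. Qed.

Lemma open_dom c : charts A c -> open (dom c).
Proof. by case/chartP. Qed.

Lemma open_imgT c : charts A c -> open (img c setT).
Proof. by case/chartP. Qed.

Lemma cinv_cont c x : charts A c -> img c setT x -> {for x, continuous (cinv c)}.
Proof. by case/chartP => _ _ _ _; apply. Qed.

Lemma open_preim (X Y : topologicalType) (U : set X) (D : set Y) (h : X -> Y) :
  open U -> open D -> (forall x, U x -> {for x, continuous h}) -> open (U `&` h @^-1` D).
Proof.
move=> oU oD ch; rewrite openE => x [Ux Dx].
apply: filterI; first exact: open_nbhs_nbhs.
by apply: (ch x Ux); exact: open_nbhs_nbhs.
Qed.

Lemma open_img c U : charts A c -> open U -> open (img c U).
Proof.
move=> cc oU.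
have [_ _ cK _ _] := chartP cc.
have -> : img c U = img c setT `&` cinv c @^-1` U.
  apply/seteqP; split=> [_ [q [dq Uq] <-]|_ [[q [dq _] <-]]] /=.
    by split; [exists q|rewrite /= cK].
  by rewrite cK // => Uq; exists q.
by apply: open_preim => //; [exact: open_imgT|move=> x; exact: cinv_cont].
Qed.

Lemma copen_open U : open U -> copen A U.
Proof. by move=> oU c cc; exact: open_img. Qed.

Lemma premanifoldG : premanifold A.
Proof.
split=> // [c q cc dq|c c' cc cc'].
  by have [_ _ cK _ _] := chartP cc; exact: cK.
split; first by apply: open_img => //; exact: open_dom.
by have [[_ _ _ _ H] _ _ _ _] := hL; exact: (H c c' cc cc').
Qed.
Let pA := premanifoldG.

(** Smooth maps from a normed space into the group. Continuity is a separate clause because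
    smoothness is tested on preimages of chart domains, whose openness it provides. *)
Definition gsmooth (X : normedModType R) (U : set X) (h : X -> G) :=
  (forall x, U x -> {for x, continuous h}) /\
  forall c, charts A c -> smooth_on (U `&` h @^-1` dom c) (cmap c \o h).

Lemma mul_cont (X : topologicalType) (h1 h2 : X -> G) x : {for x, continuous h1} -> {for x, continuous h2} ->
  {for x, continuous (fun x => (h1 x * h2 x)%g)}.
Proof.
move=> c1 c2; have [_ cm _ _ _] := hL.
exact: (@continuous2_cvg _ _ _ _ _ _ _ _ (fun a b : G => (a * b)%g) (h1 x) (h2 x) (cm (h1 x, h2 x)) c1 c2).
Qed.

Section GS.
Variables (X : normedModType R) (fX : findim X) (U : set X).
Hypothesis oU : open U.
Implicit Types h : X -> G.

Lemma gs_cst (a : G) : gsmooth U (fun=> a).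
Proof. by split=> [x _|c cc]; [exact: cst_continuous|exact: smooth_cst]. Qed.

Lemma gs_open h D : gsmooth U h -> open D -> open (U `&` h @^-1` D).
Proof. by move=> [ch _] oD; apply: open_preim. Qed.

Lemma gs_fun (Y : normedModType R) h D (f : G -> Y) : findim Y -> gsmooth U h -> open D ->
  smooth_fun A D f -> smooth_on (U `&` h @^-1` D) (fun x => f (h x)).
Proof.
move=> fY gh oD sf; apply: smooth_local => x [Ux Dx].
set c := chart_at A (h x); have cc : charts A c := cc_at _.
exists ((U `&` h @^-1` dom c) `&` (U `&` h @^-1` D)); split.
  by split=> //; split => //; exact: dd_at.
have oI : open ((U `&` h @^-1` dom c) `&` (U `&` h @^-1` D)).
  by apply: openI; apply: gs_open => //; exact: open_dom.
have sI y : ((U `&` h @^-1` dom c) `&` (U `&` h @^-1` D)) y -> img c D ((cmap c \o h) y).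
  by move=> [[_ d1] [_ d2]]; exact: img_cmap.
have sh : smooth_on ((U `&` h @^-1` dom c) `&` (U `&` h @^-1` D)) (cmap c \o h).
  by apply: smoothS (gh.2 c cc) => y [].
apply: (smooth_eq oI _ (smooth_comp fV fY oI (open_img cc oD) sI sh (sf c cc))).
by move=> y [[_ d1] _]; rewrite /= (cmapK pA).
Qed.

End GS.

Lemma gs_cinv c : charts A c -> gsmooth (img c setT) (cinv c).
Proof.
move=> cc; split=> [x|c' cc']; first exact: cinv_cont.
apply: smoothS (smooth_tr pA cc cc') => x [] /(imgP pA cc)[d1 _ e] d2.
by rewrite -e; exact: img_cmap.
Qed.

Lemma gs_comp (X Y : normedModType R) (U : set X) (D : set Y) (h : Y -> G) (f : X -> Y) :
  findim X -> findim Y -> open U -> open D -> (forall x, U x -> D (f x)) ->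
  smooth_on U f -> gsmooth D h -> gsmooth U (fun x => h (f x)).
Proof.
move=> fX fY oU oD fD sf [ch sh]; split=> [x Ux|c cc].
  by apply: continuous_comp; [exact: smooth_cont sf Ux|apply: ch; exact: fD].
have oI : open (U `&` (fun x => h (f x)) @^-1` dom c).
  apply: open_preim => //; first exact: open_dom.
  by move=> x Ux; apply: continuous_comp; [exact: smooth_cont sf Ux|apply: ch; exact: fD].
have oJ : open (D `&` h @^-1` dom c) by apply: open_preim => //; exact: open_dom.
apply: (smooth_comp fY fV oI oJ _ _ (sh c cc)) => [x [Ux d]|]; first by split => //; exact: fD.
by apply: smoothS sf => x [].
Qed.

Lemma gs_mul (X : normedModType R) (U : set X) (h1 h2 : X -> G) : findim X -> open U ->
  gsmooth U h1 -> gsmooth U h2 -> gsmooth U (fun x => (h1 x * h2 x)%g).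
Proof.
move=> fX oU g1 g2.
have cm x : U x -> {for x, continuous (fun x => (h1 x * h2 x)%g)}.
  by move=> Ux; apply: mul_cont; [exact: g1.1|exact: g2.1].
split=> // c cc; apply: smooth_local => x [Ux Dx].
set c1 := chart_at A (h1 x); have cc1 : charts A c1 := cc_at _.
set c2 := chart_at A (h2 x); have cc2 : charts A c2 := cc_at _.
have fVV := findim_prod fV fV.
(* The domain on which the multiplication is read from [c1] and [c2] into [c]. The description [TE]
   by continuous maps shows that it is open. *)
set T := img (prod_chart c1 c2) ((fun p : G * G => (p.1 * p.2)%g) @^-1` dom c).
have TE : T = ([set z : V * V | img c1 setT z.1] `&` [set z : V * V | img c2 setT z.2]) `&`
    (fun z => (cinv c1 z.1 * cinv c2 z.2)%g) @^-1` dom c.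
  apply/seteqP; split=> [_ [[p1 p2] [/= [d1 d2] d] <-]|[x1 x2] /= [[[p1 [d1 _] <-] [p2 [d2 _] <-]]]] /=.
    split; last by rewrite /= (cmapK pA cc1 d1) (cmapK pA cc2 d2).
    by split; [exists p1|exists p2].
  by rewrite (cmapK pA cc1 d1) (cmapK pA cc2 d2) => d; exists (p1, p2).
have oT : open T.
  rewrite TE; apply: open_preim; [|exact: open_dom|].
    apply: openI; apply: open_comp; try exact: open_imgT.
      by move=> z _; exact: cvg_fst.
    by move=> z _; exact: cvg_snd.
  move=> z [/= i1 i2]; apply: mul_cont.
    by apply: (@continuous_comp _ _ _ fst (cinv c1)); [exact: cvg_fst|exact: cinv_cont].
  by apply: (@continuous_comp _ _ _ snd (cinv c2)); [exact: cvg_snd|exact: cinv_cont].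
set U' := (U `&` h1 @^-1` dom c1) `&` (U `&` h2 @^-1` dom c2) `&`
   (U `&` (fun x => (h1 x * h2 x)%g) @^-1` dom c).
have oU' : open U'.
  apply: openI; last by apply: open_preim => //; exact: open_dom.
  by apply: openI; apply: gs_open => //; exact: open_dom.
exists U'; split; first by split=> //; split; split => //; exact: dd_at.
have s1 : smooth_on U' (cmap c1 \o h1) by apply: smoothS (g1.2 c1 cc1) => y [[]].
have s2 : smooth_on U' (cmap c2 \o h2) by apply: smoothS (g2.2 c2 cc2) => y [[]].
have sm : smooth_on T (cmap c \o (fun p : G * G => (p.1 * p.2)%g) \o cinv (prod_chart c1 c2)).
  by have [_ _ _ H _] := hL; apply: H => //; exists c1, c2.
have sT y : U' y -> T ((cmap c1 \o h1) y, (cmap c2 \o h2) y).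
  by move=> [[[_ d1] [_ d2]] [_ d]]; exists (h1 y, h2 y).
apply: (smooth_eq oU' _ (smooth_comp fVV fV oU' oT sT (smooth_pair oU' s1 s2) sm)).
by move=> y [[[_ d1] [_ d2]] [_ d]] /=; rewrite (cmapK pA cc1 d1) (cmapK pA cc2 d2).
Qed.

End LieGroup.

Lemma dd_partial1 (R : realType) (V W X : normedModType R) (F : V * W -> X) x y u :
  differentiable F (x, y) -> dd (fun x => F (x, y)) x u = dd F (x, y) (u, 0).
Proof.
move=> dF; have dc : differentiable (fun x : V => (x, y)) x.
  by apply: differentiable_pair; [exact: ex_diff|exact: differentiable_cst].
rewrite (dd_comp u dc dF); congr (dd _ _ _).
rewrite dd_pair; [|exact: ex_diff|exact: differentiable_cst].
by rewrite dd_id ddC.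
Qed.

Lemma dd_partial2 (R : realType) (V W X : normedModType R) (F : V * W -> X) x y u :
  differentiable F (x, y) -> dd (fun y => F (x, y)) y u = dd F (x, y) (0, u).
Proof.
move=> dF; have dc : differentiable (fun y : W => (x, y)) y.
  by apply: differentiable_pair; [exact: differentiable_cst|exact: ex_diff].
rewrite (dd_comp u dc dF); congr (dd _ _ _).
rewrite dd_pair; [|exact: differentiable_cst|exact: ex_diff].
by rewrite dd_id ddC.
Qed.

Section Frames.
Variables (R : realType) (n : nat) (G : topGroupType) (A : atlas 'rV[R]_n G).
Local Notation V := 'rV[R]_n.
Hypothesis hL : lie_group A.
Let fV : findim V := @findim_rV R n.
Let pA := premanifoldG hL.
Let cc_at q : charts A (chart_at A q).
Proof. by have [[_ _ /(_ q)[]]] := hL. Qed.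
Let dd_at q : dom (chart_at A q) q.
Proof. by have [[_ _ /(_ q)[]]] := hL. Qed.

Let Vx := findim_prod fV fV.

Lemma translations_smooth (F : G -> G) :
  (forall c, charts A c -> gsmooth A (img c setT) (F \o cinv c)) ->
  (forall c, charts A c -> copen A (F @^-1` dom c)) /\ smooth_map A A F.
Proof.
move=> gF.
have E c U : charts A c -> img c (F @^-1` U) = img c setT `&` (F \o cinv c) @^-1` U.
  move=> cc; apply/seteqP; split=> [x ix|x [ix]].
    have [dx Fx e] := imgP pA cc ix.
    by split => //; move: ix; apply: imgS.
  have [dx _ e] := imgP pA cc ix.
  by rewrite /= => Fx; rewrite -e; exact: img_cmap.
split=> [c' cc' c cc|c c' cc cc'].
  by rewrite E //; apply: (gs_open (open_imgT hL cc) (gF c cc)); exact: (open_dom hL).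
by rewrite E //; exact: (gF c cc).2.
Qed.

Lemma lam_gs (h : G) c : charts A c -> gsmooth A (img c setT) ((fun x => (h * x)%g) \o cinv c).
Proof.
move=> cc; apply: (gs_mul hL fV (open_imgT hL cc)); first exact: gs_cst.
exact: (gs_cinv hL).
Qed.

Lemma rho_gs (h : G) c : charts A c -> gsmooth A (img c setT) ((fun x => (x * h)%g) \o cinv c).
Proof.
move=> cc; apply: (gs_mul hL fV (open_imgT hL cc)); last exact: gs_cst.
exact: (gs_cinv hL).
Qed.

Lemma lam_open h c : charts A c -> copen A ((fun x : G => (h * x)%g) @^-1` dom c).
Proof. by move: c; have [] := translations_smooth (lam_gs h). Qed.
Lemma lam_smooth h : smooth_map A A (fun x : G => (h * x)%g).
Proof. by have [] := translations_smooth (lam_gs h). Qed.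
Lemma rho_open h c : charts A c -> copen A ((fun x : G => (x * h)%g) @^-1` dom c).
Proof. by move: c; have [] := translations_smooth (rho_gs h). Qed.
Lemma rho_smooth h : smooth_map A A (fun x : G => (x * h)%g).
Proof. by have [] := translations_smooth (rho_gs h). Qed.

Lemma Dv_lam (W : normedModType R) U (f : G -> W) h q u : open U -> smooth_fun A U f ->
  U (h * q)%g -> Dv A (h * q)%g (Tlambda A h (q, u)).2 f = Dv A q u (fun x => f (h * x)%g).
Proof.
move=> oU sf Uq.
exact: (Dv_tmap pA pA (@lam_open h) (lam_smooth h) u (copen_open hL oU) sf).
Qed.

Lemma Dv_rho (W : normedModType R) U (f : G -> W) h q u : open U -> smooth_fun A U f ->
  U (q * h)%g -> Dv A (q * h)%g (Trho A h (q, u)).2 f = Dv A q u (fun x => f (x * h)%g).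
Proof.
move=> oU sf Uq.
exact: (Dv_tmap pA pA (@rho_open h) (rho_smooth h) u (copen_open hL oU) sf).
Qed.

Variable E : 'M[R]_n.
Hypothesis uE : E \in unitmx.

(** A left-invariant field generates right translations: its derivative at q is that of f(q x) in x
    at the identity. Together with the mirror statement for [Etilde], this reduces calculus with the
    frames to calculus with the multiplication. *)
Lemma Dv_Ehat (W : normedModType R) U (f : G -> W) i q : open U -> smooth_fun A U f -> U q ->
  Dv A q (Ehat A E i q) f = Dv A 1%g (row i E) (fun x => f (q * x)%g).
Proof.
move=> oU sf Uq; have := @Dv_lam W U f q 1%g (row i E) oU sf.
by rewrite mulg1; apply.
Qed.

Lemma Dv_Etilde (W : normedModType R) U (f : G -> W) i q : open U -> smooth_fun A U f -> U q ->
  Dv A q (Etilde A E i q) f = Dv A 1%g (row i E) (fun x => f (x * q)%g).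
Proof.
move=> oU sf Uq; have := @Dv_rho W U f q 1%g (row i E) oU sf.
by rewrite mul1g; apply.
Qed.

Let cmap_sf c : charts A c -> smooth_fun A (dom c) (cmap c).
Proof. exact: smooth_cmap. Qed.

(** The vector is tested on the chart at q composed with translation by the inverse of h; undoing
    the translation returns the components of u. *)
Lemma Tlambda_inj h q u : (Tlambda A h (q, u)).2 = 0 -> u = 0.
Proof.
move=> T0; set c := chart_at A q.
have cc : charts A c := cc_at q.
pose U := (fun x : G => (h^-1 * x)%g) @^-1` dom c.
pose f := fun x => cmap c (h^-1 * x)%g.
have oU : open U.
  apply: open_comp; last exact: (open_dom hL).
  move=> x _; exact: (@mul_cont R n G A hL G (fun=> h^-1%g) id x (@cst_continuous _ _ _ _) (@cvg_id _ _)).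
have sf : smooth_fun A U f.
  exact: (smooth_fun_map pA pA fV (@lam_open (h^-1)%g) (lam_smooth (h^-1)%g) fV (copen_dom pA cc)
    (lam_open (h := (h^-1)%g) cc) (cmap_sf cc)).
have Uq : U (h * q)%g by rewrite /U /= mulKg; exact: dd_at.
have := Dv_lam u oU sf Uq; rewrite T0 Dv0.
have -> : (fun x => f (h * x)%g) = cmap c by apply/funext => x; rewrite /f mulKg.
by rewrite -tcomp_Dv (tcomp_at pA).
Qed.

Lemma Tlambda_lin h q (I : Type) (r : seq I) (a : I -> R) (u : I -> V) :
  (Tlambda A h (q, \sum_(i <- r) a i *: u i)).2 = \sum_(i <- r) a i *: (Tlambda A h (q, u i)).2.
Proof.
rewrite /Tlambda tmapE -[LHS]/(Dv _ _ _ _) Dvv_sum; apply: eq_bigr => i _.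
by rewrite DvvZ tmapE.
Qed.

(** Row convention: [w *m eM q] is the tangent vector at q with frame components w. *)
Definition eM q : 'M[R]_n := \matrix_j Ehat A E j q.
Definition tM q : 'M[R]_n := \matrix_j Etilde A E j q.

Lemma mul_matrix_row k m (w : 'rV[R]_k) (r : 'I_k -> 'rV[R]_m) : w *m (\matrix_j r j) = \sum_j w 0 j *: r j.
Proof. by rewrite mulmx_sum_row; apply: eq_bigr => j _; rewrite rowK. Qed.

Lemma eM_unit q : eM q \in unitmx.
Proof.
rewrite -row_free_unit; apply: inj_row_free => w.
rewrite /eM mul_matrix_row /Ehat -(Tlambda_lin q 1%g) => /Tlambda_inj.
have -> : \sum_(i < n) w 0 i *: row i E = w *m E by rewrite mulmx_sum_row.
by move=> wE; rewrite -[w](mulmxK uE) wE mul0mx.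
Qed.

(** A partial derivative in y at the fixed point y0 depends smoothly on x. With h the multiplication
    and y0 the coordinates of the identity, this is the smoothness of the invariant fields. *)
Lemma gs_dir (W : normedModType R) D (f : G -> W) (h : V * V -> G) (O : set (V * V)) (S : set V) y0 u :
  findim W -> open O -> open S -> open D -> gsmooth A O h -> smooth_fun A D f ->
  (forall x, S x -> O (x, y0) /\ D (h (x, y0))) ->
  smooth_on S (fun x => dd (fun y => f (h (x, y))) y0 u).
Proof.
move=> fW oO oS oD gh sf SO.
have oI := gs_open oO gh oD.
have sm : smooth_on (O `&` h @^-1` D) (fun z => f (h z)) := gs_fun hL oO fW gh oD sf.
have sp : smooth_on S (fun x : V => (x, y0)).
  apply: (smooth_pair oS); last exact: smooth_cst.
  by apply: (@smooth_lin R V V S idfun) => y; exact: cvg_id.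
apply: (smooth_eq oS _ (smooth_comp Vx fW oS oI _ sp (smooth_dd (0, u) sm))) => [x Sx|x /SO[]//].
have [H1 H2] := SO x Sx.
by rewrite (dd_partial2 (F := fun z => f (h z)) u (smooth_diff sm (conj H1 H2))).
Qed.

Let c1 := chart_at A 1%g.
Let cc1 : charts A c1 := cc_at 1%g.
Let e0 := cmap c1 1%g.
Let cK1 : cinv c1 e0 = 1%g.
Proof. exact: (cmapK pA cc1 (dd_at 1%g)). Qed.

Let O2 (c : chart V G) := [set z : V * V | img c setT z.1] `&` [set z : V * V | img c1 setT z.2].

Let oO2 c : charts A c -> open (O2 c).
Proof.
move=> cc; apply: openI; apply: open_comp; try exact: (open_imgT hL).
  by move=> z _; exact: cvg_fst.
by move=> z _; exact: cvg_snd.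
Qed.

Let gs1 c : charts A c -> gsmooth A (O2 c) (fun z : V * V => cinv c z.1).
Proof.
move=> cc; apply: (gs_comp hL Vx fV (oO2 cc) (open_imgT hL cc) _ _ (gs_cinv hL cc)).
  by move=> z [].
exact: smooth_fst.
Qed.

Let gs2 c : charts A c -> gsmooth A (O2 c) (fun z : V * V => cinv c1 z.2).
Proof.
move=> cc; apply: (gs_comp hL Vx fV (oO2 cc) (open_imgT hL cc1) _ _ (gs_cinv hL cc1)).
  by move=> z [].
exact: smooth_snd.
Qed.

Let Oe0 c x : img c setT x -> O2 c (x, e0).
Proof. by move=> ix; split => //; exact: (img_cmap (dd_at 1%g) I). Qed.

Lemma smooth_Ehat i : smooth_field A setT (Ehat A E i).
Proof.
move=> c cc; have oi := open_imgT hL cc.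
have gm := gs_mul hL Vx (oO2 cc) (gs1 cc) (gs2 cc).
have := gs_dir (S := img c setT) (y0 := e0) (row i E) fV (oO2 cc) oi (open_dom hL cc) gm (cmap_sf cc).
move=> /(_ _)H; apply: (smooth_eq oi _ (H _)) => x /[dup] ix /(imgP pA cc)[dx _ e].
  rewrite vcompE tcomp_Dv (Dv_Ehat _ (open_dom hL cc) (cmap_sf cc) dx).
  by rewrite /Dv.
by split; [exact: Oe0|rewrite /= cK1 mulg1].
Qed.

Lemma smooth_Etilde i : smooth_field A setT (Etilde A E i).
Proof.
move=> c cc; have oi := open_imgT hL cc.
have gm := gs_mul hL Vx (oO2 cc) (gs2 cc) (gs1 cc).
have := gs_dir (S := img c setT) (y0 := e0) (row i E) fV (oO2 cc) oi (open_dom hL cc) gm (cmap_sf cc).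
move=> /(_ _)H; apply: (smooth_eq oi _ (H _)) => x /[dup] ix /(imgP pA cc)[dx _ e].
  rewrite vcompE tcomp_Dv (Dv_Etilde _ (open_dom hL cc) (cmap_sf cc) dx).
  by rewrite /Dv.
by split; [exact: Oe0|rewrite /= cK1 mul1g].
Qed.

Lemma smooth_fieldS U X : smooth_field A setT X -> smooth_field A U X.
Proof. by move=> sX c cc; apply: smoothS (sX c cc); exact: imgS. Qed.

Lemma smooth_D U X (f : G -> R^o) : open U -> smooth_field A setT X -> smooth_fun A U f ->
  smooth_fun A U (fun p => Dv A p (X p) f : R^o).
Proof.
move=> oU sX sf; apply: (smooth_lieD fV pA (copen_open hL oU) _ sf).
exact: smooth_fieldS.
Qed.

(** Left and right translations commute: both sides are mixed second derivatives of F(x, y) = f(x q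
    y) at the identity, taken in the two orders. *)
Lemma left_right_commute U (f : G -> R^o) i k q : open U -> smooth_fun A U f -> U q ->
  Dv A q (Etilde A E i q) (fun p => Dv A p (Ehat A E k p) f : R^o) =
  Dv A q (Ehat A E k q) (fun p => Dv A p (Etilde A E i p) f : R^o).
Proof.
move=> oU sf Uq.
rewrite (Dv_Etilde _ oU (smooth_D oU (smooth_Ehat k) sf) Uq).
rewrite (Dv_Ehat _ oU (smooth_D oU (smooth_Etilde i) sf) Uq).
rewrite -[LHS]/(dd ((fun x : G => Dv A (x * q)%g (Ehat A E k (x * q)%g) f) \o cinv c1) e0 (row i E)).
rewrite -[RHS]/(dd ((fun x : G => Dv A (q * x)%g (Etilde A E i (q * x)%g) f) \o cinv c1) e0 (row k E)).
pose h (z : V * V) := (cinv c1 z.1 * q * cinv c1 z.2)%g.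
have gh : gsmooth A (O2 c1) h.
  apply: (gs_mul hL Vx (oO2 cc1) _ (gs2 cc1)).
  apply: (gs_mul hL Vx (oO2 cc1) (gs1 cc1)); exact: gs_cst.
have oI := gs_open (oO2 cc1) gh oU.
pose F z : R^o := f (h z).
have sF : smooth_on (O2 c1 `&` h @^-1` U) F := gs_fun hL (oO2 cc1) (@findimR R) gh oU sf.
have I0 : (O2 c1 `&` h @^-1` U) (e0, e0).
  split; first exact: (Oe0 (img_cmap (dd_at 1%g) I)).
  by rewrite /= /h /= cK1 mul1g mulg1.
have cpair1 : continuous (fun x : V => (x, e0)).
  move=> x; apply: differentiable_continuous.
  by apply: differentiable_pair; [exact: ex_diff|exact: differentiable_cst].
have cpair2 : continuous (fun x : V => (e0, x)).
  move=> x; apply: differentiable_continuous.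
  by apply: differentiable_pair; [exact: differentiable_cst|exact: ex_diff].
have o1 : open [set x | (O2 c1 `&` h @^-1` U) (x, e0)].
  by apply: open_comp oI => x _; exact: cpair1.
have o2 : open [set x | (O2 c1 `&` h @^-1` U) (e0, x)].
  by apply: open_comp oI => x _; exact: cpair2.
have sd1 := smooth_dd (0, row k E) sF; have sd2 := smooth_dd (row i E, 0) sF.
transitivity (dd (fun x => dd F (x, e0) (0, row k E)) e0 (row i E)).
  apply: (dd_eq (row i E) o1) => [x Ox||]; last 2 first.
  - exact: I0.
  - apply: (smooth_diff (U := [set x | (O2 c1 `&` h @^-1` U) (x, e0)])) => //.
    apply: (smooth_comp Vx (@findimR R) o1 oI _ _ sd1) => //.
    apply: (smooth_pair o1); last exact: smooth_cst.
    by apply: (@smooth_lin R V V _ idfun) => y; exact: cvg_id.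
  rewrite -[LHS](dd_partial2 _ (smooth_diff sF Ox)).
  have [_ Ux] := Ox; rewrite /h /= cK1 mulg1 in Ux.
  by rewrite /= (Dv_Ehat _ oU sf Ux).
rewrite (dd_partial1 _ (smooth_diff sd1 I0)) (dd_sym _ _ oI sF I0).
rewrite -(dd_partial2 _ (smooth_diff sd2 I0)).
apply/esym; apply: (dd_eq (row k E) o2) => [x Ox||]; last 2 first.
- exact: I0.
- apply: (smooth_diff (U := [set x | (O2 c1 `&` h @^-1` U) (e0, x)])) => //.
  apply: (smooth_comp Vx (@findimR R) o2 oI _ _ sd2) => //.
  apply: (smooth_pair o2); first exact: smooth_cst.
  by apply: (@smooth_lin R V V _ idfun) => y; exact: cvg_id.
rewrite -[LHS](dd_partial1 _ (smooth_diff sF Ox)).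
have [_ Ux] := Ox; rewrite /h /= cK1 mul1g in Ux.
rewrite /= (Dv_Etilde _ oU sf Ux); congr (dd _ _ _); apply/funext => y.
by rewrite /F /h /= mulgA.
Qed.

Lemma Tlambda_Ehat h q i : Tlambda A h (q, Ehat A E i q) = ((h * q)%g, Ehat A E i (h * q)%g).
Proof.
rewrite /Tlambda tmapE; congr (_, _).
set c := chart_at A (h * q)%g; have cc : charts A c := cc_at _.
have oU : open ((fun x : G => (h * x)%g) @^-1` dom c).
  apply: open_comp; last exact: (open_dom hL).
  by move=> x _; exact: (@mul_cont R n G A hL G (fun=> h) id x (@cst_continuous _ _ _ _) (@cvg_id _ _)).
have sf : smooth_fun A ((fun x : G => (h * x)%g) @^-1` dom c) (cmap c \o (fun x : G => (h * x)%g)).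
  exact: (smooth_fun_map pA pA fV (@lam_open h) (lam_smooth h) fV (copen_dom pA cc)
    (lam_open (h := h) cc) (cmap_sf cc)).
rewrite (Dv_Ehat _ oU sf); last exact: dd_at.
rewrite -[RHS](tcomp_at pA (h * q)%g) tcomp_Dv.
rewrite (Dv_Ehat _ (open_dom hL cc) (cmap_sf cc)); last exact: dd_at.
by congr Dv; apply/funext => x /=; rewrite mulgA.
Qed.

End Frames.

(** * Frame derivatives, structure constants and the adjoint matrix *)

Section FrameCalculus.
Variables (R : realType) (n : nat) (G : topGroupType) (A : atlas 'rV[R]_n G).
Local Notation V := 'rV[R]_n.
Variables (E : 'M[R]_n) (C : 'I_n -> 'I_n -> 'I_n -> R).
Hypotheses (hL : lie_group A) (uE : E \in unitmx) (hC : structure_constants A E C).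
Let fV : findim V := @findim_rV R n.
Let pA := premanifoldG hL.
Let cc_at q : charts A (chart_at A q).
Proof. by have [[_ _ /(_ q)[]]] := hL. Qed.
Let dd_at q : dom (chart_at A q) q.
Proof. by have [[_ _ /(_ q)[]]] := hL. Qed.
Let co U := @copen_open R n G A hL U.
Implicit Types (f g : G -> R^o) (U : set G).

Definition frameD i f : G -> R^o := fun q => Dv A q (Ehat A E i q) f.
Local Notation D := frameD.
Definition frameT i f : G -> R^o := fun q => Dv A q (Etilde A E i q) f.
Local Notation T := frameT.

Lemma frameDE i f q : D i f q = Dv A q (Ehat A E i q) f.
Proof. by []. Qed.

Lemma frameTE i f q : T i f q = Dv A q (Etilde A E i q) f.
Proof. by []. Qed.

Lemma smoothD_ U i f : open U -> smooth_fun A U f -> smooth_fun A U (D i f).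
Proof. by move=> oU sf; apply: (smooth_D hL oU) => //; exact: smooth_Ehat. Qed.

Lemma smoothT_ U i f : open U -> smooth_fun A U f -> smooth_fun A U (T i f).
Proof. by move=> oU sf; apply: (smooth_D hL oU) => //; exact: smooth_Etilde. Qed.

Lemma smooth_scale U a f : open U -> smooth_fun A U f -> smooth_fun A U (fun p => a * f p : R^o).
Proof.
move=> oU sf; apply: (smooth_funM (co oU)) sf => c cc; exact: smooth_cst.
Qed.

Section Rules.
Variables (U : set G) (oU : open U).

Lemma D_eq i f g q : (forall p, U p -> f p = g p) -> smooth_fun A U f -> U q -> D i g q = D i f q.
Proof. by move=> fg sf Uq; apply: (Dv_eq pA _ (co oU) Uq fg sf). Qed.

Lemma T_eq i f g q : (forall p, U p -> f p = g p) -> smooth_fun A U f -> U q -> T i g q = T i f q.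
Proof. by move=> fg sf Uq; apply: (Dv_eq pA _ (co oU) Uq fg sf). Qed.

Lemma D_add i f g q : smooth_fun A U f -> smooth_fun A U g -> U q ->
  D i (fun p => f p + g p) q = D i f q + D i g q.
Proof. by move=> sf sg Uq; apply: (DvD pA _ (co oU)). Qed.

Lemma D_sub i f g q : smooth_fun A U f -> smooth_fun A U g -> U q ->
  D i (fun p => f p - g p) q = D i f q - D i g q.
Proof. by move=> sf sg Uq; apply: (DvB pA _ (co oU)). Qed.

Lemma D_mul i f g q : smooth_fun A U f -> smooth_fun A U g -> U q ->
  D i (fun p => f p * g p) q = f q * D i g q + g q * D i f q.
Proof. by move=> sf sg Uq; apply: (DvM pA _ (co oU)). Qed.

Lemma T_mul i f g q : smooth_fun A U f -> smooth_fun A U g -> U q ->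
  T i (fun p => f p * g p) q = f q * T i g q + g q * T i f q.
Proof. by move=> sf sg Uq; apply: (DvM pA _ (co oU)). Qed.

Lemma D_scale i a f q : smooth_fun A U f -> U q -> D i (fun p => a * f p) q = a * D i f q.
Proof. by move=> sf Uq; apply: (DvZ pA _ _ (co oU)). Qed.

Lemma D_sum i (I : Type) (r : seq I) (f : I -> G -> R^o) q :
  (forall j, smooth_fun A U (f j)) -> U q ->
  D i (fun p => \sum_(j <- r) f j p) q = \sum_(j <- r) D i (f j) q.
Proof. by move=> sf Uq; apply: (Dv_sum pA _ _ (co oU)). Qed.

Lemma T_sum i (I : Type) (r : seq I) (f : I -> G -> R^o) q :
  (forall j, smooth_fun A U (f j)) -> U q ->
  T i (fun p => \sum_(j <- r) f j p) q = \sum_(j <- r) T i (f j) q.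
Proof. by move=> sf Uq; apply: (Dv_sum pA _ _ (co oU)). Qed.

Lemma D_cst i a q : D i (fun=> a) q = 0.
Proof. exact: DvC. Qed.

Lemma TD_comm i k f q : smooth_fun A U f -> U q -> T i (D k f) q = D k (T i f) q.
Proof. by move=> sf Uq; apply: (left_right_commute hL _ _ _ oU sf Uq). Qed.

Lemma D_comm i j f q : smooth_fun A U f -> U q ->
  D i (D j f) q - D j (D i f) q = \sum_k C i j k * D k f q.
Proof.
move=> sf Uq; rewrite /frameD -(bracketE fV pA (co oU) _ _ sf Uq).
- by rewrite hC Dvv_sum; apply: eq_bigr => k _; rewrite DvvZ.
- by apply: smooth_fieldS; exact: smooth_Ehat.
- by apply: smooth_fieldS; exact: smooth_Ehat.
Qed.

End Rules.

(** The coordinates of a chart around q are enough test functions. Identities between structure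
    constants or adjoint matrices are obtained below by comparing the coefficients of frame
    derivatives of an arbitrary f. *)
Lemma D_indep q (a : 'I_n -> R) :
  (forall U f, open U -> U q -> smooth_fun A U f -> \sum_k a k * D k f q = 0) ->
  forall k, a k = 0.
Proof.
move=> H; set c := chart_at A q; have cc : charts A c := cc_at q.
have dq : dom c q := dd_at q.
have aE : (\row_k a k) *m eM A E q = 0.
  rewrite /eM mul_matrix_row; apply/rowP => m; rewrite summxE [RHS]mxE.
  have sf : smooth_fun A (dom c) (fun p => cmap c p 0 m : R^o).
    by move=> c' cc'; apply: (smooth_rVP _ (open_tr pA cc' cc)).2; exact: (smooth_tr pA cc' cc).
  rewrite -[RHS](H _ _ (open_dom hL cc) dq sf); apply: eq_bigr => k _.
  rewrite !mxE; congr (_ * _).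
  rewrite /frameD /Dv -(dd_rV (f := cmap c \o cinv c)).
    by rewrite -[dd _ _ _]/(Dv A q (Ehat A E k q) (cmap c)) -tcomp_Dv (tcomp_at pA).
  exact: (smooth_at (co (open_dom hL cc)) (smooth_cmap pA cc) cc dq dq).
have a0 : \row_k a k = 0 by rewrite -[LHS](mulmxK (eM_unit hL uE q)) aE mul0mx.
by move=> k; have := congr1 (fun v : V => v 0 k) a0; rewrite !mxE.
Qed.

Lemma C_anti i j k : C i j k = - C j i k.
Proof.
suff : forall k, C i j k + C j i k = 0 by move=> /(_ k)/eqP; rewrite addr_eq0 => /eqP.
apply: (@D_indep 1%g) => U f oU Uq sf.
under eq_bigr => l _ do rewrite mulrDl.
rewrite big_split /= -!(D_comm oU _ _ sf Uq).
by rewrite -[X in _ + X]opprB subrr.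
Qed.

(** The Jacobi identity for commutators of derivations: each cyclic term is a nested commutator
    applied to f, and the third derivatives cancel in the sum. *)
Lemma jacobi i j k m :
  \sum_l (C j k l * C i l m + C k i l * C j l m + C i j l * C k l m) = 0.
Proof.
move: m; apply: (@D_indep 1%g) => U f oU Uq sf.
have sD a := smoothD_ a oU sf.
have sDD a b := smoothD_ a oU (sD b).
have [P PE] : exists P : 'I_n -> 'I_n -> 'I_n -> R, forall a b c, P a b c = D a (D b (D c f)) 1%g.
  by exists (fun a b c => D a (D b (D c f)) 1%g).
have key a b c : \sum_m (\sum_l C b c l * C a l m) * D m f 1%g =
    P a b c - P a c b - (P b c a - P c b a).
  rewrite !PE [X in _ - X](D_comm oU b c (sD a) Uq) -(D_sub oU a (sDD b c) (sDD c b) Uq).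
  have -> : D a (fun p => D b (D c f) p - D c (D b f) p) 1%g =
            D a (fun p => \sum_l C b c l * D l f p) 1%g.
    apply: (D_eq oU a _ _ Uq) => [p Up|]; first by rewrite (D_comm oU _ _ sf Up).
    apply: (smooth_fun_sum _ (co oU)) => l.
    exact: smooth_scale.
  rewrite (D_sum oU) // => [|l]; last first.
    exact: smooth_scale.
  rewrite -sumrB; under [RHS]eq_bigr => l _ do
    rewrite (D_scale oU a (C b c l) (sD l) Uq) -mulrBr (D_comm oU _ _ sf Uq) mulr_sumr.
  rewrite exchange_big /=; apply: eq_bigr => p _; rewrite mulr_suml.
  by apply: eq_bigr => l _; rewrite mulrA.
have -> : \sum_k0 (\sum_l (C j k l * C i l k0 + C k i l * C j l k0 + C i j l * C k l k0)) * D k0 f 1%g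
   = \sum_m (\sum_l C j k l * C i l m) * D m f 1%g + \sum_m (\sum_l C k i l * C j l m) * D m f 1%g
     + \sum_m (\sum_l C i j l * C k l m) * D m f 1%g.
  by rewrite -!big_split; apply: eq_bigr => m _ /=; rewrite !big_split /= !mulrDl.
rewrite !key; ring.
Qed.

(** The matrix of Ad(q^-1): row i holds the left-frame components of the right-invariant field
    [Etilde i] at q. *)
Definition adM q : 'M[R]_n := tM A E q *m invmx (eM A E q).
Local Notation M := adM.

Lemma Etilde_M i q : Etilde A E i q = \sum_j M q i j *: Ehat A E j q.
Proof.
have -> : Etilde A E i q = row i (tM A E q) by rewrite rowK.
rewrite -[tM A E q](mulmxKV (eM_unit hL uE q)) -/(adM q) row_mul.
by rewrite /eM mul_matrix_row; apply: eq_bigr => j _; rewrite !mxE.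
Qed.

Lemma T_M i f q : T i f q = \sum_j M q i j * D j f q.
Proof. by rewrite /frameT Etilde_M Dvv_sum; apply: eq_bigr => j _; rewrite DvvZ. Qed.

Definition vmat (X : 'I_n -> G -> V) (c : chart V G) x : 'M[R]_n := \matrix_j vcomp A (X j) c x.

Lemma vmat_Ehat_unit c x : charts A c -> img c setT x -> vmat (Ehat A E) c x \in unitmx.
Proof.
move=> cc ix; have [dx _ e] := imgP pA cc ix.
rewrite -row_free_unit; apply: inj_row_free => w.
rewrite /vmat mul_matrix_row => w0.
have : w *m eM A E (cinv c x) = 0.
  apply: (tcomp_inj pA cc dx); rewrite /eM mul_matrix_row.
  transitivity (\sum_j w 0 j *: vcomp A (Ehat A E j) c x).
    by apply: (etrans (ddv_sum _ _ _ _)); apply: eq_bigr => j _; rewrite vcompE /tcomp ddvZ.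
  by rewrite w0 /tcomp ddv0.
by move=> h; rewrite -[w](mulmxK (eM_unit hL uE (cinv c x))) h mul0mx.
Qed.

Lemma smooth_vmat X c i j : charts A c -> (forall i, smooth_field A setT (X i)) ->
  smooth_on (img c setT) (fun x => vmat X c x i j : R^o).
Proof.
move=> cc sX; have oi := open_imgT hL cc.
apply: (smooth_eq oi _ ((smooth_rVP _ oi).2 (sX i c cc) j)) => x _.
by rewrite mxE.
Qed.

(** The two frame matrices defining [adM] are written in a chart that depends on the point. In a
    fixed chart the same matrix relates the component matrices [vmat] of the two frames, and these
    are smooth. *)
Lemma smooth_M i j : smooth_fun A setT (fun q => M q i j : R^o).
Proof.
move=> c cc; have oi := open_imgT hL cc.
have sv := fun i j => smooth_vmat i j cc (@smooth_Ehat R n G A hL E).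
have st := fun i j => smooth_vmat i j cc (@smooth_Etilde R n G A hL E).
have si k l := smooth_invmx k l oi sv (fun x => @vmat_Ehat_unit c x cc).
have := smooth_sum (index_enum 'I_n) oi (fun k (_ : xpredT k) => smoothM oi (st i k) (si k j)).
apply: (smooth_eq oi) => x ix; have [dx _ e] := imgP pA cc ix.
have vE : vmat (Etilde A E) c x = M (cinv c x) *m vmat (Ehat A E) c x.
  apply/row_matrixP => k; rewrite rowK row_mul /vmat mul_matrix_row vcompE Etilde_M.
  apply: (etrans (ddv_sum _ _ _ _)).
  by apply: eq_bigr => l _; rewrite vcompE /tcomp ddvZ [row k _ 0 l]mxE.
by rewrite /= -[M (cinv c x)](mulmxK (vmat_Ehat_unit cc ix)) -vE !mxE.
Qed.

Lemma smooth_MU U i j : smooth_fun A U (fun q => M q i j : R^o).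
Proof. by apply: smooth_funS (smooth_M i j). Qed.

(** Expanding T_i = M_ij D_j in the commutation of T_i with D_k gives D_k(M_ij) D_j f = M_il
    [D_l, D_k] f; the coefficients of the D_j f are then compared. *)
Lemma D_M k i j q : D k (fun q => M q i j) q = \sum_l M q i l * C l k j.
Proof.
apply/eqP; rewrite -subr_eq0; apply/eqP.
move: j; apply: (@D_indep q) => U f oU Uq sf.
have sD a := smoothD_ a oU sf.
have E1 := TD_comm oU i k sf Uq.
have : D k (T i f) q = D k (fun p => \sum_j M p i j * D j f p) q.
  apply: (D_eq oU k _ _ Uq) => [p Up|]; first by rewrite T_M.
  apply: (smooth_fun_sum _ (co oU)) => l.
  exact: (smooth_funM (co oU) (@smooth_MU U i l) (sD l)).
rewrite (D_sum oU) // => [E2|l]; last first.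
  exact: (smooth_funM (co oU) (@smooth_MU U i l) (sD l)).
move: E2; rewrite -E1 T_M.
under [X in _ = X -> _]eq_bigr => l _ do rewrite (D_mul oU k (@smooth_MU U i l) (sD l) Uq).
rewrite big_split /= => E3.
under eq_bigr => m _ do rewrite mulrBl.
rewrite sumrB; apply/eqP; rewrite subr_eq0; apply/eqP.
under eq_bigr => m _ do rewrite mulrC.
apply: (addrI (\sum_i0 M q i i0 * D k (D i0 f) q)).
rewrite -E3; apply/eqP; rewrite -subr_eq0 opprD addrA -sumrB.
under eq_bigr => l _ do rewrite -mulrBr (D_comm oU _ _ sf Uq) mulr_sumr.
rewrite exchange_big /= -sumrB big1 // => m _; apply/eqP; rewrite subr_eq0; apply/eqP.
by rewrite mulr_suml; apply: eq_bigr => l _; rewrite mulrA.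
Qed.

End FrameCalculus.

Opaque frameD frameT.

(** * The adjoint action on cocycles *)

Section AdjointClass.
Variables (R : realType) (n : nat) (G : topGroupType) (A : atlas 'rV[R]_n G).
Local Notation V := 'rV[R]_n.
Variables (E : 'M[R]_n) (C : 'I_n -> 'I_n -> 'I_n -> R).
Hypotheses (hL : lie_group A) (uE : E \in unitmx) (hC : structure_constants A E C).
Let fV : findim V := @findim_rV R n.
Let pA := premanifoldG hL.
Let cc_at q : charts A (chart_at A q).
Proof. by have [[_ _ /(_ q)[]]] := hL. Qed.
Let dd_at q : dom (chart_at A q) q.
Proof. by have [[_ _ /(_ q)[]]] := hL. Qed.
Let co U := @copen_open R n G A hL U.
Implicit Types (f g : G -> R^o) (U : set G).
Local Notation D := (frameD A E).
Local Notation T := (frameT A E).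
Local Notation M := (adM A E).

Lemma Ehat1 i : Ehat A E i 1%g = row i E.
Proof.
set c := chart_at A 1%g; have cc : charts A c := cc_at _; have d1 : dom c 1%g := dd_at _.
rewrite -(tcomp_at pA 1%g (Ehat A E i 1%g)) tcomp_Dv.
rewrite (Dv_Ehat hL _ _ (open_dom hL cc) (smooth_cmap pA cc) d1).
have -> : (fun x => cmap c (1 * x)%g) = cmap c by apply/funext => x; rewrite mul1g.
by rewrite -tcomp_Dv (tcomp_at pA).
Qed.

Lemma Etilde1 i : Etilde A E i 1%g = row i E.
Proof.
set c := chart_at A 1%g; have cc : charts A c := cc_at _; have d1 : dom c 1%g := dd_at _.
rewrite -(tcomp_at pA 1%g (Etilde A E i 1%g)) tcomp_Dv.
rewrite (Dv_Etilde hL _ _ (open_dom hL cc) (smooth_cmap pA cc) d1).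
have -> : (fun x => cmap c (x * 1)%g) = cmap c by apply/funext => x; rewrite mulg1.
by rewrite -tcomp_Dv (tcomp_at pA).
Qed.

Lemma M1 : M 1%g = 1%:M.
Proof.
have tE : tM A E 1%g = eM A E 1%g.
  apply/row_matrixP => i; apply: (etrans (rowK _ _)); apply: (etrans (Etilde1 i)).
  by apply: esym; apply: (etrans (rowK _ _)); exact: Ehat1.
by rewrite /adM tE (mulmxV (eM_unit hL uE 1%g)).
Qed.

Lemma rho_preim_open U q : open U -> open ((fun x : G => (x * q)%g) @^-1` U).
Proof.
move=> oU; apply: open_comp oU => x _.
exact: (@mul_cont R n G A hL G id (fun=> q) x (@cvg_id _ _) (@cst_continuous _ _ _ _)).
Qed.

Lemma T_at1 i U f q : open U -> smooth_fun A U f -> U q ->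
  T i f q = D i (fun x => f (x * q)%g) 1%g.
Proof.
move=> oU sf Uq; rewrite frameTE frameDE (Dv_Etilde hL _ _ oU sf Uq).
by rewrite Ehat1.
Qed.

(** T_i f at q is D_i at the identity of the right translate g of f. Iterating reverses the order of
    the two derivatives, as [key] records, hence the sign opposite to that of [D_comm]. *)
Lemma T_comm U i j f q : open U -> smooth_fun A U f -> U q ->
  T i (T j f) q - T j (T i f) q = - \sum_k C i j k * T k f q.
Proof.
move=> oU sf Uq; set g := fun x => f (x * q)%g.
have oU' := rho_preim_open q oU.
have sg : smooth_fun A ((fun x : G => (x * q)%g) @^-1` U) g.
  exact: (smooth_fun_map pA pA fV (@rho_open _ _ _ _ hL q) (rho_smooth hL q) (@findimR R)
    (co oU) (co oU') sf).
have U1 : ((fun x : G => (x * q)%g) @^-1` U) 1%g by rewrite /= mul1g.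
have key a b : T a (T b f) q = D b (D a g) 1%g.
  rewrite (T_at1 a oU (smoothT_ E hL b oU sf) Uq).
  transitivity (D a (T b g) 1%g).
    apply: (D_eq E hL oU' a _ _ U1); last exact: (smoothT_ E hL b oU' sg).
    move=> p Up; rewrite (T_at1 b oU sf Up) (T_at1 b oU' sg Up).
    have -> : (fun x => g (x * p)%g) = (fun x => f (x * (p * q))%g).
      by apply/funext => x; rewrite /g mulgA.
    by [].
  rewrite -(TD_comm E hL oU' b a sg U1) (T_at1 b oU' (smoothD_ E hL a oU' sg) U1).
  have -> : (fun x => D a g (x * 1)%g) = D a g by apply/funext => x; rewrite mulg1.
  by [].
rewrite (key i j) (key j i); apply: (etrans (esym (opprB _ _))).
apply: (congr1 -%R); apply: (etrans (D_comm hL hC oU' i j sg U1)).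
by apply: eq_bigr => k _; rewrite (T_at1 k oU sf Uq).
Qed.

(** The adjoint action respects brackets. Writing T_i = M_ia D_a inside [T_comm] and using [D_M],
    the second derivatives of f cancel and the coefficients of the D_b f give the identity. *)
Lemma M_hom q i j b :
  \sum_a \sum_l M q i a * M q j l * C a l b = \sum_k C i j k * M q k b.
Proof.
apply/eqP; rewrite -subr_eq0; apply/eqP; move: b.
apply: (@D_indep _ _ _ _ _ hL uE q) => U f oU Uq sf.
have sD a := smoothD_ E hL a oU sf.
have TT i' j' : T i' (T j' f) q =
    \sum_l M q j' l * T i' (D l f) q + \sum_b D b f q * \sum_a M q i' a * \sum_l M q j' l * C l a b.
  have -> : T i' (T j' f) q = T i' (fun p => \sum_l M p j' l * D l f p) q.
    apply: (T_eq E hL oU i' _ _ Uq) => [p Up|]; first by rewrite (T_M hL uE).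
    apply: (smooth_fun_sum _ (co oU)) => l.
    exact: (smooth_funM (co oU) (smooth_MU hL uE U j' l) (sD l)).
  rewrite (T_sum E hL oU) // => [|l]; last first.
    exact: (smooth_funM (co oU) (smooth_MU hL uE U j' l) (sD l)).
  rewrite -big_split /=; apply: eq_bigr => l _.
  rewrite (T_mul E hL oU _ (smooth_MU hL uE U j' l) (sD l) Uq); congr (_ + _ * _).
  by rewrite (T_M hL uE); apply: eq_bigr => a _; rewrite (D_M hL uE hC).
have TD l i' : T i' (D l f) q = D l (T i' f) q := TD_comm E hL oU i' l sf Uq.
have Tsw : \sum_l M q j l * T i (D l f) q = T j (T i f) q.
  by rewrite (T_M hL uE); apply: eq_bigr => l _; rewrite TD.
have := T_comm i j oU sf Uq; rewrite TT Tsw addrAC subrr add0r => E1.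
under eq_bigr => b _ do rewrite mulrBl.
rewrite sumrB; apply/eqP; rewrite subr_eq0; apply/eqP.
apply: oppr_inj; rewrite -[LHS]sumrN.
transitivity (\sum_b D b f q * \sum_a M q i a * \sum_l M q j l * C l a b).
  apply: eq_bigr => b _; rewrite mulrC -mulrN; congr (_ * _).
  rewrite -sumrN; apply: eq_bigr => a _; rewrite mulr_sumr -sumrN.
  by apply: eq_bigr => l _; rewrite (C_anti hL uE hC l a b) !mulrN mulrA.
apply: (etrans E1); apply: (congr1 -%R).
under [RHS]eq_bigr => b _ do rewrite mulr_suml.
rewrite exchange_big; apply: eq_bigr => k _.
by rewrite (T_M hL uE) mulr_sumr; apply: eq_bigr => b _; rewrite mulrA.
Qed.

Lemma D0_dd0 U f c x v : open U -> smooth_fun A U f -> (forall i q, U q -> D i f q = 0) ->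
  charts A c -> img c U x -> dd (f \o cinv c) x v = 0.
Proof.
move=> oU sf D0 cc ix; have [dx Ux e] := imgP pA cc ix.
set q := cinv c x in dx Ux e; rewrite -{1}e -(tcomp_surj pA v cc dx).
rewrite -(Dv_chart pA _ (co oU) sf cc dx Ux); set u := dd _ _ _.
have -> : u = \sum_j (u *m invmx (eM A E q)) 0 j *: Ehat A E j q.
  by rewrite -mul_matrix_row -/(eM A E q) (mulmxKV (eM_unit hL uE q)).
rewrite Dvv_sum big1 // => j _; rewrite DvvZ.
by have := D0 j q Ux; rewrite frameDE => ->; rewrite scaler0.
Qed.

(** On a coordinate ball the mean value theorem makes f constant, so the points of U where f equals
    f(p) form a non-empty subset that is both open and closed in U. *)
Lemma D0_const U f p q : open U -> connected U -> smooth_fun A U f ->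
  (forall i x, U x -> D i f x = 0) -> U p -> U q -> f p = f q.
Proof.
move=> oU cU sf D0 Up Uq.
have loc x : U x -> \forall y \near x, U y /\ f y = f x.
  move=> Ux; set c := chart_at A x; have cc : charts A c := cc_at x.
  have dx : dom c x := dd_at x.
  have oi := co oU cc; have ix : img c U (cmap c x) by exact: img_cmap.
  have /nbhs_ballP[r /= r0 rP] : nbhs (cmap c x) (img c U) by exact: open_nbhs_nbhs.
  have nb : \forall y \near x, ball (cmap c x) r (cmap c y) /\ dom c y.
    have cmc : {for x, continuous (cmap c)}.
      by have [[_ _ _ H _] _ _ _ _] := hL; have [_ _ _ h _] := H c cc; exact: h.
    apply: filterI; last exact: (open_nbhs_nbhs (conj (open_dom hL cc) dx)).
    by apply: cmc; exact: nbhsx_ballx.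
  apply: filterS nb => y [By dy].
  have iy := rP _ By; have [_ Uy _] := imgP pA cc iy.
  rewrite (cmapK pA cc dy) in Uy; split => //.
  have [|t tI] := @dd_MVT _ _ (f \o cinv c) (cmap c x) (cmap c y - cmap c x).
    move=> t /andP[t0 t1]; apply: (smooth_diff (sf c cc)); apply: rP.
    move: By; rewrite -!ball_normE /= opprD addrA subrr sub0r normrN normrZ (ger0_norm t0).
    by rewrite distrC; apply: le_lt_trans; rewrite ler_piMl.
  rewrite [cmap c x + (_ - _)]addrC subrK /= (cmapK pA cc dy) (cmapK pA cc dx) => E1.
  apply/eqP; rewrite -subr_eq0; apply/eqP; rewrite E1.
  apply: (D0_dd0 _ oU sf D0 cc); apply: rP.
  have /andP[t0 t1] := tI.
  move: By; rewrite -!ball_normE /= opprD addrA subrr sub0r normrN normrZ (ger0_norm t0).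
  by rewrite distrC; apply: le_lt_trans; rewrite ler_piMl.
pose S := [set x | U x /\ f x = f p].
suff SU : S = U by have : S q by [rewrite SU]; case.
apply: cU; first by exists p.
- exists S; last by apply/seteqP; split => x; [move=> [Ux fx]; split|move=> []].
  rewrite openE => x [Ux fx]; apply: filterS (loc x Ux) => y [Uy fy].
  by split => //; rewrite fy.
- exists (~` [set x | U x /\ f x <> f p]).
    apply: open_closedC; rewrite openE => x [Ux fx].
    by apply: filterS (loc x Ux) => y [Uy fy]; split => //; rewrite fy.
  apply/seteqP; split=> x; first by move=> [Ux fx]; split => // -[].
  by move=> [Ux nx]; split => //; apply: contrapT => fx; apply: nx.
Qed.

Hypothesis cG : connected [set: G].

(** By [D_M] the frame derivatives of M s contain the factor s_j C_lk^j, which vanishes for a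
    cocycle; hence M s keeps its value s at the identity. *)
Lemma adM_cocycle1 s q i : cocycle1 C s -> \sum_j M q i j * s 0 j = s 0 i.
Proof.
move=> cs.
have oT : open [set: G] := openT.
have sF1 j : smooth_fun A setT (fun p => s 0 j * M p i j : R^o).
  by apply: (smooth_scale hL _ oT); exact: (smooth_MU hL uE).
have sF : smooth_fun A setT (fun p => \sum_j s 0 j * M p i j : R^o).
  exact: (smooth_fun_sum _ (co oT)).
have F0 k p : D k (fun p => \sum_j s 0 j * M p i j) p = 0.
  rewrite (D_sum E hL oT k _ sF1) //.
  under eq_bigr => j _ do rewrite (D_scale E hL oT k _ (smooth_MU hL uE setT i j)) // (D_M hL uE hC) mulr_sumr.
  rewrite exchange_big /= big1 // => l _.
  transitivity (M p i l * \sum_j s 0 j * C l k j); last by rewrite cs mulr0.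
  by rewrite mulr_sumr; apply: eq_bigr => j _; rewrite mulrCA.
have E1 : \sum_j s 0 j * M 1%g i j = s 0 i.
  rewrite M1 (bigD1 i) //= big1 => [|j ji]; first by rewrite mxE eqxx mulr1 addr0.
  by rewrite mxE eq_sym (negPf ji) mulr0.
rewrite -[RHS]E1 -(D0_const oT cG sF (fun k p _ => F0 k p) (I : setT q) (I : setT 1%g)).
by apply: eq_bigr => j _; exact: mulrC.
Qed.

(** Row k is the coboundary of the k-th dual basis vector, flattened by [mxvec]; the coboundaries
    are the row space, and the columns of the cokernel matrix are the functionals vanishing on
    it. *)
Definition Cmx : 'M[R]_(n, n * n) := \matrix_k mxvec (\matrix_(i, j) C i j k).

(* Coboundaries are cut out by linear functionals; along the group the value of
   such a functional on the adjoint transform of a cocycle has zero derivative,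
   hence is constant. *)
Lemma coboundary2P (a : 'M[R]_n) : coboundary2 C a <-> mxvec a *m cokermx Cmx = 0.
Proof.
have E1 (t : 'rV[R]_n) : t *m Cmx = mxvec (\matrix_(i, j) \sum_k t 0 k * C i j k).
  rewrite /Cmx mul_matrix_row.
  transitivity (mxvec (\sum_k t 0 k *: \matrix_(i, j) C i j k)).
    by rewrite linear_sum; apply: eq_bigr => k _; rewrite linearZ.
  congr mxvec; apply/matrixP => i j; rewrite summxE mxE; apply: eq_bigr => k _.
  by rewrite !mxE.
split=> [[t tE]|/eqP].
  have -> : mxvec a = t *m Cmx.
    by rewrite E1; congr mxvec; apply/matrixP => i j; rewrite mxE.
  by rewrite -mulmxA mulmx_coker mulmx0.
rewrite -submxE => /submxP[t]; rewrite E1 => /(can_inj mxvecK) aE.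
by exists t => i j; rewrite aE mxE.
Qed.

(** Cartan's formula: the Lie derivative of a closed 2-form is the differential of its contraction.
    Hence the derivative of the transformed cocycle is a coboundary, built from row k of b
    transformed by M. *)
Lemma D_adM2 (b : 'M[R]_n) k i j q : cocycle2 C b ->
  D k (fun p => \sum_a \sum_l b a l * (M p i a * M p j l)) q =
  \sum_m (- \sum_l M q m l * b k l) * C i j m.
Proof.
move=> [ab cb]; have oT : open [set: G] := openT.
have sMM a l : smooth_fun A setT (fun p => M p i a * M p j l : R^o).
  by apply: (smooth_funM (co oT)); exact: (smooth_MU hL uE).
have s1 a l : smooth_fun A setT (fun p => b a l * (M p i a * M p j l) : R^o).
  exact: (smooth_scale hL _ oT (sMM a l)).
have s2 a : smooth_fun A setT (fun p => \sum_l b a l * (M p i a * M p j l) : R^o).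
  exact: (smooth_fun_sum _ (co oT)).
rewrite (D_sum E hL oT k _ s2) //.
transitivity (\sum_a \sum_l b a l * (M q i a * (\sum_m M q j m * C m k l) + M q j l * (\sum_m M q i m * C m k a))).
  apply: eq_bigr => a _; rewrite (D_sum E hL oT k _ (s1 a)) //; apply: eq_bigr => l _.
  rewrite (D_scale E hL oT k _ (sMM a l)) //; congr (_ * _).
  rewrite (D_mul E hL oT k (smooth_MU hL uE setT i a) (smooth_MU hL uE setT j l)) //.
  by rewrite !(D_M hL uE hC).
transitivity (\sum_a \sum_l M q i a * M q j l * (\sum_m (b a m * C l k m + b m l * C a k m))).
  under eq_bigr => a _ do under eq_bigr => l _ do rewrite mulrDr.
  under [RHS]eq_bigr => a _ do under eq_bigr => l _ do rewrite big_split mulrDr.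
  under eq_bigr => a _ do rewrite big_split.
  under [RHS]eq_bigr => a _ do rewrite big_split.
  rewrite !big_split /=; congr (_ + _).
    apply: eq_bigr => a _.
    under eq_bigr => l _ do rewrite mulrA mulr_sumr.
    under [RHS]eq_bigr => l _ do rewrite mulr_sumr.
    rewrite exchange_big /=; apply: eq_bigr => m _; apply: eq_bigr => l _; ring.
  rewrite exchange_big /= [RHS]exchange_big /=; apply: eq_bigr => l _.
  under eq_bigr => a _ do rewrite mulrA mulr_sumr.
  under [RHS]eq_bigr => a _ do rewrite mulr_sumr.
  rewrite exchange_big /=; apply: eq_bigr => m _; apply: eq_bigr => a _; ring.
(* The cocycle identity for (a, l, k) replaces the two terms by one in which the index k has moved
   onto b. *)
transitivity (\sum_a \sum_l M q i a * M q j l * (- \sum_m b k m * C a l m)).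
  apply: eq_bigr => a _; apply: eq_bigr => l _; congr (_ * _).
  have := cb a l k; rewrite big_split /= => /eqP; rewrite addr_eq0 => /eqP <-.
  apply: eq_bigr => m _; congr (_ + _).
  have -> : b m l = - b l m by have := congr1 (fun X : 'M[R]_n => X l m) ab; rewrite !mxE.
  by rewrite (C_anti hL uE hC a k m) mulrNN.
transitivity (- \sum_m b k m * \sum_a \sum_l M q i a * M q j l * C a l m).
  rewrite -sumrN exchange_big /=.
  under eq_bigr => l _ do under eq_bigr => a _ do rewrite mulrN mulr_sumr -sumrN.
  under eq_bigr => l _ do rewrite exchange_big /=.
  rewrite exchange_big /=; apply: eq_bigr => m _; rewrite mulr_sumr -sumrN exchange_big /=.
  apply: eq_bigr => a _; rewrite mulr_sumr -sumrN; apply: eq_bigr => l _; ring.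
(* Structure constants contracted twice with M equal M contracted once with the structure constants,
   so the factor [C i j p] of a coboundary appears. *)
under eq_bigr => m _ do rewrite (M_hom q i j m) mulr_sumr.
rewrite exchange_big /= -sumrN; apply: eq_bigr => p _.
rewrite mulNr mulr_suml; apply: (congr1 -%R); apply: eq_bigr => m _; ring.
Qed.

Lemma Ad_class (b : 'M[R]_n) q : cocycle2 C b ->
  coboundary2 C (M q *m b *m (M q)^T - b).
Proof.
move=> cb; have oT : open [set: G] := openT.
pose F p : 'M[R]_n := \matrix_(i, j) \sum_a \sum_l b a l * (M p i a * M p j l).
have FE p : M p *m b *m (M p)^T = F p.
  apply/matrixP => i j; rewrite !mxE exchange_big; apply: eq_bigr => l _.
  rewrite !mxE mulr_suml; apply: eq_bigr => a _; ring.
have F1 : F 1%g = b by rewrite -FE M1 mul1mx trmx1 mulmx1.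
have sF i j : smooth_fun A setT (fun p => F p i j : R^o).
  have s2 : smooth_fun A setT (fun p => \sum_a \sum_l b a l * (M p i a * M p j l) : R^o).
    apply: (smooth_fun_sum _ (co oT)) => a; apply: (smooth_fun_sum _ (co oT)) => l.
    apply: (smooth_scale hL _ oT); apply: (smooth_funM (co oT)); exact: (smooth_MU hL uE).
  by apply: (smooth_fun_eq pA (co oT) _ s2) => p _; rewrite mxE.
have cF p k : coboundary2 C (\matrix_(i, j) D k (fun p => F p i j) p).
  exists (\row_m (- \sum_l M p m l * b k l)) => i j; rewrite mxE.
  under [RHS]eq_bigr => m _ do rewrite mxE.
  rewrite -(D_adM2 k i j p cb); congr (D k _ p); apply/funext => x.
  by rewrite mxE.
apply/coboundary2P; rewrite FE -F1 linearB mulmxBl; apply/eqP; rewrite subr_eq0; apply/eqP.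
apply/rowP => p.
(* Coefficients of one linear functional that annihilates the coboundaries. Its value on F is shown
   to be constant along G, so it agrees at q and at the identity. *)
pose kap i j : R := cokermx Cmx (mxvec_index i j) p.
have phiE (X : 'M[R]_n) : (mxvec X *m cokermx Cmx) 0 p = \sum_i \sum_j kap i j * X i j.
  rewrite mxE (reindex _ (curry_mxvec_bij _ _)) /= pair_bigA /=.
  by apply: eq_bigr => -[i j] _ /=; rewrite mxvecE mulrC.
apply: (etrans (phiE (F q))); apply: (etrans _ (esym (phiE (F 1%g)))).
have s1 i j : smooth_fun A setT (fun x => kap i j * F x i j : R^o).
  exact: (smooth_scale hL _ oT (sF i j)).
have s2 i : smooth_fun A setT (fun x => \sum_j kap i j * F x i j : R^o).
  exact: (smooth_fun_sum _ (co oT)).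
have s3 : smooth_fun A setT (fun x => \sum_i \sum_j kap i j * F x i j : R^o).
  exact: (smooth_fun_sum _ (co oT)).
apply: (D0_const oT cG s3) => // k x _.
rewrite (D_sum E hL oT k _ s2) //.
transitivity (\sum_i \sum_j kap i j * (\matrix_(i, j) D k (fun p => F p i j) x) i j).
  apply: eq_bigr => i _; rewrite (D_sum E hL oT k _ (s1 i)) //; apply: eq_bigr => j _.
  by rewrite (D_scale E hL oT k _ (sF i j)) //; congr (_ * _); rewrite [RHS]mxE.
apply: (etrans (esym (phiE _))).
by have /coboundary2P -> := cF x k; rewrite mxE.
Qed.

(** Once al is known to be constant it can be computed at a single point q0. There al + b is minus
    the difference between b and its adjoint transform, a coboundary by [Ad_class], plus the
    coboundary of h. *)
Lemma alpha_class (b : 'M[R]_n) U (a f : 'I_n -> G -> R^o) : cocycle2 C b ->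
  open U -> connected U -> U !=set0 ->
  (forall i, smooth_fun A U (a i)) -> (forall i, smooth_fun A U (f i)) ->
  (forall i j q, U q -> D i (a j) q - D j (a i) q - \sum_k C i j k * a k q = b i j) ->
  (forall i j q, U q -> D j (f i) q = T i (a j) q) ->
  exists2 al : 'M[R]_n, (forall i j q, U q ->
     T i (f j) q - T j (f i) q + \sum_l C i j l * f l q = al i j) &
    coboundary2 C (al + b).
Proof.
move=> cb oU cU [q0 Uq0] sa sf da df.
pose al i j : G -> R^o := fun q => T i (f j) q - T j (f i) q + \sum_l C i j l * f l q.
have sCf i j : smooth_fun A U (fun q => \sum_l C i j l * f l q : R^o).
  by apply: (smooth_fun_sum _ (co oU)) => l; apply: (smooth_scale hL _ oU).
have sT i j : smooth_fun A U (T i (f j)) by exact: (smoothT_ E hL i oU).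
have sal i j : smooth_fun A U (al i j).
  by apply: (smooth_funD (co oU)) => //; apply: (smooth_funB (co oU)).
(* Since T commutes with D and D_k f_j = T_j a_k, the derivative D_k of al is ([T_i, T_j] + C_ij^l
   T_l) a_k, which vanishes by [T_comm]. *)
have al0 i j k q : U q -> D k (al i j) q = 0.
  move=> Uq; rewrite (D_add E hL oU k _ (sCf i j) Uq); last exact: (smooth_funB (co oU)).
  rewrite (D_sub E hL oU k (sT i j) (sT j i) Uq).
  rewrite (D_sum E hL oU k) // => [|l]; last exact: (smooth_scale hL _ oU).
  rewrite -(TD_comm E hL oU i k (sf j) Uq) -(TD_comm E hL oU j k (sf i) Uq).
  have e1 i' j' : T i' (D k (f j')) q = T i' (T j' (a k)) q.
    apply: (T_eq E hL oU i' _ (smoothT_ E hL j' oU (sa k)) Uq) => p Up.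
    by rewrite df.
  rewrite (e1 i j) (e1 j i) (T_comm i j oU (sa k) Uq) addrC.
  apply/eqP; rewrite subr_eq0; apply/eqP; apply: eq_bigr => l _.
  by rewrite (D_scale E hL oU k _ (sf l) Uq) df.
exists (\matrix_(i, j) al i j q0).
  move=> i j q Uq; rewrite mxE; apply: (D0_const oU cU (sal i j)) => // k x Ux.
  exact: al0.
(* The a_k enter the commutator of the T_i through C_ij^l M_lk a_k. Combined with C_ij^l f_l, this
   leaves the coboundary of h_l = f_l - M_lk a_k. *)
pose h i : R := f i q0 - \sum_k M q0 i k * a k q0.
have [t tE] := Ad_class q0 cb.
exists (- t + \row_l h l) => i j.
have TE i' j' : T i' (f j') q0 = \sum_x \sum_y M q0 i' x * M q0 j' y * D y (a x) q0.
  rewrite (T_M hL uE); apply: eq_bigr => x _; rewrite df // (T_M hL uE) mulr_sumr.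
  by apply: eq_bigr => y _; rewrite mulrA.
have TTE : T i (f j) q0 - T j (f i) q0 = 
    - (M q0 *m b *m (M q0)^T) i j - \sum_l C i j l * \sum_k M q0 l k * a k q0.
  have TEji : T j (f i) q0 = \sum_x \sum_y M q0 j y * M q0 i x * D x (a y) q0.
    by rewrite (TE j i) exchange_big.
  rewrite (TE i j) TEji -sumrB.
  transitivity (\sum_x \sum_y M q0 i x * M q0 j y * (- b x y - \sum_k C x y k * a k q0)).
    apply: eq_bigr => x _; rewrite -sumrB; apply: eq_bigr => y _.
    rewrite -(da x y q0 Uq0); ring.
  under eq_bigr => x _ do under eq_bigr => y _ do rewrite mulrBr.
  under eq_bigr => x _ do rewrite sumrB.
  rewrite sumrB; congr (_ - _).
    rewrite !mxE -sumrN exchange_big /=; apply: eq_bigr => y _.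
    by rewrite !mxE mulr_suml -sumrN; apply: eq_bigr => x _; ring.
  transitivity (\sum_k a k q0 * \sum_x \sum_y M q0 i x * M q0 j y * C x y k).
    under [RHS]eq_bigr => k _ do rewrite mulr_sumr.
    rewrite [RHS]exchange_big /=; apply: eq_bigr => x _.
    under [RHS]eq_bigr => k _ do rewrite mulr_sumr.
    rewrite [RHS]exchange_big /=; apply: eq_bigr => y _.
    by rewrite mulr_sumr; apply: eq_bigr => k _; ring.
  under eq_bigr => k _ do rewrite (M_hom q0 i j k) mulr_sumr.
  rewrite exchange_big /=; apply: eq_bigr => l _; rewrite mulr_sumr.
  by apply: eq_bigr => k _; ring.
rewrite !mxE /al TTE.
under [RHS]eq_bigr => k _ do rewrite !mxE mulrDl.
rewrite big_split /=.
have -> : \sum_k - t 0 k * C i j k = - (M q0 *m b *m (M q0)^T - b) i j.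
  by rewrite tE -sumrN; apply: eq_bigr => k _; rewrite mulNr.
have -> : \sum_k h k * C i j k = \sum_l C i j l * f l q0 - \sum_l C i j l * \sum_k M q0 l k * a k q0.
  by rewrite -sumrB; apply: eq_bigr => k _; rewrite /h mulrBl mulrC [X in _ - X]mulrC.
rewrite [(_ - b) i j]mxE [(- b) i j]mxE; ring.
Qed.

End AdjointClass.

(** * Fibre coordinates on the tangent bundle *)

Section TangentFrame.
Variables (R : realType) (n : nat) (G : topGroupType) (A : atlas 'rV[R]_n G).
Local Notation V := 'rV[R]_n.
Variables (E : 'M[R]_n) (C : 'I_n -> 'I_n -> 'I_n -> R).
Hypotheses (hL : lie_group A) (uE : E \in unitmx) (hC : structure_constants A E C).
Let fV : findim V := @findim_rV R n.
Let pA := premanifoldG hL.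
Let cc_at q : charts A (chart_at A q).
Proof. by have [[_ _ /(_ q)[]]] := hL. Qed.
Let dd_at q : dom (chart_at A q) q.
Proof. by have [[_ _ /(_ q)[]]] := hL. Qed.
Let co U := @copen_open R n G A hL U.
Let coT U (oU : open U) := copen_tau pA (co oU).
Local Notation TA := (tatlas A).
Implicit Types (c : chart V G) (U : set G) (v : G * V).

(* The row (w^1(v), ..., w^n(v)) of fibre coordinates. *)
Definition tW v : V := v.2 *m invmx (eM A E v.1).

Lemma qvelE j v : qvel A E j v = tW v 0 j.
Proof. by []. Qed.

Lemma tWK v : tW v *m eM A E v.1 = v.2.
Proof. exact: (mulmxKV (eM_unit hL uE v.1)). Qed.

Lemma tW_mk q (w : V) : tW (q, w *m eM A E q) = w.
Proof. exact: (mulmxK (eM_unit hL uE q)). Qed.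

Lemma tW_sum v : v.2 = \sum_j tW v 0 j *: Ehat A E j v.1.
Proof. by rewrite -{1}(tWK v) mul_matrix_row. Qed.

(* In the chart c, the coordinate field d/dq^a is the sum over i of
   Theta_ai Ehat_i. *)
Definition Theta c (x : V) : 'M[R]_n := invmx (vmat A (Ehat A E) c x).

Lemma vmat_tcomp c q (w : V) : charts A c -> dom c q ->
  tcomp A c q (w *m eM A E q) = w *m vmat A (Ehat A E) c (cmap c q).
Proof.
move=> cc dq; rewrite /eM /vmat !mul_matrix_row; apply: (etrans (ddv_sum _ _ _ _)).
by apply: eq_bigr => j _; rewrite ddvZ vcompE (cmapK pA cc dq).
Qed.

Lemma Theta_comp c q u : charts A c -> dom c q ->
  tcomp A c q u *m Theta c (cmap c q) = u *m invmx (eM A E q).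
Proof.
move=> cc dq; rewrite -{1}[u](mulmxKV (eM_unit hL uE q)) (vmat_tcomp _ cc dq) /Theta mulmxK //.
by apply: (vmat_Ehat_unit hL uE cc); exact: img_cmap.
Qed.

Lemma Theta_at q : Theta (chart_at A q) (cmap (chart_at A q) q) = invmx (eM A E q).
Proof.
congr invmx; apply/row_matrixP => j; rewrite !rowK vcompE (cmapK pA (cc_at q) (dd_at q)).
exact: (tcomp_at pA).
Qed.

Lemma tW_chart c z : charts A c -> img c setT z.1 ->
  tW (cinv (tchart A c) z) = z.2 *m Theta c z.1.
Proof.
move=> cc iz; have [dx _ e] := imgP pA cc iz.
rewrite cinv_tchart /tW -(Theta_comp _ cc dx) e; congr (_ *m _).
by have := tcomp_surj pA z.2 cc dx; rewrite e.
Qed.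

Lemma smooth_Theta c i j : charts A c -> smooth_on (img c setT) (fun x => Theta c x i j : R^o).
Proof.
move=> cc; apply: smooth_invmx; first exact: (open_imgT hL cc).
  by move=> k l; apply: smooth_vmat => // m; exact: smooth_Ehat.
by move=> x ix; exact: vmat_Ehat_unit.
Qed.

Lemma Theta_unit c x : charts A c -> img c setT x -> Theta c x \in unitmx.
Proof. by move=> cc ix; rewrite unitmx_inv; exact: vmat_Ehat_unit. Qed.

Lemma smooth_tW_chart c : charts A c ->
  smooth_on [set z : V * V | img c setT z.1] (fun z => z.2 *m Theta c z.1).
Proof.
move=> cc; have oi := open_imgT hL cc; have oO := @open_fst R V V _ oi.
apply/(smooth_rVP _ oO) => j.
have sa a : smooth_on [set z : V * V | img c setT z.1] (fun z : V * V => z.2 0 a : R^o).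
  have := (smooth_rVP (fun z : V * V => z.2) oO).2 (@smooth_snd R V V _) a; exact.
have st a : smooth_on [set z : V * V | img c setT z.1] (fun z : V * V => Theta c z.1 a j : R^o).
  exact: (smooth_comp fV (@findimR R) oO oi (fun z h => h) (@smooth_fst R V V _) (smooth_Theta a j cc)).
have := smooth_sum (index_enum 'I_n) oO (fun a (_ : xpredT a) => smoothM oO (sa a) (st a)).
by apply: (smooth_eq oO) => z _; rewrite mxE.
Qed.

Lemma img_tchartE c : charts A c -> img (tchart A c) setT = [set z : V * V | img c setT z.1].
Proof. by move=> cc; apply/seteqP; split => z /(img_tchartP pA setT z cc). Qed.

Lemma smooth_tW : smooth_fun TA setT tW.
Proof.
move=> _ [c cc <-]; have oO := @open_fst R V V _ (open_imgT hL cc).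
rewrite img_tchartE //.
apply: (smooth_eq oO _ (smooth_tW_chart cc)) => z iz.
by rewrite /= -[RHS]/(tW (cinv (tchart A c) z)) tW_chart.
Qed.

Lemma smooth_tWU U : smooth_fun TA (tau_preim U) tW.
Proof. by apply: smooth_funS smooth_tW. Qed.

Lemma smooth_tWj U j : open U -> smooth_fun TA (tau_preim U) (fun v => tW v 0 j : R^o).
Proof.
move=> oU c cc; apply: ((smooth_rVP _ (coT oU cc)).2 (@smooth_tWU U c cc) j).
Qed.

Lemma Dv_tWj v (Z : V * V) j :
  let c := chart_at A v.1 in let x := cmap c v.1 in
  Dv TA v Z (fun v => tW v 0 j : R^o) =
  (Z.2 *m invmx (eM A E v.1)) 0 j + \sum_a v.2 0 a * dd (fun y => Theta c y a j : R^o) x Z.1.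
Proof.
move=> c x; have cc : charts A c := cc_at _.
have oi := open_imgT hL cc; have oO := @open_fst R V V _ oi.
have ix : img c setT x by apply: img_cmap => //; exact: dd_at.
set z := (x, v.2).
have zE : cmap (tchart A c) v = z by rewrite cmap_tchart (tcomp_at pA).
rewrite /Dv -[cmap _ v]/(cmap (tchart A c) v) zE.
have sa a : differentiable (fun z : V * V => z.2 0 a : R^o) z.
  exact: (smooth_diff ((smooth_rVP (fun z : V * V => z.2) openT).2 (@smooth_snd R V V _) a)).
have dth a := smooth_diff (smooth_Theta a j cc) ix.
have dfst : differentiable (fst : V * V -> V) z := smooth_diff (@smooth_fst R V V setT) I.
have st a : differentiable (fun z : V * V => Theta c z.1 a j : R^o) z.
  exact: (differentiable_comp dfst (dth a)).
have dm a : differentiable (fun z : V * V => z.2 0 a * Theta c z.1 a j : R^o) z.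
  exact: (@differentiableM _ _ (fun z : V * V => z.2 0 a) (fun z : V * V => Theta c z.1 a j)).
transitivity (dd (fun z : V * V => \sum_a z.2 0 a * Theta c z.1 a j : R^o) z Z).
  apply: (dd_eq _ oO) => [y iy|//|]; last exact: differentiable_dsum.
  by rewrite /= -[tW _]/(tW (cinv (tchart A c) y)) tW_chart // mxE.
rewrite (ddsum _ _ dm) mxE -(Theta_at v.1) -big_split; apply: eq_bigr => a _.
rewrite (ddM _ (sa a) (st a)) addrC; congr (_ + _).
  rewrite mulrC; congr (_ * _).
  rewrite -(dd_rV (f := fun z : V * V => z.2)); last exact: (smooth_diff (@smooth_snd R V V setT)).
  by rewrite (@dd_lin _ _ _ snd) // => y; exact: cvg_snd.
congr (_ * _); apply: (etrans (dd_comp Z dfst (dth a))); congr (dd _ _ _).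
by rewrite (@dd_lin _ _ _ fst) // => y; exact: cvg_fst.
Qed.

Lemma Dv_vlift_tW v i j : Dv TA v (vlift (Ehat A E i) v) (fun v => tW v 0 j : R^o) = (i == j)%:R.
Proof.
rewrite Dv_tWj /vlift /=; under eq_bigr => a _ do rewrite ddv0 mulr0.
rewrite big1 // addr0.
have -> : Ehat A E i v.1 = basis_vec R i *m eM A E v.1 by rewrite -rowE rowK.
by rewrite (mulmxK (eM_unit hL uE v.1)) mxE eqxx eq_sym.
Qed.

(* In the flow of a complete lift, the fibre coordinates change by the bracket
   with the frame; in particular the Etilde_i^C annihilate them. *)
Lemma Dv_clift_tW X v j (xi : 'I_n -> 'I_n -> R) :
  (forall m, bracket A X (Ehat A E m) v.1 = \sum_k xi m k *: Ehat A E k v.1) ->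
  Dv TA v (clift A X v) (fun v => tW v 0 j : R^o) = - \sum_m tW v 0 m * xi m j.
Proof.
move=> hxi; rewrite Dv_tWj /clift /= -ddE.
set c := chart_at A v.1; set x := cmap c v.1; set q := v.1.
have cc : charts A c := cc_at _; have oi := open_imgT hL cc.
have ix : img c setT x by apply: img_cmap => //; exact: dd_at.
have cx : cinv c x = q by exact: (cmapK pA cc (dd_at _)).
have se m : smooth_on (img c setT) (vcomp A (Ehat A E m) c) by exact: (smooth_Ehat hL).
have key m : \sum_a (Ehat A E m q) 0 a * dd (fun y => Theta c y a j : R^o) x (X q) =
   - (dd (vcomp A (Ehat A E m) c) x (X q) *m invmx (eM A E q)) 0 j.
  have dv a : differentiable (fun y => vcomp A (Ehat A E m) c y 0 a : R^o) x.
    exact: (smooth_diff ((smooth_rVP _ oi).2 (se m) a) ix).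
  have dt a := smooth_diff (smooth_Theta a j cc) ix.
  have dm a : differentiable (fun y => vcomp A (Ehat A E m) c y 0 a * Theta c y a j : R^o) x.
    exact: (@differentiableM _ _ (fun y => vcomp A (Ehat A E m) c y 0 a) (fun y => Theta c y a j)).
  (* The product of the frame matrix with [Theta] is the identity matrix; differentiating it
     expresses the derivative of [Theta] through that of the frame. *)
  have E0 : dd (fun y => \sum_a vcomp A (Ehat A E m) c y 0 a * Theta c y a j : R^o) x (X q) = 0.
    rewrite -[RHS](ddC ((m == j)%:R : R^o) x (X q)).
    apply: (dd_eq _ oi) => [y iy|//|]; last exact: differentiable_cst.
    have := congr1 (fun B : 'M[R]_n => B m j) (mulmxV (vmat_Ehat_unit hL uE cc iy)).
    rewrite /= !mxE => <-; apply: eq_bigr => a _; by rewrite mxE.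
  move: E0; rewrite (ddsum _ _ dm).
  under eq_bigr => a _ do rewrite (ddM _ (dv a) (dt a)).
  rewrite big_split /= => /eqP; rewrite addr_eq0 => /eqP E0.
  rewrite [in RHS]mxE; transitivity (\sum_a vcomp A (Ehat A E m) c x 0 a * dd (fun y => Theta c y a j : R^o) x (X q)).
    by apply: eq_bigr => a _; rewrite vcompE cx (tcomp_at pA).
  rewrite E0; congr (- _); apply: eq_bigr => a _.
  rewrite -(dd_rV (f := vcomp A (Ehat A E m) c)); last exact: (smooth_diff (se m) ix).
  by rewrite mulrC (Theta_at q).
have vE a : v.2 0 a = \sum_m tW v 0 m * (Ehat A E m q) 0 a.
  by rewrite {1}(tW_sum v) summxE; apply: eq_bigr => m _; rewrite mxE.
have -> : \sum_a v.2 0 a * dd (fun y => Theta c y a j : R^o) x (X q) =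
   - \sum_m tW v 0 m * (dd (vcomp A (Ehat A E m) c) x (X q) *m invmx (eM A E q)) 0 j.
  under eq_bigr => a _ do rewrite vE mulr_suml.
  rewrite exchange_big /= -sumrN; apply: eq_bigr => m _.
  by rewrite -mulrN -key mulr_sumr; apply: eq_bigr => a _; rewrite mulrA.
have -> : (dd (vcomp A X c) x v.2 *m invmx (eM A E q)) 0 j =
   \sum_m tW v 0 m * (dd (vcomp A X c) x (Ehat A E m q) *m invmx (eM A E q)) 0 j.
  rewrite {1}(tW_sum v) ddv_sum mulmx_suml summxE; apply: eq_bigr => m _.
  by rewrite ddvZ -scalemxAl mxE.
rewrite -sumrB -sumrN; apply: eq_bigr => m _; rewrite -mulrBr -mulrN; congr (_ * _).
have <- : (bracket A X (Ehat A E m) q *m invmx (eM A E q)) 0 j = xi m j.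
  have -> : bracket A X (Ehat A E m) q = (\row_k xi m k) *m eM A E q.
    by rewrite hxi /eM mul_matrix_row; apply: eq_bigr => k _; rewrite mxE.
  by rewrite (mulmxK (eM_unit hL uE q)) mxE.
have -> : bracket A X (Ehat A E m) q =
    dd (vcomp A (Ehat A E m) c) x (X q) - dd (vcomp A X c) x (Ehat A E m q) by rewrite !ddE.
have mB (B1 B2 : V) : (B1 - B2) 0 j = B1 0 j - B2 0 j by rewrite !mxE.
by rewrite mulmxBl mB opprB.
Qed.

(** The bracket is tested on the coordinates of the chart at q, where it is the commutator of two
    derivations that commute because left and right translations do. *)
Lemma bracket_Etilde i m q : bracket A (Etilde A E i) (Ehat A E m) q = 0.
Proof.
set c := chart_at A q; have cc : charts A c := cc_at q; have dq : dom c q := dd_at q.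
have oU := open_dom hL cc.
rewrite -[LHS](tcomp_at pA q) tcomp_Dv; apply/rowP => j; rewrite [RHS]mxE.
have sc := smooth_cmap pA cc.
have sf : smooth_fun A (dom c) (fun p => cmap c p 0 j : R^o).
  by move=> c' cc'; apply: (smooth_rVP _ (open_tr pA cc' cc)).2; exact: (sc c' cc').
rewrite /Dv (dd_rV (f := cmap c \o cinv c)); last exact: (smooth_at (co oU) sc cc dq dq).
rewrite -[LHS]/(Dv A q (bracket A (Etilde A E i) (Ehat A E m) q) (fun p => cmap c p 0 j : R^o)).
have sX : smooth_field A (dom c) (Etilde A E i).
  by apply: smooth_fieldS; exact: (smooth_Etilde hL).
have sY : smooth_field A (dom c) (Ehat A E m).
  by apply: smooth_fieldS; exact: (smooth_Ehat hL).
apply: (etrans (bracketE fV pA (co oU) sX sY sf dq)); apply/eqP; rewrite subr_eq0; apply/eqP.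
exact: (left_right_commute hL E i m oU sf dq).
Qed.

End TangentFrame.

Lemma findim_linear (R : realType) (V W : normedModType R) (f : {linear V -> W}) (U : set V) :
  findim V -> [/\ continuous f, smooth_on U f & forall x v, dd f x v = f v].
Proof.
move=> [K [b [l [cl lE]]]].
have sf : smooth_on setT f.
  apply: (smooth_eq openT _ (smooth_sum (index_enum K) openT
    (fun i (_ : xpredT i) => smooth_scaler (f (b i)) openT (smooth_lin setT (cl i))))) => x _.
  by rewrite {2}(lE x) linear_sum; apply: eq_bigr => i _; rewrite linearZ.
have cf : continuous f by move=> x; exact: (smooth_cont sf I).
split=> [||x v] //; first by apply: smoothS sf.
exact: dd_lin.
Qed.

Section TangentFields.
Variables (R : realType) (n : nat) (G : topGroupType) (A : atlas 'rV[R]_n G).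
Local Notation V := 'rV[R]_n.
Variables (E : 'M[R]_n) (C : 'I_n -> 'I_n -> 'I_n -> R).
Hypotheses (hL : lie_group A) (uE : E \in unitmx) (hC : structure_constants A E C).
Let fV : findim V := @findim_rV R n.
Let fVV := findim_prod fV fV.
Let pA := premanifoldG hL.
Let pT := premanifold_tatlas fV pA.
Let cc_at q : charts A (chart_at A q).
Proof. by have [[_ _ /(_ q)[]]] := hL. Qed.
Let dd_at q : dom (chart_at A q) q.
Proof. by have [[_ _ /(_ q)[]]] := hL. Qed.
Let co U := @copen_open R n G A hL U.
Local Notation TA := (tatlas A).
Implicit Types (c : chart V G) (U : set G) (v : G * V).

Lemma tchart_charts c : charts A c -> charts TA (tchart A c).
Proof. by move=> cc; exists c. Qed.

Lemma tcomp_vlift c v u : charts A c -> dom c v.1 ->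
  tcomp TA (tchart A c) v (0, u) = (0, tcomp A c v.1 u).
Proof.
move=> cc dv; set c0 := chart_at A v.1; set x := cmap c0 v.1.
have cc0 : charts A c0 := cc_at _; have d0 : dom c0 v.1 := dd_at _.
have ix : img c0 (dom c) x by exact: img_cmap.
rewrite /tcomp -[chart_at TA v]/(tchart A c0) cmap_tchart (tcomp_at pA) -/x.
have iz w : img (tchart A c0) (dom (tchart A c)) (x, w).
  by apply/(img_tchartP pA (dom c) (x, w) cc0).
have dtr w : differentiable (tr (tchart A c0) (tchart A c)) (x, w).
  exact: (diff_tr pT (tchart_charts cc0) (tchart_charts cc) (iz w)).
rewrite -(dd_partial2 _ (dtr v.2)).
have -> : (fun y => tr (tchart A c0) (tchart A c) (x, y)) = (fun y => (tr c0 c x, dd (tr c0 c) x y)).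
  by apply/funext => y; exact: (tr_tchart pA cc0 cc).
have lin : linear (dd (tr c0 c) x : V -> V) by move=> a u1 u2; rewrite ddvD ddvZ.
pose lM := GRing.isLinear.Build _ _ _ _ _ lin.
pose l : {linear V -> V} := HB.pack (dd (tr c0 c) x : V -> V) lM.
have [cl sl dl] := findim_linear l setT fV.
have dlx : differentiable (dd (tr c0 c) x : V -> V) v.2 := smooth_diff sl (I : setT v.2).
have dcst : differentiable (fun _ : V => tr c0 c x) v.2 by exact: differentiable_cst.
apply: (etrans (dd_pair u dcst dlx)).
exact: (congr2 (@pair V V) (ddC _ _ _) (dl v.2 u)).
Qed.

Lemma smooth_vlift U X : open U -> smooth_field A U X -> smooth_field TA (tau_preim U) (vlift X).
Proof.
move=> oU sX _ [c cc <-].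
have oO := open_img_tchart pA cc (co oU); have oi := co oU cc.
have sI z : img (tchart A c) (tau_preim U) z -> img c U z.1 by move=> /(img_tchartP pA U z cc).
have s1 : smooth_on (img (tchart A c) (tau_preim U)) (fun z : V * V => vcomp A X c z.1).
  exact: (smooth_comp fV fV oO oi sI (@smooth_fst R V V _) (sX c cc)).
apply: (smooth_eq oO _ (smooth_pair oO (@smooth_cst _ _ _ _ (0 : V)) s1)) => z iz.
have [dx Ux e] := imgP pA cc (sI z iz).
apply: esym; apply: (etrans (vcompE _ _ _ _)).
apply: (etrans (tcomp_vlift _ cc _)); first by rewrite cinv_tchart.
by rewrite cinv_tchart vcompE.
Qed.

Lemma smooth_vlift_Ehat U i : open U -> smooth_field TA (tau_preim U) (vlift (Ehat A E i)).
Proof. by move=> oU; apply: smooth_vlift => //; apply: smooth_fieldS; exact: smooth_Ehat. Qed.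

Lemma cinv_tchart_at q u : let c := chart_at A q in cinv (tchart A c) (cmap c q, u) = (q, u).
Proof.
move=> c; have cc : charts A c := cc_at q; have dq : dom c q := dd_at q.
rewrite -[RHS](tchartK pA (v := (q, u)) cc dq) cmap_tchart /=.
by rewrite (tcomp_at pA).
Qed.

Section Fibre.
Variables (U : set G) (F : G * V -> R^o) (q : G).
Hypotheses (oU : open U) (sF : smooth_fun TA (tau_preim U) F) (Uq : U q).

Definition fib (w : V) : R^o := F (q, w *m eM A E q).

Let c := chart_at A q.
Let cc : charts A c := cc_at q.
Let oO := open_img_tchart pA cc (co oU).
Let x := cmap c q.
Let lm : {linear V -> V} := mulmxr (eM A E q).

Let sm : smooth_on setT (fun w : V => (x, w *m eM A E q)).
Proof.
have [_ sl _] := findim_linear lm setT fV.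
by apply: (smooth_pair openT); [exact: smooth_cst|exact: sl].
Qed.

Let inO w : setT w -> img (tchart A c) (tau_preim U) (x, w *m eM A E q).
Proof. by move=> _; apply/(img_tchartP pA U _ cc); apply: img_cmap => //; exact: dd_at. Qed.

Lemma smooth_fib : smooth_on setT fib.
Proof.
have := smooth_comp fVV (@findimR R) openT oO inO sm (sF (tchart_charts cc)).
by apply: (smooth_eq openT) => w _; rewrite /fib -(cinv_tchart_at q).
Qed.

Lemma dd_fib w u : dd fib w u = Dv TA (q, w *m eM A E q) (0, u *m eM A E q) F.
Proof.
have dF := smooth_diff (sF (tchart_charts cc)) (inO (I : setT w)).
have dm := smooth_diff sm (I : setT w).
have -> : fib = fun w => (F \o cinv (tchart A c)) (x, w *m eM A E q).
  by apply/funext => w'; rewrite /fib -(cinv_tchart_at q).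
apply: (etrans (dd_comp u dm dF)).
rewrite /Dv -[chart_at TA _]/(tchart A c) cmap_tchart (tcomp_at pA); congr (dd _ _ _).
have [_ sl dl] := findim_linear lm setT fV.
have dcst : differentiable (fun _ : V => x) w by exact: differentiable_cst.
apply: (etrans (dd_pair u dcst (smooth_diff sl (I : setT w)))).
exact: (congr2 (@pair V V) (ddC _ _ _) (dl w u)).
Qed.

Lemma pd_fib i w : pd i fib w = Dv TA (q, w *m eM A E q) (vlift (Ehat A E i) (q, w *m eM A E q)) F.
Proof. by rewrite /pd dd_fib /vlift /= -rowE rowK. Qed.

End Fibre.

Lemma smooth_zero_section U (F : G * V -> R^o) : open U -> smooth_fun TA (tau_preim U) F ->
  smooth_fun A U (fun q => F (q, 0) : R^o).
Proof.
move=> oU sF c cc; have oi := co oU cc.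
have oO := open_img_tchart pA cc (co oU).
have sp : smooth_on (img c U) (fun y : V => (y, 0 : V)).
  apply: (smooth_pair oi); last exact: smooth_cst.
  by apply: (@smooth_lin R V V _ idfun) => y; exact: cvg_id.
have inO y : img c U y -> img (tchart A c) (tau_preim U) (y, 0).
  by move=> iy; apply/(img_tchartP pA U _ cc).
apply: (smooth_eq oi _ (smooth_comp fVV (@findimR R) oi oO inO sp (sF _ (tchart_charts cc)))).
by move=> y iy; rewrite -[LHS]/(F (cinv (tchart A c) (y, 0))) cinv_tchart ddv0.
Qed.

Definition fcoef (X : G -> V) (i : 'I_n) : G -> R^o := fun q => (X q *m invmx (eM A E q)) 0 i.

Lemma fcoef_sum X q : X q = \sum_i fcoef X i q *: Ehat A E i q.
Proof. by rewrite -mul_matrix_row -/(eM A E q) (mulmxKV (eM_unit hL uE q)). Qed.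

Lemma smooth_fcoef U X i : open U -> smooth_field A U X -> smooth_fun A U (fcoef X i).
Proof.
move=> oU sX c cc; have oi := co oU cc.
have sa a : smooth_on (img c U) (fun y => vcomp A X c y 0 a : R^o).
  exact: ((smooth_rVP _ oi).2 (sX c cc) a).
have st a : smooth_on (img c U) (fun y => Theta A E c y a i : R^o).
  by apply: smoothS (smooth_Theta hL uE a i cc); exact: imgS.
have := smooth_sum (index_enum 'I_n) oi (fun a (_ : xpredT a) => smoothM oi (sa a) (st a)).
apply: (smooth_eq oi) => y iy; have [dy Uy e] := imgP pA cc iy.
rewrite /fcoef /= -(Theta_comp hL uE _ cc dy) e mxE; apply: eq_bigr => a _.
by rewrite vcompE.
Qed.

Lemma cliftE X v : clift A X v =
  (X v.1, dd (vcomp A X (chart_at A v.1)) (cmap (chart_at A v.1) v.1) v.2).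
Proof. by rewrite ddE. Qed.

(** Leibniz rule for complete lifts: (f Y)^C = f Y^C + (df along v) Y^V, summed over the frame
    expansion of X. *)
Lemma clift_decomp U X v : open U -> smooth_field A U X -> U v.1 ->
  clift A X v = \sum_i fcoef X i v.1 *: clift A (Ehat A E i) v +
                \sum_i Dv A v.1 v.2 (fcoef X i) *: vlift (Ehat A E i) v.
Proof.
move=> oU sX Uv; set q := v.1; set c := chart_at A q; set x := cmap c q.
have cc : charts A c := cc_at q; have oi := co oU cc.
have dq : dom c q := dd_at q.
have ix : img c U x by exact: img_cmap.
have cx : cinv c x = q := cmapK pA cc dq.
have sf i : smooth_on (img c U) (fcoef X i \o cinv c) := smooth_fcoef i oU sX cc.
have se i : smooth_on (img c U) (vcomp A (Ehat A E i) c).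
  have h : smooth_field A U (Ehat A E i) by apply: smooth_fieldS; exact: (smooth_Ehat hL).
  exact: (h c cc).
have sum_pair (I : Type) (r : seq I) (F1 F2 : I -> V) (a : I -> R) :
    \sum_(i <- r) a i *: (F1 i, F2 i) = (\sum_(i <- r) a i *: F1 i, \sum_(i <- r) a i *: F2 i).
  by elim: r => [|i r IH]; rewrite ?big_nil // !big_cons IH.
rewrite cliftE /vlift -/q -/c -/x.
under eq_bigr => i _ do rewrite cliftE -/q -/c -/x.
rewrite !sum_pair; apply: (congr2 (@pair V V)).
  rewrite [X in _ + X]big1 ?addr0 -?fcoef_sum // => i _; exact: scaler0.
apply/rowP => j.
have sXj := (smooth_rVP _ oi).2 (sX c cc) j.
have sej i := (smooth_rVP _ oi).2 (se i) j.
have df i := smooth_diff (sf i) ix; have de i := smooth_diff (sej i) ix.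
rewrite (dd_rV (f := vcomp A X c)); last exact: (smooth_diff (sX c cc) ix).
transitivity (dd (fun y => \sum_i (fcoef X i \o cinv c) y * vcomp A (Ehat A E i) c y 0 j : R^o) x v.2).
  apply: (dd_eq _ oi) => [y iy|//|].
    have [dy Uy e] := imgP pA cc iy.
    rewrite vcompE [X in tcomp _ _ _ X](fcoef_sum X (cinv c y)).
    rewrite /tcomp ddv_sum summxE; apply: eq_bigr => i _.
    by rewrite ddvZ mxE vcompE.
  by apply: differentiable_dsum => i; apply: differentiableM.
rewrite ddsum => [|i]; last exact: differentiableM.
rewrite [RHS]mxE !summxE -big_split; apply: eq_bigr => i _ /=.
rewrite (ddM _ (df i) (de i)) /= cx [X in _ = X + _]mxE [X in _ = _ + X]mxE; congr (_ * _ + _).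
  by rewrite (dd_rV (f := vcomp A (Ehat A E i) c)); last exact: (smooth_diff (se i) ix).
by rewrite mulrC vcompE cx (tcomp_at pA).
Qed.

End TangentFields.

(** * Euler-Lagrange expressions *)

Section Lagrange.
Variables (R : realType) (n : nat) (G : topGroupType) (A : atlas 'rV[R]_n G).
Local Notation V := 'rV[R]_n.
Variables (E : 'M[R]_n) (C : 'I_n -> 'I_n -> 'I_n -> R) (Gam : G * V -> V * V).
Hypotheses (hL : lie_group A) (uE : E \in unitmx) (hC : structure_constants A E C).
Hypothesis hG : invariant_sode A Gam.
Let fV : findim V := @findim_rV R n.
Let fVV := findim_prod fV fV.
Let pA := premanifoldG hL.
Let pT := premanifold_tatlas fV pA.
Let cc_at q : charts A (chart_at A q).
Proof. by have [[_ _ /(_ q)[]]] := hL. Qed.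
Let dd_at q : dom (chart_at A q) q.
Proof. by have [[_ _ /(_ q)[]]] := hL. Qed.
Let co U := @copen_open R n G A hL U.
Let coT U (oU : open U) := copen_tau pA (co oU).
Local Notation TA := (tatlas A).
Local Notation D := (frameD A E).
Local Notation T := (frameT A E).
Local Notation Eh := (Ehat A E).
Local Notation tWj j := (fun v : G * V => tW A E v 0 j : R^o).
Implicit Types (c : chart V G) (U : set G) (v : G * V) (F : G * V -> R^o).

Lemma Gam1 v : (Gam v).1 = v.2.
Proof.
have [[_ hs] _] := hG; set c := chart_at A v.1.
have cc : charts A c := cc_at _; have dv : dom c v.1 := dd_at _.
have iz : img (tchart A c) setT (cmap (tchart A c) v) by exact: img_cmap.
have := hs c _ cc iz; rewrite vcompE (tchartK pA cc dv).
rewrite (tcomp_at pT v (Gam v)) => ->.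
by rewrite cmap_tchart (tcomp_at pA).
Qed.

Lemma smooth_Gam U : smooth_field TA (tau_preim U) Gam.
Proof.
have [[sG _] _] := hG; move=> c cc; apply: smoothS (sG c cc); exact: imgS.
Qed.

Definition LV (X : G -> V) F : G * V -> R^o := fun v => Dv TA v (vlift X v) F.
Definition LC (X : G -> V) F : G * V -> R^o := fun v => Dv TA v (clift A X v) F.
Definition LG F : G * V -> R^o := fun v => Dv TA v (Gam v) F.
Definition EL (X : G -> V) F : G * V -> R^o := fun v => LG (LV X F) v - LC X F v.

Lemma lagrangianE U F : lagrangian A Gam U F <->
  [/\ smooth_fun TA (tau_preim U) F, regular A U F &
      forall X, smooth_field A U X -> forall v, U v.1 -> EL X F v = 0].
Proof.
have E1 X v : lieD TA Gam (lieD TA (vlift X) F) v = LG (LV X F) v.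
  rewrite lieDE; have -> : lieD TA (vlift X) F = LV X F by apply/funext => w; exact: lieDE.
  by [].
have E2 X v : lieD TA (clift A X) F v = LC X F v by exact: lieDE.
split=> -[s r h]; split => // X sX v Uv.
  by rewrite /EL -E1 -E2 (h X sX v Uv) subrr.
by rewrite E1 E2; apply/eqP; rewrite -subr_eq0; apply/eqP; exact: h.
Qed.

Lemma LV_decomp X F v : LV X F v = \sum_i fcoef A E X i v.1 * LV (Eh i) F v.
Proof.
rewrite /LV.
have -> : vlift X v = \sum_i fcoef A E X i v.1 *: vlift (Eh i) v.
  have sum_pair (K : Type) (r : seq K) (F2 : K -> V) (a : K -> R) :
      \sum_(i <- r) a i *: (0 : V, F2 i) = (0, \sum_(i <- r) a i *: F2 i).
    elim: r => [|i r IH]; rewrite ?big_nil // !big_cons IH.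
    by apply: (congr2 (@pair V V)) => //=; rewrite scaler0 addr0.
  by rewrite /vlift sum_pair -(fcoef_sum hL uE).
by rewrite Dvv_sum; apply: eq_bigr => i _; rewrite DvvZ.
Qed.

Lemma smooth_LV U i F : open U -> smooth_fun TA (tau_preim U) F ->
  smooth_fun TA (tau_preim U) (LV (Eh i) F).
Proof.
move=> oU sF; exact: (smooth_lieD fVV pT (coT oU) (smooth_vlift_Ehat E hL i oU) sF).
Qed.

Lemma smooth_LG U F : open U -> smooth_fun TA (tau_preim U) F ->
  smooth_fun TA (tau_preim U) (LG F).
Proof. by move=> oU sF; exact: (smooth_lieD fVV pT (coT oU) (@smooth_Gam U) sF). Qed.

(** Tensoriality of the Euler-Lagrange expression. The derivatives of the coefficients of X come
    once from Gam and once from the complete lift; they are equal because the base component of Gam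
    at v is v, and so they cancel. *)
Lemma EL_decomp U X F v : open U -> smooth_fun TA (tau_preim U) F -> smooth_field A U X ->
  U v.1 -> EL X F v = \sum_i fcoef A E X i v.1 * EL (Eh i) F v.
Proof.
move=> oU sF sX Uv; have oT := coT oU.
have sc i : smooth_fun A U (fcoef A E X i) := smooth_fcoef hL uE i oU sX.
have scT i : smooth_fun TA (tau_preim U) (fun v => fcoef A E X i v.1 : R^o).
  exact: (smooth_fun_tau fV pA (@findimR R) (co oU) (sc i)).
have sL i := smooth_LV i oU sF.
have LE : LV X F = (fun v => \sum_i fcoef A E X i v.1 * LV (Eh i) F v).
  by apply/funext => w; exact: LV_decomp.
apply: (etrans (congr1 (fun H => LG H v - LC X F v) LE)).
have E1 : LG (fun v => \sum_i fcoef A E X i v.1 * LV (Eh i) F v) v =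
    \sum_i (fcoef A E X i v.1 * LG (LV (Eh i) F) v + LV (Eh i) F v * Dv A v.1 v.2 (fcoef A E X i)).
  rewrite /LG (Dv_sum pT _ _ oT) => [||//]; last by move=> i; exact: smooth_funM.
  apply: eq_bigr => i _; rewrite (DvM pT _ oT (scT i) (sL i) Uv).
  by rewrite (Dv_tau pA _ (co oU) (sc i) Uv) Gam1.
have E2 : LC X F v = \sum_i (fcoef A E X i v.1 * LC (Eh i) F v + LV (Eh i) F v * Dv A v.1 v.2 (fcoef A E X i)).
  rewrite /LC (clift_decomp hL uE oU sX Uv) DvvD !Dvv_sum -big_split; apply: eq_bigr => i _.
  by rewrite !DvvZ; congr (_ + _); exact: mulrC.
rewrite E1 E2 -sumrB; apply: eq_bigr => i _.
by rewrite opprD addrACA subrr addr0 -mulrBr.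
Qed.

Lemma Tlambda_tW h v : Tlambda A h v = ((h * v.1)%g, tW A E v *m eM A E (h * v.1)%g).
Proof.
have vE : v = (v.1, \sum_j tW A E v 0 j *: Eh j v.1).
  by rewrite -(tW_sum hL uE v); case: v.
transitivity ((h * v.1)%g, (Tlambda A h (v.1, \sum_j tW A E v 0 j *: Eh j v.1)).2).
  by rewrite {1}vE.
rewrite (Tlambda_lin A h v.1) mul_matrix_row; apply: (congr2 (@pair G V)) => //.
by apply: eq_bigr => j _; rewrite (Tlambda_Ehat hL).
Qed.

Lemma tW_inv h v : tW A E (Tlambda A h v) = tW A E v.
Proof. by rewrite Tlambda_tW (tW_mk hL uE). Qed.

Lemma inv_fun_tW F : invariant_fun A F -> forall v, F v = fib A E F 1%g (tW A E v).
Proof.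
move=> iF v; rewrite /fib -(iF v.1 (1%g, _)) Tlambda_tW (tW_mk hL uE) /= mulg1.
by rewrite (tWK hL uE); case: v.
Qed.

(* Gam(w^k); by invariance it is a function [gam k] of the fibre coordinates. *)
Definition gamma k : G * V -> R^o := LG (tWj k).
Definition gam k : V -> R^o := fib A E (gamma k) 1%g.

(** Gam is related to itself by each [Tlambda h], and w^k is unchanged by it, so differentiating w^k
    along Gam gives an invariant function. *)
Lemma gamma_inv k : invariant_fun A (gamma k).
Proof.
move=> h v; have [_ hi] := hG.
have oF (e : chart (V * V)%type (G * V)%type) : charts TA e -> copen TA (Tlambda A h @^-1` dom e).
  move=> [c0 cc0 <-]; exact: (copen_tau pA (lam_open (h := h) hL cc0)).
have sF : smooth_map TA TA (Tlambda A h).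
  exact: (smooth_tmap pA pA fV fV (@lam_open _ _ _ _ hL h) (lam_smooth hL h)).
have sk : smooth_fun TA (tau_preim setT) (tWj k) := smooth_tWj hL uE k openT.
have E1 := fun w => @Dv_tmap _ _ _ _ _ _ _ _ pT pT oF sF _ setT _ w (Gam v) (coT openT) sk I.
rewrite /gamma /LG.
apply: (etrans (congr1 (fun Z => Dv TA (Tlambda A h v) Z (tWj k)) (esym (congr1 snd (hi h v))))).
apply: (etrans (E1 v)).
have E2 : (fun w => tWj k (Tlambda A h w)) = tWj k by apply/funext => w; rewrite tW_inv.
exact: (congr1 (fun H => Dv TA v (Gam v) H) E2).
Qed.

Lemma gammaE k v : gamma k v = gam k (tW A E v).
Proof. exact: (inv_fun_tW (gamma_inv k)). Qed.

Lemma smooth_gam k : smooth_on setT (gam k).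
Proof.
apply: (smooth_fib E hL (U := setT) openT) => //.
exact: (smooth_LG openT (smooth_tWj hL uE k openT)).
Qed.

Lemma smooth_KW U (K : V -> R^o) : open U -> smooth_on setT K ->
  smooth_fun TA (tau_preim U) (fun v => K (tW A E v) : R^o).
Proof.
move=> oU sK; apply: (smooth_fun_comp pT fV (coT oU) openT _ (@smooth_tWU R n G A E hL uE U) sK).
by [].
Qed.

Lemma Dv_KW (K : V -> R^o) v Z : smooth_on setT K ->
  Dv TA v Z (fun v => K (tW A E v) : R^o) = \sum_j Dv TA v Z (tWj j) * pd j K (tW A E v).
Proof.
move=> sK; have sW := @smooth_tWU R n G A E hL uE setT.
rewrite (Dv_comp pT _ (coT openT) sW (I : setT _)); last exact: (smooth_diff sK I).
rewrite dd_pd; apply: eq_bigr => j _; congr (_ * _).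
rewrite /Dv (dd_rV (f := tW A E \o _)) //.
by apply: (smooth_at (coT openT) sW) => //; [exists (chart_at A v.1)|exact: dd_at].
Qed.

(* The Euler-Lagrange expression of the function K(w) against Ehat_i. *)
Definition eps (K : V -> R^o) i (w : V) : R^o :=
  \sum_j gam j w * pd j (pd i K) w + \sum_m \sum_k w 0 m * C i m k * pd k K w.

Definition lform (K : V -> R^o) (a : 'I_n -> G -> R^o) (phi : G -> R^o) : G * V -> R^o :=
  fun v => K (tW A E v) + \sum_j a j v.1 * tW A E v 0 j + phi v.1.

Section LForm.
Variables (U : set G) (K : V -> R^o) (a : 'I_n -> G -> R^o) (phi : G -> R^o).
Hypotheses (oU : open U) (sK : smooth_on setT K) (sa : forall i, smooth_fun A U (a i)).
Hypothesis sphi : smooth_fun A U phi.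

Let saT j : smooth_fun TA (tau_preim U) (fun v => a j v.1 : R^o).
Proof. exact: (smooth_fun_tau fV pA (@findimR R) (co oU) (sa j)). Qed.
Let sphiT : smooth_fun TA (tau_preim U) (fun v => phi v.1 : R^o).
Proof. exact: (smooth_fun_tau fV pA (@findimR R) (co oU) sphi). Qed.
Let sprod j : smooth_fun TA (tau_preim U) (fun v => a j v.1 * tW A E v 0 j : R^o).
Proof. exact: (smooth_funM (coT oU) (saT j) (smooth_tWj hL uE j oU)). Qed.

Lemma smooth_lform : smooth_fun TA (tau_preim U) (lform K a phi).
Proof.
apply: (smooth_funD (coT oU) _ sphiT); apply: (smooth_funD (coT oU) (smooth_KW oU sK)).
exact: (smooth_fun_sum _ (coT oU)).
Qed.

Lemma Dv_lform v Z : U v.1 -> Dv TA v Z (lform K a phi) =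
  \sum_j Dv TA v Z (tWj j) * (pd j K (tW A E v) + a j v.1)
  + \sum_j tW A E v 0 j * Dv A v.1 Z.1 (a j) + Dv A v.1 Z.1 phi.
Proof.
move=> Uv; rewrite (DvD pT _ (coT oU) _ sphiT Uv); last first.
  apply: (smooth_funD (coT oU) (smooth_KW oU sK)); exact: (smooth_fun_sum _ (coT oU)).
rewrite (DvD pT _ (coT oU) (smooth_KW oU sK) _ Uv); last exact: (smooth_fun_sum _ (coT oU)).
rewrite (Dv_tau pA _ (co oU) sphi Uv); congr (_ + _).
rewrite (Dv_KW _ _ sK) (Dv_sum pT _ _ (coT oU) sprod Uv).
under [X in _ + X]eq_bigr => j _ do rewrite
  (DvM pT _ (coT oU) (saT j) (smooth_tWj hL uE j oU) Uv) (Dv_tau pA _ (co oU) (sa j) Uv).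
rewrite [X in _ + X]big_split addrA; congr (_ + _) => /=.
by rewrite -big_split; apply: eq_bigr => j _ /=; rewrite mulrDr; congr (_ + _); exact: mulrC.
Qed.

Lemma LV_lform i v : U v.1 -> LV (Eh i) (lform K a phi) v = pd i K (tW A E v) + a i v.1.
Proof.
move=> Uv; rewrite /LV (Dv_lform _ Uv) /vlift /= !Dv0 addr0.
rewrite [X in _ + X]big1 ?addr0 => [|j _]; last by rewrite Dv0 mulr0.
under eq_bigr => j _ do rewrite (Dv_vlift_tW hL uE v i j).
rewrite (bigD1 i) //= eqxx mul1r big1 ?addr0 // => j ji.
by rewrite eq_sym (negPf ji) mul0r.
Qed.

Lemma LC_Etilde_lform i v : U v.1 -> LC (Etilde A E i) (lform K a phi) v =
  \sum_j tW A E v 0 j * T i (a j) v.1 + T i phi v.1.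
Proof.
move=> Uv; rewrite /LC (Dv_lform _ Uv) big1 ?add0r //.
move=> j _; rewrite (Dv_clift_tW hL uE (xi := fun _ _ => 0) j).
  by rewrite big1 ?oppr0 ?mul0r // => m _; rewrite mulr0.
move=> m; rewrite bracket_Etilde // big1 // => k _; exact: scale0r.
Qed.

Lemma LC_Ehat_lform i v : U v.1 -> LC (Eh i) (lform K a phi) v =
  - \sum_m \sum_j tW A E v 0 m * C i m j * (pd j K (tW A E v) + a j v.1)
  + \sum_j tW A E v 0 j * D i (a j) v.1 + D i phi v.1.
Proof.
move=> Uv; rewrite /LC (Dv_lform _ Uv) frameDE; congr (_ + _ + _).
rewrite exchange_big /= -sumrN; apply: eq_bigr => j _.
rewrite (Dv_clift_tW hL uE (xi := C i) j) => [|m]; last exact: hC.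
by rewrite mulNr mulr_suml.
Qed.

Lemma LG_tau f v : smooth_fun A U f -> U v.1 ->
  LG (fun v => f v.1) v = \sum_j tW A E v 0 j * D j f v.1.
Proof.
move=> sf Uv; rewrite /LG (Dv_tau pA _ (co oU) sf Uv) Gam1 {1}(tW_sum hL uE v) Dvv_sum.
by apply: eq_bigr => j _; rewrite DvvZ frameDE.
Qed.

(** The bracket multiplying w^k is the frame component (i, k) of the exterior derivative of the
    1-form a. The terms added to K(w) thus contribute a magnetic force -(da)_ik w^k and a potential
    force -(d phi)_i. *)
Lemma EL_lform i v : U v.1 -> EL (Eh i) (lform K a phi) v =
  eps K i (tW A E v)
  - (\sum_k tW A E v 0 k * (D i (a k) v.1 - D k (a i) v.1 - \sum_l C i k l * a l v.1)
     + D i phi v.1).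
Proof.
move=> Uv; rewrite /EL (LC_Ehat_lform i Uv).
have -> : LG (LV (Eh i) (lform K a phi)) v =
    \sum_j gam j (tW A E v) * pd j (pd i K) (tW A E v) + \sum_j tW A E v 0 j * D j (a i) v.1.
  have sp := smooth_KW oU (smooth_pd i sK).
  transitivity (LG (fun v => pd i K (tW A E v) + a i v.1) v).
    apply: (Dv_eq pT _ (coT oU) Uv _ (smooth_funD (coT oU) sp (saT i))) => w Uw.
    by rewrite (LV_lform i Uw).
  rewrite /LG (DvD pT _ (coT oU) sp (saT i) Uv) -[X in _ + X]/(LG (fun v => a i v.1) v).
  rewrite (LG_tau (sa i) Uv); congr (_ + _).
  rewrite (Dv_KW _ _ (smooth_pd i sK)); apply: eq_bigr => j _.
  by rewrite -[Dv _ _ _ _]/(gamma j v) gammaE.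
rewrite /eps; set S0 := \sum_j gam j _ * _; set S1 := \sum_j _ * D j (a i) _.
set S2 := \sum_j _ * D i (a j) _; set P := D i phi _.
have -> : \sum_m \sum_j tW A E v 0 m * C i m j * (pd j K (tW A E v) + a j v.1) =
   \sum_m \sum_k tW A E v 0 m * C i m k * pd k K (tW A E v) +
   \sum_m tW A E v 0 m * (\sum_l C i m l * a l v.1).
  rewrite -big_split; apply: eq_bigr => m _ /=; rewrite mulr_sumr -big_split.
  by apply: eq_bigr => j _ /=; rewrite mulrDr mulrA.
have -> : \sum_k tW A E v 0 k * (D i (a k) v.1 - D k (a i) v.1 - \sum_l C i k l * a l v.1) =
   S2 - S1 - \sum_m tW A E v 0 m * (\sum_l C i m l * a l v.1).
  by rewrite -!sumrB; apply: eq_bigr => k _; rewrite !mulrBr.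
set S3 := \sum_m \sum_k _; set S4 := \sum_m _ * _; ring.
Qed.

End LForm.

End Lagrange.

(** Index algebra behind [spray_dv_ea]. Here v and q stand for the derivatives of the force in
    velocities and positions, sv and sg for derivatives of v and g along the field, and sg is given
    by condition (2). Of the quadratic terms, Y is symmetric and cancels, while X completes the
    expression P of condition (3). *)
Lemma multiplier_algebra (R : realFieldType) n (g v q sg sv : 'I_n -> 'I_n -> R) a b :
  (forall i j, g i j = g j i) ->
  (forall i j, sg i j = - (2^-1 * \sum_c v c j * g i c) - 2^-1 * \sum_c v c i * g j c) ->
  \sum_c (v c b * sg a c + g a c * sv c b) - \sum_c (v c a * sg b c + g b c * sv c a) =
  \sum_c g a c * (sv c b - 2 * q c b - 2^-1 * \sum_l v l b * v c l)
  - \sum_c g b c * (sv c a - 2 * q c a - 2^-1 * \sum_l v l a * v c l)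
  + 2 * (\sum_c q c b * g a c - \sum_c q c a * g b c).
Proof.
move=> gC sgE.
pose X i j := \sum_c v c j * \sum_l v l c * g i l.
pose Y i j := \sum_c v c j * \sum_l v l i * g c l.
pose Z i j := \sum_c g i c * sv c j.
pose F i j := \sum_c q c j * g i c.
have SN i j : \sum_c (v c j * sg i c + g i c * sv c j) = - (2^-1 * X i j) - 2^-1 * Y i j + Z i j.
  rewrite big_split; congr (_ + _); rewrite !mulr_sumr -!sumrN -big_split.
  by apply: eq_bigr => c _ /=; rewrite sgE; ring.
have YC : Y a b = Y b a.
  rewrite /Y; under eq_bigr => c _ do rewrite mulr_sumr.
  rewrite exchange_big; apply: eq_bigr => l _ /=; rewrite mulr_sumr; apply: eq_bigr => c _.
  by rewrite (gC c) mulrCA.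
have J i j : \sum_c g i c * (sv c j - 2 * q c j - 2^-1 * \sum_l v l j * v c l) =
    Z i j - 2 * F i j - 2^-1 * X i j.
  have -> : X i j = \sum_c g i c * \sum_l v l j * v c l.
    rewrite /X; under eq_bigr => c _ do rewrite mulr_sumr.
    rewrite exchange_big; apply: eq_bigr => l _ /=; rewrite mulr_sumr; apply: eq_bigr => c _.
    by rewrite [RHS]mulrC mulrA.
  by rewrite /Z /F !mulr_sumr -!sumrB; apply: eq_bigr => c _; ring.
by rewrite !J !SN YC -/(F a b) -/(F b a); lra.
Qed.

Lemma dv_ea_arith (R : realFieldType) (x q q' y h h' : R) :
  q = q' -> h = h' -> x + q + y - h = x + y + (q' - h').
Proof. by move=> -> ->; ring. Qed.

Lemma dq_ea_arith (R : realFieldType) (t x y p q h k s1 s2 : R) :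
  t = x - y -> s1 = 0 -> s2 = 0 -> h = k ->
  x + s1 + p - h - (y + s2 + q - k) = t + p - q.
Proof. by move=> -> -> -> ->; ring. Qed.

Lemma dv_ea_sym_arith (R : realFieldType) (x x' y w w' h h' : R) :
  x' = x -> w = w' -> h' = - h ->
  x + y + h + (x' + w' + h') = 2 * (x + 2^-1 * y + 2^-1 * w).
Proof. by move=> -> -> ->; lra. Qed.

Lemma helm2_solve (R : realFieldType) (x p q : R) :
  x + 2^-1 * p + 2^-1 * q = 0 -> x = - (2^-1 * p) - 2^-1 * q.
Proof. by lra. Qed.

Lemma half_skew_arith (R : realFieldType) (p q h : R) :
  2^-1 * (p - q) + h = - (2^-1 * p) - 2^-1 * q + p + h.
Proof. by lra. Qed.

Lemma spray_dv_ea_arith (R : realFieldType) (s1 s2 c1 c2 t d p f : R) :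
  s1 = c1 -> s2 = c2 -> c1 - c2 = p + 2 * f -> d = t + f ->
  2 * (2^-1 * (s1 - s2) + t) = p + 2 * d.
Proof. by move=> -> -> + ->; lra. Qed.

(** * Euler-Lagrange expressions of a second-order field in coordinates *)

Section SecondOrder.
Variables (R : realType) (n : nat).
Local Notation V := 'rV[R]_n.
Implicit Types (phi : V * V -> R^o) (z u : V * V).
Variables (O : set (V * V)) (f : 'I_n -> V * V -> R^o) (K : V * V -> R^o).
Hypotheses (oO : open O) (sf : forall i, smooth_on O (f i)) (sK : smooth_on O K).

Definition qdir (i : 'I_n) : V * V := (basis_vec R i, 0).
Definition vdir (i : 'I_n) : V * V := (0, basis_vec R i).

Lemma dd_split phi z u :
  dd phi z u = \sum_i u.1 0 i * dd phi z (qdir i) + \sum_i u.2 0 i * dd phi z (vdir i).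
Proof.
have uE : u = \sum_i u.1 0 i *: qdir i + \sum_i u.2 0 i *: vdir i.
  have sum_pair (I : Type) (r : seq I) (F1 F2 : I -> V) (a : I -> R) :
      \sum_(i <- r) a i *: (F1 i, F2 i) = (\sum_(i <- r) a i *: F1 i, \sum_(i <- r) a i *: F2 i).
    by elim: r => [|i r IH]; rewrite ?big_nil // !big_cons IH.
  rewrite !sum_pair; case: u => u1 u2; apply: (congr2 (@pair V V)) => /=.
    rewrite [X in _ + X]big1 ?addr0 => [|i _]; [exact: row_sum_delta|exact: scaler0].
  rewrite [X in X + _]big1 ?add0r => [|i _]; [exact: row_sum_delta|exact: scaler0].
by rewrite {1}uE ddvD !ddv_sum; congr (_ + _); apply: eq_bigr => i _; exact: ddvZ.
Qed.

Definition sprayD phi z : R^o := dd phi z (z.2, \row_i f i z).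
Local Notation S := sprayD.

Lemma sprayDE phi z :
  S phi z = \sum_i z.2 0 i * dd phi z (qdir i) + \sum_i f i z * dd phi z (vdir i).
Proof.
by rewrite /sprayD dd_split; congr (_ + _); apply: eq_bigr => i _; rewrite mxE.
Qed.

Let sz i : smooth_on O (fun z : V * V => z.2 0 i : R^o).
Proof. exact: ((smooth_rVP (fun z : V * V => z.2) oO).2 (@smooth_snd R V V O) i). Qed.

Lemma smooth_spray phi : smooth_on O phi -> smooth_on O (S phi).
Proof.
move=> sp; have sd u : smooth_on O (fun y => dd phi y u) := smooth_dd u sp.
apply: (smooth_eq oO (f := fun z => \sum_i z.2 0 i * dd phi z (qdir i) + \sum_i f i z * dd phi z (vdir i))).
  by move=> z _; rewrite sprayDE.
apply: (smoothD oO); apply: (smooth_sum _ oO) => i _.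
  exact: (smoothM oO (sz i) (sd _)).
exact: (smoothM oO (sf i) (sd _)).
Qed.

Lemma dd_z2 z u i : dd (fun z : V * V => z.2 0 i : R^o) z u = u.2 0 i.
Proof.
rewrite -(dd_rV (f := fun z : V * V => z.2)); last exact: (smooth_diff (@smooth_snd R V V setT)).
by rewrite (@dd_lin _ _ _ snd) // => y; exact: cvg_snd.
Qed.

(** The direction u passes through the second derivatives by symmetry; the two sums come from
    differentiating the coefficients qdot^i and f^i of the field. *)
Lemma dd_spray phi z u : smooth_on O phi -> O z ->
  dd (S phi) z u = S (fun y => dd phi y u) z + \sum_i u.2 0 i * dd phi z (qdir i)
                   + \sum_i dd (f i) z u * dd phi z (vdir i).
Proof.
move=> sp Oz; have sd w : smooth_on O (fun y => dd phi y w) := smooth_dd w sp.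
have dz i := smooth_diff (sz i) Oz; have df i := smooth_diff (sf i) Oz.
have ds w := smooth_diff (sd w) Oz.
have dm1 i : differentiable (fun z : V * V => z.2 0 i * dd phi z (qdir i) : R^o) z.
  exact: (smooth_diff (smoothM oO (sz i) (sd _)) Oz).
have dm2 i : differentiable (fun z : V * V => f i z * dd phi z (vdir i) : R^o) z.
  exact: (smooth_diff (smoothM oO (sf i) (sd _)) Oz).
have -> : S phi = fun z => \sum_i z.2 0 i * dd phi z (qdir i) + \sum_i f i z * dd phi z (vdir i).
  by apply/funext => y; exact: sprayDE.
rewrite ddD; [|exact: differentiable_dsum..].
rewrite !ddsum // sprayDE -addrA; apply: esym; apply: (etrans (addrACA _ _ _ _)).
apply: esym; congr (_ + _); rewrite -big_split; apply: eq_bigr => i _ /=.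
  rewrite (ddM _ (dz i) (ds _)) dd_z2 (dd_sym _ _ oO sp Oz); congr (_ + _); exact: mulrC.
by rewrite (ddM _ (df i) (ds _)) (dd_sym _ _ oO sp Oz); congr (_ + _); exact: mulrC.
Qed.

(* With K a Lagrangian and f the force of a second-order field, in a chart:
   [gg] is the multiplier, [ea a] the a-th Euler-Lagrange expression, [helm2] the
   left-hand side of the Helmholtz condition (2), and [jac k j] the P^k_j of
   condition (3). Condition (2) says that the vertical Jacobian of [ea] is
   skew-symmetric, and then (3) computes its derivative along the field. *)
Definition gg a b : V * V -> R^o := fun z => dd (fun y => dd K y (vdir a)) z (vdir b).
Definition fv c b : V * V -> R^o := fun z => dd (f c) z (vdir b).
Definition fq c b : V * V -> R^o := fun z => dd (f c) z (qdir b).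
Definition ea a : V * V -> R^o := fun z => S (fun y => dd K y (vdir a)) z - dd K z (qdir a).
Definition hh a b : V * V -> R^o := fun z =>
  dd (fun y => dd K y (vdir a)) z (qdir b) - dd (fun y => dd K y (vdir b)) z (qdir a).
Definition helm2 a b z := S (gg a b) z + 2^-1 * \sum_c fv c b z * gg a c z
  + 2^-1 * \sum_c fv c a z * gg c b z.
Definition jac k j z := S (fv k j) z - 2 * fq k j z - 2^-1 * \sum_l fv l j z * fv k l z.

Let sKd u : smooth_on O (fun y => dd K y u). Proof. exact: smooth_dd. Qed.
Let sKdd u w : smooth_on O (fun y => dd (fun y => dd K y u) y w). Proof. exact: smooth_dd. Qed.

Lemma ggC a b z : O z -> gg a b z = gg b a z.
Proof. move=> Oz; exact: (dd_sym _ _ oO sK Oz). Qed.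

Lemma S_eq phi psi z : (forall y, O y -> phi y = psi y) -> smooth_on O phi -> O z ->
  S psi z = S phi z.
Proof. move=> e sp Oz; exact: (dd_eq _ oO e Oz (smooth_diff sp Oz)). Qed.

Lemma smooth_ea a : smooth_on O (ea a).
Proof. exact: (smoothB oO (smooth_spray (sKd _)) (sKd _)). Qed.

Lemma dd_ea a z u : O z -> dd (ea a) z u =
  S (fun y => dd (fun y => dd K y (vdir a)) y u) z
  + \sum_i u.2 0 i * dd (fun y => dd K y (vdir a)) z (qdir i)
  + \sum_i dd (f i) z u * gg a i z - dd (fun y => dd K y (qdir a)) z u.
Proof.
move=> Oz; apply: (etrans (ddB _ _ _)).
- exact: (smooth_diff (smooth_spray (sKd _)) Oz).
- exact: (smooth_diff (sKd _) Oz).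
by rewrite (dd_spray _ (sKd _) Oz).
Qed.

Lemma sum_basis (F : 'I_n -> R) b : \sum_i basis_vec R b 0 i * F i = F b.
Proof.
rewrite (bigD1 b) //= mxE !eqxx mul1r big1 ?addr0 // => i ib.
by rewrite mxE eqxx (negPf ib) mul0r.
Qed.

Lemma sum_qdir (F : 'I_n -> R) b : \sum_i (qdir b).2 0 i * F i = 0.
Proof. by apply: big1 => i _; rewrite mxE mul0r. Qed.

Lemma dv_ea a b z : O z ->
  dd (ea a) z (vdir b) = S (gg a b) z + \sum_c fv c b z * gg a c z + hh a b z.
Proof.
move=> Oz; apply: (etrans (dd_ea _ _ Oz)).
have e1 : \sum_i (vdir b).2 0 i * dd (fun y => dd K y (vdir a)) z (qdir i) =
  dd (fun y => dd K y (vdir a)) z (qdir b) := sum_basis _ b.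
have e2 : dd (fun y => dd K y (qdir a)) z (vdir b) = dd (fun y => dd K y (vdir b)) z (qdir a).
  exact: (dd_sym _ _ oO sK Oz).
exact: (@dv_ea_arith R _ _ _ _ _ _ e1 e2).
Qed.

Lemma dq_ea a b z : O z -> dd (ea a) z (qdir b) - dd (ea b) z (qdir a) =
  S (hh a b) z + \sum_c fq c b z * gg a c z - \sum_c fq c a z * gg b c z.
Proof.
move=> Oz; apply: (etrans (congr2 (fun s t => s - t) (dd_ea _ _ Oz) (dd_ea _ _ Oz))).
have e0 : S (hh a b) z = S (fun y => dd (fun y => dd K y (vdir a)) y (qdir b)) z
   - S (fun y => dd (fun y => dd K y (vdir b)) y (qdir a)) z.
  apply: ddB; exact: (smooth_diff (sKdd _ _) Oz).
have e : dd (fun y => dd K y (qdir a)) z (qdir b) = dd (fun y => dd K y (qdir b)) z (qdir a).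
  exact: (dd_sym _ _ oO sK Oz).
have e1 := sum_qdir (fun i => dd (fun y => dd K y (vdir a)) z (qdir i)) b.
have e2 := sum_qdir (fun i => dd (fun y => dd K y (vdir b)) z (qdir i)) a.
exact: (@dq_ea_arith R _ _ _ _ _ _ _ _ _ e0 e1 e2 e).
Qed.

Lemma spray_cross a b z : O z -> S (fun y => \sum_c fv c b y * gg a c y) z =
  \sum_c (fv c b z * S (gg a c) z + gg a c z * S (fv c b) z).
Proof.
move=> Oz; have s1 c := smooth_dd (vdir b) (sf c).
have d1 c := smooth_diff (s1 c) Oz; have d2 c := smooth_diff (sKdd (vdir a) (vdir c)) Oz.
apply: (etrans (ddsum _ _ (fun c => smooth_diff (smoothM oO (s1 c) (sKdd (vdir a) (vdir c))) Oz))).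
by apply: eq_bigr => c _; exact: (ddM _ (d1 c) (d2 c)).
Qed.

Lemma dv_ea_sym a b z : O z ->
  dd (ea a) z (vdir b) + dd (ea b) z (vdir a) = 2 * helm2 a b z.
Proof.
move=> Oz; apply: (etrans (congr2 (fun s t => s + t) (dv_ea _ _ Oz) (dv_ea _ _ Oz))).
have e1 : S (gg b a) z = S (gg a b) z.
  by apply: S_eq (sKdd _ _) Oz => y Oy; exact: ggC.
have e2 : \sum_c fv c a z * gg c b z = \sum_c fv c a z * gg b c z.
  by apply: eq_bigr => c _; rewrite ggC.
have e3 : hh b a z = - hh a b z by rewrite /hh opprB.
exact: (@dv_ea_sym_arith R _ _ _ _ _ _ _ e1 e2 e3).
Qed.

(** With condition (2) available at all points of O, the Jacobian of [ea] is half the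
    antisymmetrisation of N plus [hh]. Differentiating this along the field produces the P terms,
    and the derivative of [hh] is exchanged for the curl of [ea] in positions by [dq_ea]. *)
Lemma spray_dv_ea a b z : (forall y i j, O y -> helm2 i j y = 0) -> O z ->
  2 * S (fun y => dd (ea a) y (vdir b)) z =
  \sum_c gg a c z * jac c b z - \sum_c gg b c z * jac c a z
  + 2 * (dd (ea a) z (qdir b) - dd (ea b) z (qdir a)).
Proof.
move=> H2 Oz.
pose N i j y : R^o := \sum_c fv c j y * gg i c y.
(* Condition (2) solved for the derivative of the multiplier along the field, which removes that
   derivative from [dv_ea]. *)
have SgE i j y : O y -> S (gg i j) y = - (2^-1 * N i j y) - 2^-1 * N j i y.
  move=> Oy; have := H2 y i j Oy; rewrite /helm2.
  have -> : \sum_c fv c i y * gg c j y = N j i y by apply: eq_bigr => c _; rewrite ggC.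
  move=> h; exact: (@helm2_solve R).
have s1 i j := smooth_dd (vdir j) (sf i).
have sN i j : smooth_on O (N i j).
  by apply: (smooth_sum _ oO) => c _; exact: (smoothM oO (s1 c j) (sKdd (vdir i) (vdir c))).
have shh : smooth_on O (hh a b) by exact: (smoothB oO (sKdd _ _) (sKdd _ _)).
have -> : S (fun y => dd (ea a) y (vdir b)) z = 2^-1 * (S (N a b) z - S (N b a) z) + S (hh a b) z.
  have dN i j := smooth_diff (sN i j) Oz.
  have e y : O y -> 2^-1 * (N a b y - N b a y) + hh a b y = dd (ea a) y (vdir b).
    move=> Oy; rewrite (dv_ea _ _ Oy) (SgE _ _ _ Oy) -/(N a b y).
    exact: (@half_skew_arith R).
  have sB : smooth_on O (fun y => N a b y - N b a y) := smoothB oO (sN _ _) (sN _ _).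
  have sh : smooth_on O (fun y => 2^-1 * (N a b y - N b a y) : R^o).
    exact: (smoothM oO (@smooth_cst _ _ _ _ (2^-1 : R^o)) sB).
  apply: (etrans (S_eq e (smoothD oO sh shh) Oz)).
  apply: (etrans (ddD _ (smooth_diff sh Oz) (smooth_diff shh Oz))); congr (_ + _).
  apply: (etrans (ddZ _ _ (smooth_diff sB Oz))); congr (_ * _).
  exact: (ddB _ (dN a b) (dN b a)).
have e1 := spray_cross a b Oz; have e2 := spray_cross b a Oz; have e3 := dq_ea a b Oz.
have e4 := multiplier_algebra (fun c j => fq c j z) (fun c j => S (fv c j) z) a b
  (fun i j => ggC i j Oz) (fun i j => SgE i j z Oz).
exact: (@spray_dv_ea_arith R _ _ _ _ _ _ _ _ e1 e2 e4 (etrans e3 (esym (addrA _ _ _)))).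
Qed.

End SecondOrder.

(** * Frame forms in a chart *)

Section PoincareBall.
Variables (R : realType) (n : nat).
Local Notation V := 'rV[R]_n.
Implicit Types (f : V -> R^o) (U : set V) (a x y v : V).
Let fV : findim V := @findim_rV R n.

Lemma smooth_translation U a : smooth_on U (fun y : V => y + a).
Proof.
have sid : smooth_on setT (fun y : V => y).
  by apply: (@smooth_lin R V V setT idfun) => y; exact: cvg_id.
have := smoothD openT sid (@smooth_cst _ V _ setT a); exact: smoothS.
Qed.

Lemma dd_translation (W : normedModType R) (f : V -> W) a y v : differentiable f (y + a) ->
  dd (fun y => f (y + a)) y v = dd f (y + a) v.
Proof.
move=> df; have dt := smooth_diff (@smooth_translation setT a) (I : setT y).
apply: (etrans (dd_comp v dt df)); congr (dd _ _ _).
apply: (etrans (ddD _ _ _)); [exact: ex_diff|exact: differentiable_cst|].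
by rewrite dd_id ddC addr0.
Qed.

Variables (x0 : V) (r : R).
Local Notation B := (ball x0 r).
Let B0 : set V := ball 0 r.

Let inB0 y : B (y + x0) = B0 y.
Proof. by rewrite /B0 -!ball_normE /= opprD addrCA subrr addr0 sub0r. Qed.
Let inB y : B0 (y - x0) = B y.
Proof. by rewrite -inB0 subrK. Qed.
Let oB0 : open B0. Proof. exact: ball_open. Qed.
Let oB : open B. Proof. exact: ball_open. Qed.
Let starB0 : starshaped B0.
Proof.
move=> x t; rewrite /B0 -!ball_normE /= !sub0r !normrN normrZ => xr /andP[t0 t1].
by rewrite (ger0_norm t0); apply: le_lt_trans xr; rewrite ler_piMl.
Qed.
Let sh f : smooth_on B f -> smooth_on B0 (fun y => f (y + x0)).
Proof.
move=> sf; apply: (smooth_comp fV (@findimR R) oB0 oB _ (@smooth_translation _ _) sf).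
by move=> y; rewrite inB0.
Qed.
Let sh' f : smooth_on B0 f -> smooth_on B (fun y => f (y - x0)).
Proof.
move=> sf; apply: (smooth_comp fV (@findimR R) oB oB0 _ (@smooth_translation _ _) sf).
by move=> y; rewrite inB.
Qed.
Let pdsh f i y : smooth_on B f -> B0 y -> pd i (fun y => f (y + x0)) y = pd i f (y + x0).
Proof. by move=> sf By; apply: dd_translation; apply: (smooth_diff sf); rewrite inB0. Qed.
Let pdsh' f i y : smooth_on B0 f -> B y -> pd i (fun y => f (y - x0)) y = pd i f (y - x0).
Proof. by move=> sf By; apply: dd_translation; apply: (smooth_diff sf); rewrite inB. Qed.

Lemma poincare1_ball (om : 'I_n -> V -> R^o) : (forall i, smooth_on B (om i)) ->
  (forall i j x, B x -> pd i (om j) x = pd j (om i) x) ->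
  exists phi : V -> R^o, smooth_on B phi /\ forall i x, B x -> pd i phi x = om i x.
Proof.
move=> som closed.
have [|i j y By|phi [sp pE]] := poincare1 (om := fun i y => om i (y + x0)) oB0 starB0.
- by move=> i; exact: sh.
- by rewrite !pdsh //; apply: closed; rewrite inB0.
exists (fun y => phi (y - x0)); split; first exact: sh'.
by move=> i y By; rewrite pdsh' // pE ?inB // subrK.
Qed.

Lemma poincare2_ball (b : 'I_n -> 'I_n -> V -> R^o) : (forall i j, smooth_on B (b i j)) ->
  (forall i j x, B x -> b i j x = - b j i x) ->
  (forall i j k x, B x -> pd k (b i j) x + pd i (b j k) x + pd j (b k i) x = 0) ->
  exists a : 'I_n -> V -> R^o, (forall i, smooth_on B (a i)) /\
    forall i j x, B x -> pd i (a j) x - pd j (a i) x = b i j x.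
Proof.
move=> sb anti closed.
have [||i j k y By|a [sa aE]] := poincare2 (B := fun i j y => b i j (y + x0)) oB0 starB0.
- by move=> i j; exact: sh.
- by move=> i j y By; apply: anti; rewrite inB0.
- by rewrite !pdsh //; apply: closed; rewrite inB0.
exists (fun i y => a i (y - x0)); split; first by move=> i; exact: sh'.
by move=> i j y By; rewrite !pdsh' // aE ?inB // subrK.
Qed.

End PoincareBall.

Lemma mx_congruence (R : realFieldType) n (N Q : 'M[R]_n) i j :
  (N *m Q *m N^T) i j = \sum_a \sum_b N i a * N j b * Q a b.
Proof.
rewrite mxE exchange_big; apply: eq_bigr => b _ /=; rewrite !mxE mulr_suml.
by apply: eq_bigr => a _; rewrite mulrAC.
Qed.

Lemma mx_congruence_inv (R : realFieldType) n (N Q r : 'M[R]_n) : N \in unitmx ->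
  N *m Q *m N^T = r -> Q = invmx N *m r *m (invmx N)^T.
Proof.
move=> uN <-; rewrite -!mulmxA -trmx_mul mulVmx // trmx1 mulmx1.
by rewrite mulmxA mulVmx // mul1mx.
Qed.

Lemma curl_arith (R : realFieldType) (x y p q : R) : x + p - (y + q) - (p - q) = x - y.
Proof. by ring. Qed.

Section Charts.
Variables (R : realType) (n : nat) (G : topGroupType) (A : atlas 'rV[R]_n G).
Local Notation V := 'rV[R]_n.
Variables (E : 'M[R]_n) (C : 'I_n -> 'I_n -> 'I_n -> R).
Hypotheses (hL : lie_group A) (uE : E \in unitmx) (hC : structure_constants A E C).
Let fV : findim V := @findim_rV R n.
Let pA := premanifoldG hL.
Let cc_at q : charts A (chart_at A q).
Proof. by have [[_ _ /(_ q)[]]] := hL. Qed.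
Let dd_at q : dom (chart_at A q) q.
Proof. by have [[_ _ /(_ q)[]]] := hL. Qed.
Let co U := @copen_open R n G A hL U.
Local Notation D := (frameD A E).
Local Notation vm := (vmat A (Ehat A E)).
Implicit Types (c : chart V G) (U : set G) (q : G).

(** Coordinate balls are where potentials are constructed: the Poincare lemmas hold on the ball, and
    the connectedness that class data demand is provided by radial paths. *)
Lemma ball_chart q : exists c (U : set G) x r,
  [/\ charts A c, [/\ open U, connected U, U q & U `<=` dom c] & img c U = ball x r].
Proof.
set c := chart_at A q; have cc : charts A c := cc_at q; have dq : dom c q := dd_at q.
set x := cmap c q; have oi := open_imgT hL cc.
have ix : img c setT x by exact: img_cmap.
have /nbhs_ballP[r /= r0 rP] : nbhs x (img c setT) by exact: open_nbhs_nbhs.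
pose U : set G := [set p | dom c p /\ ball x r (cmap c p)].
have iU : img c U = ball x r.
  apply/seteqP; split=> [_ [p [_ [_ bp]] <-] //|y By].
  have [dy _ e] := imgP pA cc (rP _ By).
  by exists (cinv c y) => //; split => //; split => //; rewrite e.
exists c, U, x, r; split => //; split => //; last first.
- by move=> p [].
- by split => //; exact: ballxx.
- pose P y (t : R) : G := cinv c (x + t *: (y - x)).
  have Pin y (t : R) : ball x r y -> 0 <= t <= 1 -> ball x r (x + t *: (y - x)).
    move=> By /andP[t0 t1].
    move: By; rewrite -!ball_normE /= opprD addrA subrr sub0r normrN normrZ (ger0_norm t0).
    by rewrite distrC; apply: le_lt_trans; rewrite ler_piMl.
  (* U is the union of the images of the segments from the centre; these are connected and all
     contain q. *)
  have -> : U = \bigcup_(y in ball x r) (P y @` `[0, 1]%classic).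
    apply/seteqP; split=> [p [dp bp]|p [y By [t /=]]].
      exists (cmap c p) => //; exists 1; first by rewrite /= in_itv /= ler01 lexx.
      by rewrite /P scale1r addrC subrK (cmapK pA cc dp).
    rewrite in_itv /= => t01 <-; have b1 := Pin y t By t01.
    by have [d1 _ e1] := imgP pA cc (rP _ b1); split => //; rewrite e1.
  apply: bigcup_connected.
    exists q => y By; exists 0; first by rewrite /= in_itv /= ler01 lexx.
    by rewrite /P scale0r addr0 (cmapK pA cc dq).
  move=> y By; apply: connected_continuous_connected; first exact: segment_connected.
  apply: continuous_in_subspaceT => t; rewrite inE /= in_itv /= => t01.
  apply: (@continuous_comp _ _ _ (fun t : R => x + t *: (y - x)) (cinv c)); last first.
    exact: (cinv_cont hL cc (rP _ (Pin y t By t01))).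
  apply: cvgD; first exact: cvg_cst.
  by apply: cvgZl; exact: cvg_id.
have -> : U = dom c `&` cmap c @^-1` (ball x r) by [].
apply: open_preim (open_dom hL cc) _ _; first exact: ball_open.
by have [[_ _ _ H _] _ _ _ _] := hL; have [_ _ _ h _] := H c cc; exact: h.
Qed.

Section Chart.
Variables (c : chart V G) (U : set G).
Hypotheses (cc : charts A c) (oU : open U) (Uc : U `<=` dom c).
Let oi : open (img c U) := co oU cc.
Let sc : smooth_fun A U (cmap c) := smooth_funS Uc (smooth_cmap pA cc).
Let inU q : U q -> img c U (cmap c q).
Proof. by move=> Uq; apply: img_cmap => //; exact: Uc. Qed.

Lemma smooth_pull (K : V -> R^o) : smooth_on (img c U) K -> smooth_fun A U (fun q => K (cmap c q) : R^o).
Proof. exact: (smooth_fun_comp pA fV (co oU) oi inU sc). Qed.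

Lemma vmat_cmap i b q : dom c q -> vm c (cmap c q) i b = tcomp A c q (Ehat A E i q) 0 b.
Proof. by move=> dq; rewrite mxE vcompE (cmapK pA cc dq). Qed.

Lemma D_pull i (K : V -> R^o) q : smooth_on (img c U) K -> U q ->
  D i (fun p => K (cmap c p)) q = \sum_a vm c (cmap c q) i a * pd a K (cmap c q).
Proof.
move=> sK Uq; rewrite frameDE (Dv_comp pA _ (co oU) sc Uq); last exact: (smooth_diff sK (inU Uq)).
rewrite dd_pd -tcomp_Dv; apply: eq_bigr => a _; rewrite vmat_cmap //; exact: Uc.
Qed.

Let X a : G -> R^o := fun q => cmap c q 0 a.
Let sX a : smooth_fun A U (X a).
Proof. exact: (smooth_pull (@smooth_coord R n (img c U) a)). Qed.

Let DX i a q : U q -> D i (X a) q = vm c (cmap c q) i a.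
Proof.
move=> Uq; rewrite (D_pull i (@smooth_coord R n (img c U) a) Uq) (bigD1 a) //=.
have pdc b : pd b (fun y : V => y 0 a : R^o) (cmap c q) = (a == b)%:R.
  by rewrite /pd dd_coord mxE eqxx.
rewrite pdc eqxx mulr1 big1 ?addr0 // => b ba.
by rewrite pdc eq_sym (negPf ba) mulr0.
Qed.

Variables (Om : 'I_n -> V -> R^o) (om : 'I_n -> G -> R^o).
Hypothesis sOm : forall a, smooth_on (img c U) (Om a).
Hypothesis omE : forall j q, U q -> om j q = \sum_b vm c (cmap c q) j b * Om b (cmap c q).

Let s1 j b : smooth_fun A U (fun q => D j (X b) q * Om b (cmap c q) : R^o).
Proof. exact: (smooth_funM (co oU) (smoothD_ E hL j oU (sX b)) (smooth_pull (sOm b))). Qed.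

Let som' j : smooth_fun A U (fun q => \sum_b D j (X b) q * Om b (cmap c q)).
Proof. exact: (smooth_fun_sum _ (co oU) (s1 j)). Qed.

Let omE' j q : U q -> om j q = \sum_b D j (X b) q * Om b (cmap c q).
Proof. by move=> Uq; rewrite omE //; apply: eq_bigr => b _; rewrite DX. Qed.

Lemma smooth_frame_form j : smooth_fun A U (om j).
Proof. by apply: (smooth_fun_eq pA (co oU) _ (som' j)) => q Uq; rewrite omE'. Qed.

(** The exterior derivative of a 1-form evaluated on the frame and in coordinates. The second
    derivatives D_i D_j of the chart coordinates enter antisymmetrised, so the structure constants
    absorb them. *)
Lemma frame_curl i j q : U q ->
  D i (om j) q - D j (om i) q - \sum_k C i j k * om k q =
  \sum_a \sum_b vm c (cmap c q) i a * vm c (cmap c q) j b *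
    (pd a (Om b) (cmap c q) - pd b (Om a) (cmap c q)).
Proof.
move=> Uq; set x := cmap c q; set N := vm c x.
have DE i' j' : D i' (om j') q = \sum_a \sum_b N i' a * N j' b * pd a (Om b) x
    + \sum_b Om b x * D i' (D j' (X b)) q.
  rewrite (D_eq E hL oU i' (fun p Up => esym (omE' j' Up)) (som' j') Uq) (D_sum E hL oU i' _ (s1 j') Uq).
  under eq_bigr => b _ do rewrite (D_mul E hL oU i' (smoothD_ E hL j' oU (sX b)) (smooth_pull (sOm b)) Uq)
    (D_pull i' (sOm b) Uq) (DX j' b Uq) -/x -/N.
  rewrite big_split; congr (_ + _); rewrite exchange_big; apply: eq_bigr => b _ /=.
  by rewrite mulr_sumr; apply: eq_bigr => a _; rewrite mulrCA mulrA.
have -> : \sum_k C i j k * om k q = \sum_b Om b x * D i (D j (X b)) q - \sum_b Om b x * D j (D i (X b)) q.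
  rewrite -sumrB; under [RHS]eq_bigr => b _ do
    rewrite -mulrBr (D_comm hL hC oU i j (sX b) Uq) mulr_sumr.
  rewrite exchange_big; apply: eq_bigr => k _ /=; rewrite omE' // mulr_sumr.
  by apply: eq_bigr => b _; rewrite mulrA; exact: mulrC.
have -> : \sum_a \sum_b N i a * N j b * (pd a (Om b) x - pd b (Om a) x) =
    \sum_a \sum_b N i a * N j b * pd a (Om b) x - \sum_a \sum_b N j a * N i b * pd a (Om b) x.
  rewrite [X in _ = _ - X]exchange_big -sumrB; apply: eq_bigr => a _; rewrite -sumrB.
  by apply: eq_bigr => b _; rewrite mulrBr [N j b * N i a]mulrC.
rewrite !DE; apply: (curl_arith (R := R)).
Qed.

Lemma chart_curl q : U q ->
  \matrix_(a, b) (pd a (Om b) (cmap c q) - pd b (Om a) (cmap c q)) =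
  Theta A E c (cmap c q) *m
    (\matrix_(i, j) (D i (om j) q - D j (om i) q - \sum_k C i j k * om k q)) *m
  (Theta A E c (cmap c q))^T.
Proof.
move=> Uq; apply: mx_congruence_inv.
  by apply: (vmat_Ehat_unit hL uE cc); apply: imgS (inU Uq).
apply/matrixP => i j; rewrite [RHS]mxE frame_curl // mx_congruence.
by apply: eq_bigr => a _; apply: eq_bigr => b _; congr (_ * _); exact: mxE.
Qed.

End Chart.

Lemma theta_pull c x (om : 'I_n -> R) j : charts A c -> img c setT x ->
  \sum_b vm c x j b * (\sum_k Theta A E c x b k * om k) = om j.
Proof.
move=> cc ix; have := congr1 (fun B : 'M[R]_n => B *m \col_k om k) (mulmxV (vmat_Ehat_unit hL uE cc ix)).
rewrite mul1mx -mulmxA => /(congr1 (fun B : 'cV[R]_n => B j 0)).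
rewrite !mxE => <-; apply: eq_bigr => b _; rewrite !mxE; congr (_ * _).
by apply: eq_bigr => k _; rewrite mxE.
Qed.

Section FramePoincare.
Variables (c : chart V G) (U : set G) (x0 : V) (r : R).
Hypotheses (cc : charts A c) (oU : open U) (Uc : U `<=` dom c) (iU : img c U = ball x0 r).
Let inU q : U q -> img c U (cmap c q).
Proof. by move=> Uq; apply: img_cmap => //; exact: Uc. Qed.
Let iT x : img c U x -> img c setT x. Proof. exact: imgS. Qed.

(** The hypothesis is closedness written in the frame. [Om] holds the coordinate components of the
    form, obtained with [Theta], and [chart_curl] transfers closedness to them. *)
Lemma frame_poincare1 (om : 'I_n -> G -> R^o) : (forall i, smooth_fun A U (om i)) ->
  (forall i j q, U q -> D i (om j) q - D j (om i) q - \sum_k C i j k * om k q = 0) ->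
  exists f : G -> R^o, smooth_fun A U f /\ forall i q, U q -> D i f q = om i q.
Proof.
move=> som closed; have oi := co oU cc.
pose Om a x : R^o := \sum_k Theta A E c x a k * om k (cinv c x).
have sOm a : smooth_on (img c U) (Om a).
  apply: (smooth_sum _ oi) => k _; apply: (smoothM oi); last exact: (som k c cc).
  by apply: smoothS (smooth_Theta hL uE a k cc); exact: imgS.
have omE j q : U q -> om j q = \sum_b vm c (cmap c q) j b * Om b (cmap c q).
  move=> Uq; rewrite /Om (cmapK pA cc (Uc Uq)).
  by rewrite (theta_pull _ _ cc (iT (inU Uq))).
have cl i j x : ball x0 r x -> pd i (Om j) x = pd j (Om i) x.
  rewrite -iU => ix; have [dx Ux e] := imgP pA cc ix.
  have := chart_curl cc oU Uc sOm omE Ux; rewrite e.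
  have -> : \matrix_(i, j) (D i (om j) (cinv c x) - D j (om i) (cinv c x) -
      \sum_k C i j k * om k (cinv c x)) = 0.
    by apply/matrixP => a b; rewrite !mxE closed.
  rewrite mulmx0 mul0mx => /matrixP/(_ i j); rewrite !mxE => /eqP.
  by rewrite subr_eq0 => /eqP.
have := poincare1_ball; rewrite /= => /(_ _ _ _ _ _ _ cl)[|phi [sp pE]].
  by move=> a; rewrite -iU.
rewrite -iU in sp; exists (fun q => phi (cmap c q)); split; first exact: (smooth_pull cc oU Uc sp).
move=> i q Uq; rewrite (D_pull cc oU Uc i sp Uq) omE //; apply: eq_bigr => a _.
by rewrite pE // -iU; exact: inU.
Qed.

(** B holds the coordinate components of the left-invariant 2-form with constant frame components b.
    The conclusion is da = b in the frame. *)
Lemma frame_poincare2 (b : 'M[R]_n) : b^T = - b ->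
  (let B i j x : R^o := (Theta A E c x *m b *m (Theta A E c x)^T) i j in
   forall i j k x, img c U x -> pd k (B i j) x + pd i (B j k) x + pd j (B k i) x = 0) ->
  exists a : 'I_n -> G -> R^o, (forall i, smooth_fun A U (a i)) /\
    forall i j q, U q -> D i (a j) q - D j (a i) q - \sum_k C i j k * a k q = b i j.
Proof.
move=> ab; set B := fun i j x => _ => closed; have oi := co oU cc.
have sB i j : smooth_on (img c U) (B i j).
  have st a k : smooth_on (img c U) (fun x => Theta A E c x a k : R^o).
    by apply: smoothS (smooth_Theta hL uE a k cc); exact: imgS.
  have : smooth_on (img c U) (fun x => \sum_k \sum_l Theta A E c x i k * Theta A E c x j l * b k l : R^o).
    apply: (smooth_sum _ oi) => k _; apply: (smooth_sum _ oi) => l _.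
    exact: (smoothM oi (smoothM oi (st i k) (st j l)) (@smooth_cst _ _ R^o _ (b k l))).
  by apply: (smooth_eq oi) => x _; rewrite /B mx_congruence.
have aB i j x : ball x0 r x -> B i j x = - B j i x.
  move=> _; rewrite /B; set T := Theta A E c x.
  have {1}-> : T *m b *m T^T = - (T *m b *m T^T)^T.
    by rewrite !trmx_mul trmxK ab mulNmx mulmxN mulmxA opprK.
  by rewrite [LHS]mxE [X in - X = _]mxE.
have := poincare2_ball _ aB; move=> [i j|i j k x|Om [sOm OmE]].
- by rewrite -iU.
- by rewrite -iU; exact: closed.
rewrite -iU in sOm OmE.
pose a j q : R^o := \sum_k vm c (cmap c q) j k * Om k (cmap c q).
have aE j q : U q -> a j q = \sum_k vm c (cmap c q) j k * Om k (cmap c q) by [].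
exists a; split; first exact: (smooth_frame_form cc oU Uc sOm aE).
move=> i j q Uq; rewrite (frame_curl cc oU Uc sOm aE _ _ Uq).
have e1 k l : pd k (Om l) (cmap c q) - pd l (Om k) (cmap c q) = B k l (cmap c q).
  exact: OmE (inU Uq).
under eq_bigr => k _ do under eq_bigr => l _ do rewrite e1.
have uN := vmat_Ehat_unit hL uE cc (iT (inU Uq)).
rewrite -mx_congruence.
by rewrite /Theta !mulmxA mulmxV // mul1mx -mulmxA -trmx_mul mulmxV // trmx1 mulmx1.
Qed.

End FramePoincare.

(** Column k of [Theta] holds the coordinate components of the k-th dual 1-form. Its frame
    components are Kronecker constants, so only the structure constants remain in [chart_curl]. *)
Lemma maurer_cartan c x a b k : charts A c -> img c setT x ->
  pd a (fun x => Theta A E c x b k : R^o) x - pd b (fun x => Theta A E c x a k : R^o) x =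
  - \sum_i \sum_j Theta A E c x a i * Theta A E c x b j * C i j k.
Proof.
move=> cc ix; have [dx _ e] := imgP pA cc ix.
have oU := open_dom hL cc.
have sOm l : smooth_on (img c (dom c)) (fun x => Theta A E c x l k : R^o).
  by apply: smoothS (smooth_Theta hL uE l k cc); exact: imgS.
pose om j : G -> R^o := fun=> (j == k)%:R.
have omE j q : dom c q -> om j q = \sum_l vm c (cmap c q) j l * Theta A E c (cmap c q) l k.
  move=> dq; have iq : img c setT (cmap c q) by exact: img_cmap.
  have := congr1 (fun B : 'M[R]_n => B j k) (mulmxV (vmat_Ehat_unit hL uE cc iq)).
  by rewrite /= !mxE => ->.
have := chart_curl cc oU (@subset_refl _ _) sOm omE dx; rewrite e => /matrixP/(_ a b).
rewrite mxE mx_congruence => ->; rewrite -sumrN; apply: eq_bigr => i _.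
rewrite -sumrN; apply: eq_bigr => j _; rewrite mxE !(D_cst) !sub0r oppr0 add0r mulrN.
congr (- (_ * _)); rewrite (bigD1 k) //= /om eqxx mulr1 big1 ?addr0 // => l lk.
by rewrite (negPf lk) mulr0.
Qed.

End Charts.

Lemma maurer_cartan_arith (R : realFieldType) (z b a c : R) : z * - (b * a * c) = a * (z * b * - c).
Proof. by ring. Qed.

Lemma ea_chart_arith (R : realFieldType) (p x y w q : R) : p * x + y * w - q * y = p * x + (w - q) * y.
Proof. by ring. Qed.

(** * Functions of the fibre coordinates in tangent charts *)

Section TangentCharts.
Variables (R : realType) (n : nat) (G : topGroupType) (A : atlas 'rV[R]_n G).
Local Notation V := 'rV[R]_n.
Variables (E : 'M[R]_n) (C : 'I_n -> 'I_n -> 'I_n -> R) (Gam : G * V -> V * V).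
Hypotheses (hL : lie_group A) (uE : E \in unitmx) (hC : structure_constants A E C).
Hypothesis hG : invariant_sode A Gam.
Let fV : findim V := @findim_rV R n.
Let fVV := findim_prod fV fV.
Let pA := premanifoldG hL.
Let pT := premanifold_tatlas fV pA.
Let co U := @copen_open R n G A hL U.
Let coT U (oU : open U) := copen_tau pA (co oU).
Local Notation TA := (tatlas A).
Local Notation Th := (Theta A E).
Implicit Types (c : chart V G) (U : set G) (z u : V * V) (K H : V -> R^o).

Definition Wc c z : V := z.2 *m Th c z.1.

Section Chart.
Variable c : chart V G.
Hypothesis cc : charts A c.
Local Notation W := (Wc c).
Local Notation fc := (force A Gam c).
Local Notation S := (sprayD fc).
Let O := [set z : V * V | img c setT z.1].
Let oO : open O := @open_fst R V V _ (open_imgT hL cc).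

Let sfst (h : V -> R^o) : smooth_on (img c setT) h -> smooth_on O (fun z : V * V => h z.1 : R^o).
Proof. exact: (smooth_comp fV (@findimR R) oO (open_imgT hL cc) (fun z h => h) (@smooth_fst R V V _)). Qed.

Lemma dd_base (h : V -> R^o) z u : smooth_on (img c setT) h -> O z ->
  dd (fun z : V * V => h z.1 : R^o) z u = dd h z.1 u.1.
Proof.
move=> sh Oz; have df : differentiable (fst : V * V -> V) z := smooth_diff (@smooth_fst R V V setT) I.
apply: (etrans (dd_comp u df (smooth_diff sh Oz))); congr (dd _ _ _).
by rewrite (@dd_lin _ _ _ fst) // => y; exact: cvg_fst.
Qed.

Let sTh a k : smooth_on (img c setT) (fun x => Th c x a k : R^o).
Proof. exact: smooth_Theta. Qed.

Lemma dd_fibre_affine (al : V -> R^o) (mu : 'I_n -> V -> R^o) z u :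
  smooth_on (img c setT) al -> (forall b, smooth_on (img c setT) (mu b)) -> O z ->
  dd (fun y : V * V => al y.1 + \sum_b y.2 0 b * mu b y.1 : R^o) z u =
  dd al z.1 u.1 + \sum_b (z.2 0 b * dd (mu b) z.1 u.1 + mu b z.1 * u.2 0 b).
Proof.
move=> sal smu Oz.
have sb b : smooth_on O (fun z : V * V => z.2 0 b : R^o).
  exact: ((smooth_rVP (fun z : V * V => z.2) oO).2 (@smooth_snd R V V O) b).
have sm b : smooth_on O (fun z : V * V => z.2 0 b * mu b z.1 : R^o).
  exact: (smoothM oO (sb b) (sfst (smu b))).
apply: (etrans (ddD _ (smooth_diff (sfst sal) Oz) (smooth_diff (smooth_sum _ oO (fun b _ => sm b)) Oz))).
apply: (congr2 (fun s t => s + t) (dd_base _ sal Oz)).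
apply: (etrans (ddsum _ _ (fun b => smooth_diff (sm b) Oz))); apply: eq_bigr => b _.
apply: (etrans (ddM _ (smooth_diff (sb b) Oz) (smooth_diff (sfst (smu b)) Oz))).
apply: (congr2 (fun s t => _ * s + _ * t) (dd_base _ (smu b) Oz)).
exact: dd_z2.
Qed.

Let sW : smooth_on O W.
Proof. exact: smooth_tW_chart. Qed.

Lemma dd_Wc z u k : O z ->
  dd (fun y => W y 0 k : R^o) z u = \sum_b (z.2 0 b * dd (fun x => Th c x b k : R^o) z.1 u.1 + Th c z.1 b k * u.2 0 b).
Proof.
move=> Oz; have s0 : smooth_on (img c setT) (fun _ : V => 0 : R^o) by exact: smooth_cst.
have := dd_fibre_affine u s0 (fun b => sTh b k) Oz; rewrite ddC add0r => <-.
by congr (dd _ _ _); apply/funext => y; rewrite add0r mxE.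
Qed.

Lemma smooth_KWc K : smooth_on setT K -> smooth_on O (fun y => K (W y) : R^o).
Proof. exact: (smooth_comp fV (@findimR R) oO openT (fun _ _ => I) sW). Qed.

Lemma dd_KWc K z u : smooth_on setT K -> O z ->
  dd (fun y => K (W y) : R^o) z u = \sum_k dd (fun y => W y 0 k : R^o) z u * pd k K (W z).
Proof.
move=> sK Oz; have dW := smooth_diff sW Oz.
apply: (etrans (dd_comp u dW (smooth_diff sK I))); rewrite dd_pd; apply: eq_bigr => k _.
by rewrite -(dd_rV (f := W)).
Qed.

Lemma dv_KWc K a z : smooth_on setT K -> O z ->
  dd (fun y => K (W y) : R^o) z (vdir R a) = \sum_k Th c z.1 a k * pd k K (W z).
Proof.
move=> sK Oz; rewrite dd_KWc //; apply: eq_bigr => k _; congr (_ * _).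
rewrite dd_Wc //; under eq_bigr => b _ do rewrite ddv0 mulr0 add0r mulrC.
by rewrite sum_basis.
Qed.

Lemma dq_KWc K a z : smooth_on setT K -> O z ->
  dd (fun y => K (W y) : R^o) z (qdir R a) =
  \sum_k (\sum_b z.2 0 b * pd a (fun x => Th c x b k : R^o) z.1) * pd k K (W z).
Proof.
move=> sK Oz; rewrite dd_KWc //; apply: eq_bigr => k _; congr (_ * _).
by rewrite dd_Wc //; apply: eq_bigr => b _; rewrite mxE mulr0 addr0.
Qed.

(** The coefficient of dq^a in the 1-form along the projection whose frame components are the
    functions h_k(w). *)
Definition comb a (h : 'I_n -> V -> R^o) z : R^o := \sum_k Th c z.1 a k * h k (W z).

Let scomb1 a h k : (forall k, smooth_on setT (h k)) -> smooth_on O (fun z => Th c z.1 a k * h k (W z) : R^o).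
Proof. by move=> sh; exact: (smoothM oO (sfst (sTh a k)) (smooth_KWc (sh k))). Qed.

Lemma smooth_comb a h : (forall k, smooth_on setT (h k)) -> smooth_on O (comb a h).
Proof. by move=> sh; apply: (smooth_sum _ oO) => k _; exact: scomb1. Qed.

Lemma dd_comb a h z u : (forall k, smooth_on setT (h k)) -> O z ->
  dd (comb a h) z u = \sum_k (Th c z.1 a k * dd (fun y => h k (W y) : R^o) z u +
                              h k (W z) * dd (fun x => Th c x a k : R^o) z.1 u.1).
Proof.
move=> sh Oz; apply: (etrans (ddsum _ _ (fun k => smooth_diff (scomb1 a k sh) Oz))).
apply: eq_bigr => k _.
apply: (etrans (ddM _ (smooth_diff (sfst (sTh a k)) Oz) (smooth_diff (smooth_KWc (sh k)) Oz))).
exact: (congr1 (fun t => _ + _ * t) (dd_base _ (sTh a k) Oz)).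
Qed.

Lemma dv_comb a b h z : (forall k, smooth_on setT (h k)) -> O z ->
  dd (comb a h) z (vdir R b) = \sum_k \sum_l Th c z.1 a k * Th c z.1 b l * pd l (h k) (W z).
Proof.
move=> sh Oz; rewrite dd_comb //; apply: eq_bigr => k _.
rewrite ddv0 mulr0 addr0 dv_KWc // mulr_sumr; apply: eq_bigr => l _; exact: mulrA.
Qed.

Lemma gg_chart K a b z : smooth_on setT K -> O z ->
  gg (fun y => K (W y)) a b z = \sum_k \sum_l Th c z.1 a k * Th c z.1 b l * pd l (pd k K) (W z).
Proof.
move=> sK Oz; have sp k : smooth_on setT (pd k K) := smooth_pd k sK.
rewrite -(dv_comb a b sp Oz); apply: (dd_eq _ oO) => [y Oy||]; last 2 first.
- exact: Oz.
- exact: (smooth_diff (smooth_comb a sp) Oz).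
by rewrite dv_KWc.
Qed.

Lemma smooth_force i : smooth_on O (fc i : V * V -> R^o).
Proof.
have [[sG _] _] := hG; have s1 := sG _ (tchart_charts cc).
rewrite (img_tchartE hL cc) in s1.
have s2 : smooth_on O (fun z => (vcomp TA Gam (tchart A c) z).2).
  exact: (smooth_comp fVV fV oO openT (fun _ _ => I) s1 (@smooth_snd R V V _)).
exact: ((smooth_rVP _ oO).2 s2 i).
Qed.

Lemma LG_chart U (F : G * V -> R^o) z : open U -> smooth_fun TA (tau_preim U) F ->
  img c U z.1 -> LG A Gam F (cinv (tchart A c) z) = S (F \o cinv (tchart A c)) z.
Proof.
move=> oU sF iz; have [d U1 e] := imgP pA cc iz.
set v := cinv (tchart A c) z.
have iz' : img (tchart A c) (tau_preim U) z by apply/(img_tchartP pA U z cc).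
have [dv Uv ev] := imgP pT (tchart_charts cc) iz'.
rewrite /LG (Dv_chart pT _ (coT oU) sF (tchart_charts cc) dv Uv) ev; congr (dd _ _ _).
rewrite -vcompE.
have [[_ hs] _] := hG; have iT : img (tchart A c) setT z by exact: imgS iz'.
apply: (etrans (surjective_pairing _)); apply: (congr2 (@pair V V) (hs c z cc iT)).
by apply/rowP => i; rewrite mxE.
Qed.

Lemma spray_W k z : O z -> S (fun y => W y 0 k : R^o) z = gam A E Gam k (W z).
Proof.
move=> Oz; have sk := smooth_tWj hL uE k openT.
have e y : O y -> tW A E (cinv (tchart A c) y) = W y by move=> Oy; exact: tW_chart.
have e0 := LG_chart openT sk Oz.
have e1 : S (fun y => W y 0 k : R^o) z = S ((fun v => tW A E v 0 k : R^o) \o cinv (tchart A c)) z.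
  apply: (dd_eq _ oO _ Oz) => [y Oy|]; first by rewrite /= -e.
  apply: (smooth_diff (sk _ (tchart_charts cc))); exact: ((img_tchartP pA setT z cc).2 Oz).
have e2 := gammaE hL uE hG k (cinv (tchart A c) z).
exact: (etrans e1 (etrans (esym e0) (etrans e2 (congr1 (gam A E Gam k) (e z Oz))))).
Qed.

(** The Euler-Lagrange expressions in the chart and in the frame are components of one tensor. This
    lets the Helmholtz identities, proved in coordinates, act on the functions [eps] of w. *)
Lemma ea_chart K a z : smooth_on setT K -> O z ->
  ea fc (fun y => K (W y)) a z = comb a (eps A E C Gam K) z.
Proof.
move=> sK Oz; have sp k : smooth_on setT (pd k K) := smooth_pd k sK.
have e1 : S (fun y => dd (fun y => K (W y) : R^o) y (vdir R a)) z = dd (comb a (fun k => pd k K)) z (z.2, \row_i fc i z).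
  by apply: (dd_eq _ oO _ Oz (smooth_diff (smooth_comb a sp) Oz)) => y Oy; rewrite dv_KWc.
apply: (etrans (congr2 (fun s t => s - t) (etrans e1 (dd_comb _ _ sp Oz)) (dq_KWc _ sK Oz))).
rewrite -sumrB.
have e2 k : dd (fun y => pd k K (W y) : R^o) z (z.2, \row_i fc i z) =
    \sum_j gam A E Gam j (W z) * pd j (pd k K) (W z).
  rewrite dd_KWc //; apply: eq_bigr => j _; congr (_ * _).
  exact: spray_W.
(* The derivative of [Theta] along the velocity and the position derivative of w combine into the
   curl of [Theta]; the Maurer-Cartan equation turns it into the structure constants of [eps]. *)
have e3 l : dd (fun x => Th c x a l : R^o) z.1 z.2 - \sum_b z.2 0 b * pd a (fun x => Th c x b l : R^o) z.1 =
    \sum_k Th c z.1 a k * \sum_m W z 0 m * C k m l.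
  rewrite dd_pd -sumrB.
  under eq_bigr => b _ do rewrite -mulrBr (maurer_cartan hL uE hC b a l cc Oz) -sumrN mulr_sumr.
  under [RHS]eq_bigr => k _ do rewrite mulr_sumr.
  rewrite exchange_big [RHS]exchange_big; apply: eq_bigr => m _ /=.
  under eq_bigr => b _ do rewrite -sumrN mulr_sumr.
  rewrite exchange_big; apply: eq_bigr => k _ /=.
  rewrite [W z 0 m]mxE mulr_suml mulr_sumr; apply: eq_bigr => b _.
  rewrite (C_anti hL uE hC k m l); exact: (@maurer_cartan_arith R).
rewrite /comb /eps; under [RHS]eq_bigr => k _ do rewrite mulrDr.
rewrite [RHS]big_split /=.
have e4 : \sum_k Th c z.1 a k * (\sum_m \sum_l W z 0 m * C k m l * pd l K (W z)) =
    \sum_l (dd (fun x => Th c x a l : R^o) z.1 z.2 - \sum_b z.2 0 b * pd a (fun x => Th c x b l : R^o) z.1) * pd l K (W z).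
  under [RHS]eq_bigr => l _ do rewrite e3 mulr_suml.
  rewrite [RHS]exchange_big; apply: eq_bigr => k _ /=.
  under [RHS]eq_bigr => l _ do rewrite -mulrA mulr_suml.
  by rewrite -mulr_sumr exchange_big.
rewrite e4 -big_split; apply: eq_bigr => k _ /=; rewrite -e2.
exact: (@ea_chart_arith R).
Qed.

End Chart.

End TangentCharts.

(** * The Helmholtz conditions *)

Section AntisymmetricJacobian.
Variables (R : realType) (n : nat).
Local Notation V := 'rV[R]_n.

Lemma pd0_cst (f : V -> R^o) : smooth_on setT f -> (forall i w, pd i f w = 0) ->
  forall w, f w = f 0.
Proof.
move=> sf f0 w; have [t _|t _] := @dd_MVT _ _ f 0 w; first exact: (smooth_diff sf I).
rewrite add0r dd_pd big1 => [/eqP|i _]; first by rewrite subr_eq0 => /eqP.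
by rewrite -[dd _ _ _]/(pd i f _) f0; exact: scaler0.
Qed.

Lemma affine_of_hess0 (f : V -> R^o) : smooth_on setT f ->
  (forall i j w, pd i (pd j f) w = 0) -> forall w, f w = f 0 + \sum_j w 0 j * pd j f 0.
Proof.
move=> sf H0 w; have [t _|t _] := @dd_MVT _ _ f 0 w; first exact: (smooth_diff sf I).
rewrite (add0r w) => e.
have aux (x y d : R) : x - y = d -> x = y + d by move=> <-; rewrite addrC subrK.
apply: (aux _ _ _ (etrans e _)).
apply: (etrans (dd_pd _ _ _)); apply: eq_bigr => j _; apply: (congr1 (fun t : R => w 0 j * t)).
apply: (@pd0_cst (pd j f)) => [|i w']; first exact: smooth_pd.
exact: H0.
Qed.

(** The second derivatives are antisymmetric in the component and the first derivative index ([sw])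
    and symmetric in the two derivative indices ([sy]). Alternating the two exchanges equates each
    of them with its negative, so every component is affine. *)
Lemma antisym_jacobian (e : 'I_n -> V -> R^o) : (forall i, smooth_on setT (e i)) ->
  (forall i j w, pd j (e i) w = - pd i (e j) w) ->
  exists (s : V) (b : 'M[R]_n), b^T = - b /\
    forall i w, e i w = s 0 i + \sum_j b i j * w 0 j.
Proof.
move=> se anti; have sp i j : smooth_on setT (pd j (e i)) := smooth_pd j (se i).
have sw i j k w : pd k (pd j (e i)) w = - pd k (pd i (e j)) w.
  have -> : pd j (e i) = fun w => - pd i (e j) w by apply/funext => w'; exact: anti.
  by rewrite /pd ddN //; exact: (smooth_diff (sp j i) I).
have sy i j k w : pd k (pd j (e i)) w = pd j (pd k (e i)) w := pd_sym k j openT (se i) I.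
have H0 i j k w : pd k (pd j (e i)) w = 0.
  have e1 : pd k (pd j (e i)) w = - pd k (pd j (e i)) w.
    by rewrite {1}sw sy {1}sw opprK sy sw sy.
  by apply/eqP; rewrite -[_ == _](mulrn_eq0 _ 2) mulr2n {1}e1 addNr.
exists (\row_i e i 0), (\matrix_(i, j) pd j (e i) 0); split.
  by apply/matrixP => i j; rewrite !mxE anti.
move=> i w; apply: (etrans (affine_of_hess0 (se i) (fun k j w => H0 i j k w) w)).
by rewrite mxE; congr (_ + _); apply: eq_bigr => j _; rewrite mxE mulrC.
Qed.

End AntisymmetricJacobian.

Section Multiplier.
Variables (R : realType) (n : nat) (G : topGroupType) (A : atlas 'rV[R]_n G).
Local Notation V := 'rV[R]_n.
Variables (E : 'M[R]_n) (C : 'I_n -> 'I_n -> 'I_n -> R) (Gam : G * V -> V * V).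
Hypotheses (hL : lie_group A) (uE : E \in unitmx) (hC : structure_constants A E C).
Hypothesis hG : invariant_sode A Gam.
Local Notation Th := (Theta A E).
Local Notation form := Defs.form.
Implicit Types (c : chart V G) (U : set G) (z u : V * V) (K H : V -> R^o).

Lemma sodeDE c (phi : V * V -> R^o) z :
  sodeD A Gam c phi z = sprayD (force A Gam c) phi z.
Proof.
rewrite sprayDE /sodeD; congr (_ + _); apply: eq_bigr => i _; congr (_ * _); exact: esym (ddE _ _ _).
Qed.

Lemma dvE i (phi : V * V -> R^o) z : dv i phi z = dd phi z (vdir R i).
Proof. by rewrite ddE. Qed.

Lemma PcoefE c k j z : Pcoef A Gam c k j z = jac (force A Gam c) k j z.
Proof.
by rewrite /Pcoef /jac sodeDE; congr (_ - _ - _).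
Qed.

Lemma form_frame (g : G * V -> 'M[R]_n) v (x y : V) :
  form g v (x *m eM A E v.1) (y *m eM A E v.1) =
  \sum_k \sum_l x 0 k * y 0 l * form g v (Ehat A E k v.1) (Ehat A E l v.1).
Proof.
have fE k l : form g v (Ehat A E k v.1) (Ehat A E l v.1) =
    (eM A E v.1 *m g v *m (eM A E v.1)^T) k l.
  rewrite /form -[Ehat A E k v.1](rowK (fun k => Ehat A E k v.1)) -/(eM A E v.1).
  rewrite -[Ehat A E l v.1](rowK (fun k => Ehat A E k v.1)) -/(eM A E v.1).
  rewrite -row_mul [LHS]mxE [RHS]mxE; apply: eq_bigr => a _.
  by congr (_ * _); rewrite !mxE.
under [RHS]eq_bigr => k _ do under eq_bigr => l _ do rewrite fE.
rewrite /form trmx_mul !mulmxA.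
set N := eM A E v.1 *m g v *m (eM A E v.1)^T.
have -> : x *m eM A E v.1 *m g v *m (eM A E v.1)^T *m y^T = x *m N *m y^T by rewrite /N !mulmxA.
rewrite mxE exchange_big; apply: eq_bigr => l _ /=.
rewrite [(x *m N) 0 l]mxE [y^T l 0]mxE mulr_suml.
by apply: eq_bigr => k _; rewrite mulrAC.
Qed.

Lemma coord_fieldE c i x : charts A c -> img c setT x ->
  coord_field A c i x = row i (Th c x) *m eM A E (cinv c x).
Proof.
move=> cc ix; have e := tWK hL uE (cinv (tchart A c) (x, basis_vec R i)).
have e1 := tW_chart hL uE (z := (x, basis_vec R i)) cc ix.
by apply: (etrans (esym e)); rewrite e1 rowE.
Qed.

Section Hessian.
Variables (g : G * V -> 'M[R]_n) (K : V -> R^o).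
Hypothesis sK : smooth_on setT K.
Hypothesis gK : forall i j v, form g v (Ehat A E i v.1) (Ehat A E j v.1) = pd i (pd j K) (tW A E v).

Section Chart.
Variable c : chart V G.
Hypothesis cc : charts A c.
Local Notation W := (Wc A E c).
Local Notation fc := (force A Gam c).
Local Notation S := (sprayD fc).
Local Notation Kh := (fun y => K (W y) : R^o).
Let O := [set z : V * V | img c setT z.1].
Let oO : open O := @open_fst R V V _ (open_imgT hL cc).
Let sKh : smooth_on O Kh := smooth_KWc hL uE cc sK.

Lemma gcoef_gg i j z : O z -> gcoef A g c i j z = gg Kh i j z.
Proof.
move=> Oz; rewrite /gcoef !coord_fieldE //.
have -> : cinv c z.1 = (cinv (tchart A c) z).1 by [].
rewrite form_frame (gg_chart hL uE cc _ _ sK Oz); apply: eq_bigr => k _; apply: eq_bigr => l _.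
rewrite !mxE gK (tW_chart hL uE cc Oz); congr (_ * _).
exact: (pd_sym k l openT sK I).
Qed.

Let sgg i j : smooth_on O (gg Kh i j).
Proof. apply: smooth_dd; exact: smooth_dd. Qed.

Lemma sodeD_gcoef i j z : O z -> sodeD A Gam c (gcoef A g c i j) z = S (gg Kh i j) z.
Proof.
move=> Oz; rewrite sodeDE; apply: (S_eq fc oO _ (sgg i j) Oz) => y Oy.
by rewrite gcoef_gg.
Qed.

Lemma dv_gcoef i j k z : O z -> dv k (gcoef A g c i j) z = dd (gg Kh i j) z (vdir R k).
Proof.
move=> Oz; rewrite dvE; apply: (dd_eq _ oO _ Oz (smooth_diff (sgg i j) Oz)) => y Oy.
by rewrite gcoef_gg.
Qed.

Lemma helm2E i j z : O z -> sodeD A Gam c (gcoef A g c i j) z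
  + 2^-1 * \sum_k dv j (fc k) z * gcoef A g c i k z
  + 2^-1 * \sum_k dv i (fc k) z * gcoef A g c k j z = helm2 fc Kh i j z.
Proof.
move=> Oz; rewrite sodeD_gcoef // /helm2; congr (_ + _ * _ + _ * _);
  by apply: eq_bigr => k _; rewrite dvE gcoef_gg.
Qed.

Lemma helm3E i j z : O z ->
  \sum_k gcoef A g c i k z * Pcoef A Gam c k j z = \sum_k gg Kh i k z * jac fc k j z.
Proof. by move=> Oz; apply: eq_bigr => k _; rewrite PcoefE gcoef_gg. Qed.

Lemma gcoef_matrix z : O z -> \matrix_(i, j) gcoef A g c i j z =
  Th c z.1 *m (\matrix_(k, l) pd k (pd l K) (W z)) *m (Th c z.1)^T.
Proof.
move=> Oz; apply/matrixP => i j; rewrite mx_congruence mxE gcoef_gg //.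
rewrite (gg_chart hL uE cc _ _ sK Oz); apply: eq_bigr => k _; apply: eq_bigr => l _.
by rewrite mxE (pd_sym k l openT sK I).
Qed.

End Chart.
End Hessian.
End Multiplier.

Lemma double_eq0 (R : realFieldType) (x : R) : 2 * x = 0 -> x = 0.
Proof. by move=> /eqP; rewrite mulf_eq0 pnatr_eq0 => /eqP. Qed.

Lemma comb_affine (R : realFieldType) n (T b : 'M[R]_n) (s v : 'rV[R]_n) a :
  \sum_k T a k * (s 0 k + \sum_j b k j * (v *m T) 0 j) =
  \sum_k T a k * s 0 k + \sum_d v 0 d * (T *m b *m T^T) a d.
Proof.
under eq_bigr => k _ do rewrite mulrDr.
rewrite big_split; congr (_ + _) => /=.
under [RHS]eq_bigr => d _ do rewrite mx_congruence mulr_sumr.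
rewrite exchange_big; apply: eq_bigr => k _ /=.
under [RHS]eq_bigr => d _ do rewrite mulr_sumr.
rewrite exchange_big mulr_sumr; apply: eq_bigr => l _ /=.
by rewrite mxE !mulr_sumr; apply: eq_bigr => d _; ring.
Qed.

Lemma helm_closed_arith1 (R : realFieldType) (p q x y z w t : R) : p = q ->
  2 * t = p - q + 2 * (x + y - (z + w)) -> t = x - z + (y - w).
Proof. by move=> ->; lra. Qed.

Lemma helm_closed_arith2 (R : realFieldType) (p q x y : R) : p = q -> p - q + (x - y) + y + - x = 0.
Proof. by move=> ->; ring. Qed.

Section Helmholtz.
Variables (R : realType) (n : nat) (G : topGroupType) (A : atlas 'rV[R]_n G).
Local Notation V := 'rV[R]_n.
Variables (E : 'M[R]_n) (C : 'I_n -> 'I_n -> 'I_n -> R) (Gam : G * V -> V * V).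
Hypotheses (hL : lie_group A) (uE : E \in unitmx) (hC : structure_constants A E C).
Hypothesis hG : invariant_sode A Gam.
Let fV : findim V := @findim_rV R n.
Local Notation Th := (Theta A E).
Local Notation form := Defs.form.
Local Notation ep := (eps A E C Gam).
Implicit Types (c : chart V G) (U : set G) (z u : V * V).

Definition hess (K : V -> R^o) (w : V) : 'M[R]_n := \matrix_(k, l) pd k (pd l K) w.

Lemma smooth_eps (K : V -> R^o) i : smooth_on setT K -> smooth_on setT (ep K i).
Proof.
move=> sK; have sp k : smooth_on setT (pd k K) := smooth_pd k sK.
apply: (smoothD openT); apply: (smooth_sum _ openT) => j _.
  exact: (smoothM openT (smooth_gam hL uE hG j) (smooth_pd j (sp i))).
apply: (smooth_sum _ openT) => k _; apply: (smoothM openT _ (sp k)).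
exact: (smoothM openT (@smooth_coord R n setT j) (@smooth_cst _ _ R^o _ (C i j k))).
Qed.

Variables (g : G * V -> 'M[R]_n) (K : V -> R^o).
Hypothesis sK : smooth_on setT K.
Hypothesis gK : forall i j v, form g v (Ehat A E i v.1) (Ehat A E j v.1) = pd i (pd j K) (tW A E v).

Section Chart.
Variable c : chart V G.
Hypothesis cc : charts A c.
Local Notation W := (Wc A E c).
Local Notation fc := (force A Gam c).
Local Notation S := (sprayD fc).
Local Notation Kh := (fun y => K (W y) : R^o).
Let O := [set z : V * V | img c setT z.1].
Let oO : open O := @open_fst R V V _ (open_imgT hL cc).
Let sKh : smooth_on O Kh := smooth_KWc hL uE cc sK.
Let sf i : smooth_on O (fc i : V * V -> R^o) := smooth_force hL hG cc i.
Let se i : smooth_on setT (ep K i) := smooth_eps i sK.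

Let dd_ea_chart a z u : O z -> dd (ea fc Kh a) z u = dd (comb A E c a (ep K)) z u.
Proof.
move=> Oz; apply: (dd_eq _ oO _ Oz (smooth_diff (smooth_comb hL uE cc a se) Oz)) => y Oy.
by rewrite (ea_chart hL uE hC hG cc a sK Oy).
Qed.

(** If [eps] vanishes, so do all Euler-Lagrange expressions of K(w) in the chart. Then [dv_ea_sym]
    is condition (2) and [spray_dv_ea] is condition (3); (1) comes from the congruence with the
    Hessian of K, and (4) from symmetry of third derivatives. *)
Lemma helm_suff_chart z : (forall i w, ep K i w = 0) -> (forall w, hess K w \in unitmx) -> O z ->
  let f := force A Gam c in let g_ := gcoef A g c in
  [/\ \det (\matrix_(i, j) g_ i j z) != 0 /\
        (forall i j, g_ i j z = g_ j i z),
      forall i j, sodeD A Gam c (g_ i j) z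
        + 2^-1 * \sum_k dv j (f k) z * g_ i k z
        + 2^-1 * \sum_k dv i (f k) z * g_ k j z = 0,
      forall i j, \sum_k g_ i k z * Pcoef A Gam c k j z =
                  \sum_k g_ j k z * Pcoef A Gam c k i z &
      forall i j k, dv k (g_ i j) z = dv j (g_ i k) z].
Proof.
move=> e0 uH Oz f g_.
have dea0 a y u : O y -> dd (ea fc Kh a) y u = 0.
  move=> Oy; rewrite dd_ea_chart // -[RHS](ddC (0 : R^o) y u); congr (dd _ _ _).
  by apply/funext => x; rewrite /comb big1 // => k _; rewrite e0 mulr0.
have H2 y i j : O y -> helm2 fc Kh i j y = 0.
  move=> Oy; apply: (@double_eq0 R); rewrite -(dv_ea_sym oO sf sKh i j Oy).
  by rewrite !dea0 // addr0.
split.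
- split; last by move=> i j; rewrite /g_ !(gcoef_gg hL uE sK gK cc _ _ Oz); exact: (ggC oO sKh).
  have := gcoef_matrix hL uE sK gK cc Oz; rewrite -/(hess K _) => ->.
  by rewrite -unitfE -unitmxE !unitmx_mul unitmx_tr uH (Theta_unit hL uE cc Oz).
- by move=> i j; rewrite (helm2E Gam hL uE sK gK cc i j Oz) H2.
- move=> i j; rewrite !(helm3E Gam hL uE sK gK cc _ _ Oz); apply/eqP; rewrite -subr_eq0; apply/eqP.
  have := spray_dv_ea oO sf sKh i j H2 Oz.
  have -> : S (fun y => dd (ea fc Kh i) y (vdir R j)) z = 0.
    rewrite -[RHS](ddC (0 : R^o) z (z.2, \row_i fc i z)); apply: (dd_eq _ oO _ Oz) => [y Oy|].
      by rewrite dea0.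
    exact: differentiable_cst.
  by rewrite !dea0 // subrr !mulr0 addr0.
- move=> i j k; rewrite !(dv_gcoef hL uE sK gK cc _ _ _ Oz).
  exact: (dd_sym _ _ oO (smooth_dd _ sKh) Oz).
Qed.

Hypothesis H : helmholtz A Gam g.

Let H2 z i j : O z -> helm2 fc Kh i j z = 0.
Proof.
move=> Oz; have iz : img (tchart A c) setT z by rewrite (img_tchartE hL cc).
by have [_ h _ _] := H cc iz; rewrite -(helm2E Gam hL uE sK gK cc i j Oz) h.
Qed.

(** In the chart, condition (2) makes the vertical Jacobian of [ea] skew. It is congruent by [Theta]
    to the Jacobian of [eps], and a congruence by an invertible matrix preserves skewness. *)
Lemma helm_antisym i j w : img c setT !=set0 -> pd j (ep K i) w = - pd i (ep K j) w.
Proof.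
move=> [x ix]; pose T := Th c x; have uT : T \in unitmx := Theta_unit hL uE cc ix.
(* The velocity over x whose fibre coordinates are w. *)
pose z : V * V := (x, w *m invmx T); have Oz : O z by [].
have Wz : W z = w by rewrite /Wc /z /= mulmxKV.
pose J := \matrix_(k, l) pd l (ep K k) w.
have JT a b : (T *m J *m T^T) a b = dd (ea fc Kh a) z (vdir R b).
  rewrite dd_ea_chart // (dv_comb hL uE cc a b se Oz) mx_congruence.
  by apply: eq_bigr => k _; apply: eq_bigr => l _; rewrite Wz mxE.
have anti : T *m J *m T^T = - (T *m J *m T^T)^T.
  apply/matrixP => a b; rewrite [RHS]mxE [X in - X]mxE !JT; apply/eqP; rewrite -addr_eq0.
  by rewrite (dv_ea_sym oO sf sKh a b Oz) H2 // mulr0.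
have : J = - J^T.
  rewrite [LHS](mx_congruence_inv uT (erefl _)) anti.
  rewrite !trmx_mul trmxK !mulmxN !mulNmx !mulmxA mulVmx // mul1mx.
  by rewrite -mulmxA -trmx_mul mulVmx // trmx1 mulmx1.
by move=> /matrixP/(_ i j); rewrite !mxE.
Qed.

Variables (s : V) (b : 'M[R]_n).
Hypothesis bT : b^T = - b.
Hypothesis epE : forall i w, ep K i w = s 0 i + \sum_j b i j * w 0 j.

(** With [B] below, the coordinate components of the left-invariant 1-form and 2-form whose frame
    components are s and b. *)
Let sa a x : R^o := \sum_i Th c x a i * s 0 i.
Let B i j x : R^o := (Th c x *m b *m (Th c x)^T) i j.

Let oi : open (img c setT) := open_imgT hL cc.
Let ssa a : smooth_on (img c setT) (sa a).
Proof.
apply: (smooth_sum _ oi) => i _.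
exact: (smoothM oi (smooth_Theta hL uE a i cc) (@smooth_cst _ _ R^o _ (s 0 i))).
Qed.
Let sB i j : smooth_on (img c setT) (B i j).
Proof.
have st a k := smooth_Theta hL uE a k cc.
have : smooth_on (img c setT) (fun x => \sum_k \sum_l Th c x i k * Th c x j l * b k l : R^o).
  apply: (smooth_sum _ oi) => k _; apply: (smooth_sum _ oi) => l _.
  exact: (smoothM oi (smoothM oi (st i k) (st j l)) (@smooth_cst _ _ R^o _ (b k l))).
by apply: (smooth_eq oi) => x _; rewrite /B mx_congruence.
Qed.

Let eaE a z : O z -> ea fc Kh a z = sa a z.1 + \sum_d z.2 0 d * B a d z.1.
Proof.
move=> Oz; apply: (etrans (ea_chart hL uE hC hG cc a sK Oz)).
apply: (etrans _ (comb_affine (Th c z.1) b s z.2 a)).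
by apply: eq_bigr => k _; rewrite epE.
Qed.

Let dd_eaE a z u : O z -> dd (ea fc Kh a) z u =
  dd (sa a) z.1 u.1 + \sum_d (z.2 0 d * dd (B a d) z.1 u.1 + B a d z.1 * u.2 0 d).
Proof.
move=> Oz; rewrite -(dd_fibre_affine hL cc u (ssa a) (sB a) Oz).
have sea := smooth_ea oO sf sKh a.
by apply: esym; apply: (dd_eq _ oO _ Oz (smooth_diff sea Oz)) => y Oy; rewrite eaE.
Qed.

Lemma helm_closed x : img c setT x ->
  (forall i j, pd i (sa j) x = pd j (sa i) x) /\
  (forall i j k, pd k (B i j) x + pd i (B j k) x + pd j (B k i) x = 0).
Proof.
move=> ix.
have key a b' (v : V) : \sum_d v 0 d * pd d (B a b') x =
    pd b' (sa a) x - pd a (sa b') x + \sum_d v 0 d * (pd b' (B a d) x - pd a (B b' d) x).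
  pose z : V * V := (x, v); have Oz : O z by [].
  have e0 := spray_dv_ea oO sf sKh a b' (fun y i j Oy => H2 i j Oy) Oz.
  have iz : img (tchart A c) setT z by rewrite (img_tchartE hL cc).
  have [_ _ h3 _] := H cc iz; move: (h3 a b').
  rewrite !(helm3E Gam hL uE sK gK cc _ _ Oz) => e1.
  have e2 : S (fun y => dd (ea fc Kh a) y (vdir R b')) z = \sum_d v 0 d * pd d (B a b') x.
    have bE y : O y -> B a b' y.1 = dd (ea fc Kh a) y (vdir R b').
      move=> Oy; rewrite dd_eaE // ddv0 add0r.
      under eq_bigr => d _ do rewrite ddv0 mulr0 add0r mulrC.
      by rewrite sum_basis.
    have db : differentiable (fun y : V * V => B a b' y.1 : R^o) z.
      apply: (smooth_diff _ Oz).
      exact: (smooth_comp fV (@findimR R) oO oi (fun z h => h) (@smooth_fst R V V _) (sB a b')).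
    apply: (etrans (dd_eq _ oO (fun y Oy => bE y Oy) Oz db)).
    exact: (etrans (dd_base _ (sB a b') Oz) (dd_pd _ _ _)).
  have e3 i j : dd (ea fc Kh i) z (qdir R j) = pd j (sa i) x + \sum_d v 0 d * pd j (B i d) x.
    rewrite dd_eaE //; congr (_ + _); apply: eq_bigr => d _.
    by rewrite mxE mulr0 addr0.
  rewrite e2 !e3 in e0.
  under [X in _ = _ + X]eq_bigr => d _ do rewrite mulrBr.
  rewrite sumrB; exact: (helm_closed_arith1 e1 e0).
have hs i j : pd i (sa j) x = pd j (sa i) x.
  have v0 (F : 'I_n -> R) : \sum_d (0 : V) 0 d * F d = 0.
    by apply: big1 => d _; rewrite mxE mul0r.
  have := key j i 0; rewrite !v0 addr0 => /eqP.
  by rewrite eq_sym subr_eq0 => /eqP.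
split=> // i j k.
have aB : pd j (B k i) x = - pd j (B i k) x.
  have Bn : B k i = fun y => - B i k y.
    apply/funext => y; rewrite /B.
    have {1}-> : Th c y *m b *m (Th c y)^T = - (Th c y *m b *m (Th c y)^T)^T.
      by rewrite !trmx_mul trmxK bT mulNmx mulmxN mulmxA opprK.
    by rewrite [LHS]mxE [X in - X = _]mxE.
  by rewrite Bn; exact: (ddN _ (smooth_diff (sB i k) ix)).
have := key i j (basis_vec R k); rewrite !sum_basis => ->.
by rewrite aB; exact: (helm_closed_arith2 _ _ (hs j i)).
Qed.

End Chart.
End Helmholtz.

(** * The fibre potential of an invariant multiplier and regularity *)

Section LinearChange.
Variables (R : realType) (n : nat) (f : 'rV[R]_n -> R^o) (E : 'M[R]_n).
Hypothesis sf : smooth_on setT f.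
Let lm : {linear 'rV[R]_n -> 'rV[R]_n} := mulmxr E.

Lemma smooth_mulmx : smooth_on setT (fun w => f (w *m E) : R^o).
Proof.
have [_ sl dl] := findim_linear lm setT (@findim_rV R n).
exact: (smooth_comp (@findim_rV R n) (@findimR R) openT openT (fun _ _ => I) sl sf).
Qed.

Lemma pd_mulmx i w : pd i (fun w => f (w *m E) : R^o) w = \sum_a E i a * pd a f (w *m E).
Proof.
have [_ sl dl] := findim_linear lm setT (@findim_rV R n).
apply: (etrans (dd_comp (basis_vec R i) (smooth_diff sl (I : setT w)) (smooth_diff sf I))).
rewrite dd_pd; apply: eq_bigr => a _; congr (_ *: _).
by rewrite dl /= -rowE mxE.
Qed.

End LinearChange.

Lemma mulr_swap3 (R : realFieldType) (a b c : R) : a * (b * c) = b * a * c.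
Proof. by ring. Qed.

Section Potential.
Variables (R : realType) (n : nat) (G : topGroupType) (A : atlas 'rV[R]_n G).
Local Notation V := 'rV[R]_n.
Variables (E : 'M[R]_n) (C : 'I_n -> 'I_n -> 'I_n -> R) (Gam : G * V -> V * V).
Hypotheses (hL : lie_group A) (uE : E \in unitmx) (hC : structure_constants A E C).
Hypothesis hG : invariant_sode A Gam.
Let fV : findim V := @findim_rV R n.
Let fVV := findim_prod fV fV.
Let pA := premanifoldG hL.
Let pT := premanifold_tatlas fV pA.
Let cc_at q : charts A (chart_at A q).
Proof. by have [[_ _ /(_ q)[]]] := hL. Qed.
Let dd_at q : dom (chart_at A q) q.
Proof. by have [[_ _ /(_ q)[]]] := hL. Qed.
Let co U := @copen_open R n G A hL U.
Let coT U (oU : open U) := copen_tau pA (co oU).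
Local Notation TA := (tatlas A).
Local Notation Th := (Theta A E).
Local Notation form := Defs.form.
Local Notation Eh := (Ehat A E).
Implicit Types (c : chart V G) (U : set G) (z u : V * V).

Lemma eM1 : eM A E 1%g = E.
Proof. by apply/row_matrixP => i; rewrite rowK Ehat1. Qed.

(** By invariance it suffices to work in the fibre over the identity, a vector space. Condition (4)
    makes each row of g a closed 1-form there; the symmetry of g makes the row potentials p closed
    in turn, and integrating once more gives K. *)
Lemma mult_potential g : invariant_multiplier A E Gam g ->
  exists K : V -> R^o, [/\ smooth_on setT K,
    forall i j v, form g v (Eh i v.1) (Eh j v.1) = pd i (pd j K) (tW A E v) &
    forall w, hess K w \in unitmx].
Proof.
move=> [sg ig Hg].
set c := chart_at A 1%g; set x0 := cmap c 1%g.
have cc : charts A c := cc_at 1%g; have d1 : dom c 1%g := dd_at 1%g.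
have ix : img c setT x0 by exact: img_cmap.
have iz v : img (tchart A c) setT (x0, v) by rewrite (img_tchartE hL cc).
pose h i j (v : V) : R^o := g (1%g, v) i j.
have formE v (x y : V) : form g v x y = \sum_a \sum_b x 0 a * y 0 b * g v a b.
  rewrite /Defs.form mxE exchange_big; apply: eq_bigr => b _ /=.
  rewrite [(x *m g v) 0 b]mxE [y^T b 0]mxE mulr_suml.
  by apply: eq_bigr => a _; rewrite mulrAC.
have cfE i : coord_field A c i x0 = basis_vec R i.
  by rewrite /coord_field cinv_tchart_at.
have gE i j v : gcoef A g c i j (x0, v) = h i j v.
  rewrite /gcoef cinv_tchart_at // !cfE formE.
  under eq_bigr => a _ do under eq_bigr => b _ do rewrite -mulrA.
  under eq_bigr => a _ do rewrite -mulr_sumr.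
  by rewrite sum_basis sum_basis.
have sxv : smooth_on setT (fun v : V => (x0, v)).
  apply: (smooth_pair openT); first exact: smooth_cst.
  by apply: (@smooth_lin R V V setT idfun) => y; exact: cvg_id.
have oO := open_img_tchart pA cc (co openT).
have sgc i j : smooth_on (img (tchart A c) setT) (gcoef A g c i j : V * V -> R^o) := sg c i j cc.
have sh i j : smooth_on setT (h i j).
  apply: (smooth_eq openT _ (smooth_comp fVV (@findimR R) openT oO (fun v _ => iz v) sxv (sgc i j))).
  by move=> v _; rewrite gE.
have pdh i j k v : pd k (h i j) v = dv k (gcoef A g c i j) (x0, v).
  rewrite dvE -(dd_partial2 _ (smooth_diff (sgc i j) (iz v))); congr (dd _ _ _).
  by apply/funext => y; rewrite gE.
have star : starshaped [set: V] by [].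
have hsym i j v : h i j v = h j i v.
  by have [[_ s] _ _ _] := Hg c _ cc (iz v); have := s i j; rewrite !gE.
have /choice[p pP] i : exists phi : V -> R^o, smooth_on setT phi /\ forall j w, setT w -> pd j phi w = h i j w.
  apply: (poincare1 openT star (sh i)) => j k w _.
  by have [_ _ _ s] := Hg c _ cc (iz w); rewrite !pdh s.
have [||Kx [sKx KxE]] := poincare1 (om := p) openT star.
- by move=> i; have [] := pP i.
- move=> i j w _; have [_ e1] := pP i; have [_ e2] := pP j.
  by rewrite e1 // e2 // hsym.
have sp i : smooth_on setT (p i) by have [] := pP i.
(* Passage from chart components of tangent vectors at the identity to the frame coordinates w, in
   which such a vector is w E. *)
pose K w : R^o := Kx (w *m E).
have pdK j w : pd j K w = \sum_a E j a * p a (w *m E).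
  by rewrite (pd_mulmx E sKx); apply: eq_bigr => a _; rewrite KxE.
have sK : smooth_on setT K := smooth_mulmx E sKx.
have spE a : smooth_on setT (fun w : V => p a (w *m E) : R^o).
  exact: (smooth_mulmx E (sp a)).
have gK i j v : form g v (Eh i v.1) (Eh j v.1) = pd i (pd j K) (tW A E v).
  rewrite (inv_fun_tW hL uE (ig i j)) /fib /=; set w := tW A E v.
  rewrite eM1 !Ehat1 // formE.
  have -> : pd j K = fun w => \sum_a E j a * p a (w *m E) by apply/funext => w'; exact: pdK.
  have se a : smooth_on setT (fun w : V => E j a * p a (w *m E) : R^o).
    exact: (smoothM openT (@smooth_cst _ _ R^o _ (E j a)) (spE a)).
  apply: esym; apply: (etrans (ddsum _ _ (fun a => smooth_diff (se a) I))).
  rewrite exchange_big; apply: eq_bigr => b _ /=.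
  apply: (etrans (ddZ _ _ (smooth_diff (spE b) I))).
  apply: (etrans (congr1 (fun t : R => _ * t) (pd_mulmx E (sp b) i w))); rewrite mulr_sumr; apply: eq_bigr => a _.
  have [_ ->] := pP b; rewrite // !mxE hsym /h mulrA; congr (_ * _); exact: mulrC.
exists K; split => // w.
have uT : Th c x0 \in unitmx := Theta_unit hL uE cc ix.
(* A velocity with fibre coordinates w. Condition (1) at this point passes to the Hessian of K
   through the congruence by [Theta]. *)
pose z : V * V := (x0, w *m invmx (Th c x0)).
have [[d0 _] _ _ _] := Hg c z cc (iz _).
have Oz : img c setT z.1 by [].
have := gcoef_matrix hL uE sK gK cc Oz.
have -> : Wc A E c z = w by rewrite /Wc /z /= mulmxKV.
move=> e; move: d0; rewrite e -unitfE -unitmxE !unitmx_mul => /andP[/andP[_ ]].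
by [].
Qed.

Lemma dv_chart c U (F : G * V -> R^o) j z : charts A c -> open U ->
  smooth_fun TA (tau_preim U) F -> img c U z.1 ->
  dd (F \o cinv (tchart A c)) z (vdir R j) =
  \sum_k Th c z.1 j k * LV A (Eh k) F (cinv (tchart A c) z).
Proof.
move=> cc oU sF iz; have [d U1 e] := imgP pA cc iz.
set v := cinv (tchart A c) z.
have iz' : img (tchart A c) (tau_preim U) z by apply/(img_tchartP pA U z cc).
have [dv Uv ev] := imgP pT (tchart_charts cc) iz'.
have LE k : LV A (Eh k) F v = dd (F \o cinv (tchart A c)) z (0, row k (vmat A Eh c z.1)).
  rewrite /LV (Dv_chart pT _ (coT oU) sF (tchart_charts cc) dv Uv) ev; congr (dd _ _ _).
  rewrite /vlift (tcomp_vlift hL _ cc) //; congr (_, _).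
  by rewrite rowK vcompE.
under eq_bigr => k _ do rewrite LE.
have ddZ' a u : a * dd (F \o cinv (tchart A c)) z u = dd (F \o cinv (tchart A c)) z (a *: u).
  by rewrite ddvZ.
under eq_bigr => k _ do rewrite ddZ'.
rewrite -ddv_sum; congr (dd _ _ _).
have sum_pair (r : seq 'I_n) (F2 : 'I_n -> V) (a : 'I_n -> R) :
    \sum_(i <- r) a i *: (0 : V, F2 i) = (0, \sum_(i <- r) a i *: F2 i).
  elim: r => [|i r IH]; rewrite ?big_nil // !big_cons IH.
  by apply: (congr2 (@pair V V)) => //=; rewrite scaler0 addr0.
rewrite sum_pair; apply: (congr2 (@pair V V)) => //.
have iT : img c setT z.1 by exact: imgS iz.
have := congr1 (row j) (mulVmx (vmat_Ehat_unit hL uE cc iT)).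
rewrite row_mul row1 => e1; apply: (etrans (esym e1)); rewrite mulmx_sum_row.
by apply: eq_bigr => k _; congr (_ *: _); rewrite mxE.
Qed.

Lemma dvdv_chart c U (F : G * V -> R^o) i j z : charts A c -> open U ->
  smooth_fun TA (tau_preim U) F -> img c U z.1 ->
  dv i (dv j (F \o cinv (tchart A c))) z =
  \sum_k \sum_l Th c z.1 i k * Th c z.1 j l * LV A (Eh k) (LV A (Eh l) F) (cinv (tchart A c) z).
Proof.
move=> cc oU sF iz; rewrite dvE.
have oO : open [set z : V * V | img c U z.1] := @open_fst R V V _ (co oU cc).
have sL l := smooth_LV E hL l oU sF.
have sLc l : smooth_on [set z : V * V | img c U z.1] (LV A (Eh l) F \o cinv (tchart A c)).
  have := sL l _ (tchart_charts cc).
  by have -> : img (tchart A c) (tau_preim U) = [set z : V * V | img c U z.1]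
    by apply/seteqP; split => y /(img_tchartP pA U y cc).
have sT l : smooth_on [set z : V * V | img c U z.1] (fun z => Th c z.1 j l : R^o).
  have st : smooth_on (img c U) (fun x => Th c x j l : R^o).
    by apply: smoothS (smooth_Theta hL uE j l cc); exact: imgS.
  exact: (smooth_comp fV (@findimR R) oO (co oU cc) (fun z h => h) (@smooth_fst R V V _) st).
have sm l := smoothM oO (sT l) (sLc l).
apply: (etrans (dd_eq (F := fun y : V * V => \sum_l Th c y.1 j l * LV A (Eh l) F (cinv (tchart A c) y) : R^o)
   _ oO _ iz _)).
- by move=> y iy; rewrite dvE (dv_chart j cc oU sF iy).
- exact: (smooth_diff (smooth_sum _ oO (fun l _ => sm l)) iz).
apply: (etrans (ddsum _ _ (fun l => smooth_diff (sm l) iz))).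
rewrite exchange_big; apply: eq_bigr => l _ /=.
apply: (etrans (ddM _ (smooth_diff (sT l) iz) (smooth_diff (sLc l) iz))).
rewrite (dv_chart i cc oU (sL l) iz).
have -> : dd (fun z : V * V => Th c z.1 j l : R^o) z (vdir R i) = 0.
  by rewrite (dd_base _ (smooth_Theta hL uE j l cc) (imgS (@subsetT _ U) iz)) ddv0.
rewrite mulr0 addr0 mulr_sumr; apply: eq_bigr => k _; exact: (@mulr_swap3 R).
Qed.

(** The velocity Hessian in a chart is congruent, by the invertible matrix [Theta], to the matrix of
    second vertical derivatives along the frame. *)
Lemma regularE U (F : G * V -> R^o) : open U -> smooth_fun TA (tau_preim U) F ->
  regular A U F <->
  forall v, U v.1 -> \matrix_(k, l) LV A (Eh k) (LV A (Eh l) F) v \in unitmx.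
Proof.
move=> oU sF.
have key c z : charts A c -> img c U z.1 ->
    \matrix_(i, j) dv i (dv j (F \o cinv (tchart A c))) z =
    Th c z.1 *m (\matrix_(k, l) LV A (Eh k) (LV A (Eh l) F) (cinv (tchart A c) z)) *m (Th c z.1)^T.
  move=> cc iz; apply/matrixP => i j; rewrite mx_congruence mxE (dvdv_chart _ _ cc oU sF iz).
  by apply: eq_bigr => k _; apply: eq_bigr => l _; rewrite mxE.
split=> H.
  move=> v Uv; pose c := chart_at A v.1; have cc : charts A c := cc_at _.
  have iz : img (tchart A c) (tau_preim U) (cmap (tchart A c) v).
    by apply: img_cmap => //; exact: dd_at.
  have iz' : img c U (cmap (tchart A c) v).1 by apply/(img_tchartP pA U _ cc).
  have := H c _ cc iz; rewrite key // !unitmx_mul (tchartK pA cc); last exact: dd_at.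
  by case/andP => /andP[].
move=> c z cc iz; have iz' : img c U z.1 by apply/(img_tchartP pA U _ cc).
have [d U1 e] := imgP pA cc iz'.
rewrite key // !unitmx_mul unitmx_tr (Theta_unit hL uE cc (imgS (@subsetT _ U) iz')) /= andbT.
exact: H.
Qed.

Lemma has_multiplierE U L g : has_multiplier A E U L g <->
  forall i j v, U v.1 -> form g v (Eh i v.1) (Eh j v.1) = LV A (Eh i) (LV A (Eh j) L) v.
Proof.
have e i j v : lieD TA (vlift (Eh i)) (lieD TA (vlift (Eh j)) L) v = LV A (Eh i) (LV A (Eh j) L) v.
  rewrite lieDE; have -> : lieD TA (vlift (Eh j)) L = LV A (Eh j) L by apply/funext => w; exact: lieDE.
  by [].
by split=> H i j v Uv; [rewrite -e|rewrite e]; exact: H.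
Qed.

End Potential.

(** * Closed left-invariant forms and their local potentials *)

Lemma cyclic_sum_arith (R : realFieldType) (kij kji ijk ikj jki jik x y z : R) :
  kij - kji - x = 0 -> ijk - ikj - y = 0 -> jki - jik - z = 0 ->
  ijk - jik - x + (jki - kji - y) + (kij - ikj - z) = 0.
Proof. by lra. Qed.

Lemma cyclic_antisym_arith (R : realFieldType) (x y z p q r u v w : R) :
  x * (- p + u) + y * (- q + v) + z * (- r + w) = - (q * y + r * z + p * x) + (x * u + y * v + z * w).
Proof. by ring. Qed.

Lemma cyclic_mul_arith (R : realFieldType) (x y z p q r a : R) :
  x * (- p * a) + y * (- q * a) + z * (- r * a) = - ((y * q + z * r + x * p) * a).
Proof. by ring. Qed.

(** The identity d(da) = 0 in a frame, with Q and P standing for first and second frame derivatives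
    of a. The cyclic sum of the P terms removes all second derivatives; replacing antisymmetrised Q
    by b leaves the cocycle expression and terms in a that cancel by the Jacobi identity. *)
Lemma closed_curl_algebra (R : realFieldType) n (C : 'I_n -> 'I_n -> 'I_n -> R) (b : 'M[R]_n)
    (P : 'I_n -> 'I_n -> 'I_n -> R) (Q : 'I_n -> 'I_n -> R) (a : 'I_n -> R) i j k :
  (forall i j k, C i j k = - C j i k) ->
  (forall i j k m, \sum_l (C j k l * C i l m + C k i l * C j l m + C i j l * C k l m) = 0) ->
  (forall i j, b i j = - b j i) ->
  (forall l i j, P l i j - P l j i - \sum_m C i j m * Q l m = 0) ->
  (forall x y z, P x y z - P y x z = \sum_l C x y l * Q l z) ->
  (forall l m, Q l m - Q m l = b l m + \sum_p C l m p * a p) ->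
  \sum_l (b i l * C j k l + b j l * C k i l + b k l * C i j l) = 0.
Proof.
move=> Canti jac abE e1 e2 e3.
have key : \sum_l (C i j l * (Q l k - Q k l) + C j k l * (Q l i - Q i l) + C k i l * (Q l j - Q j l)) = 0.
  rewrite !big_split /=.
  have e4 x y z : \sum_l C x y l * (Q l z - Q z l) = P x y z - P y x z - \sum_l C x y l * Q z l.
    by rewrite e2 -sumrB; apply: eq_bigr => l _; rewrite mulrBr.
  rewrite !e4; exact: (cyclic_sum_arith (e1 k i j) (e1 i j k) (e1 j k i)).
move: key; under eq_bigr => l _ do rewrite !e3.
have -> : \sum_l (C i j l * (b l k + \sum_p C l k p * a p) + C j k l * (b l i + \sum_p C l i p * a p) +
     C k i l * (b l j + \sum_p C l j p * a p)) =
   - \sum_l (b i l * C j k l + b j l * C k i l + b k l * C i j l) +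
   \sum_l \sum_p (C i j l * (C l k p * a p) + C j k l * (C l i p * a p) + C k i l * (C l j p * a p)).
  rewrite -sumrN -big_split; apply: eq_bigr => l _ /=.
  rewrite !big_split /= -!mulr_sumr (abE l k) (abE l i) (abE l j); exact: (@cyclic_antisym_arith R).
rewrite exchange_big [X in _ + X]big1 ?addr0 => [/eqP|p _]; first by rewrite oppr_eq0 => /eqP.
have jac0 := jac i j k p.
transitivity (- (\sum_l (C j k l * C i l p + C k i l * C j l p + C i j l * C k l p)) * a p).
  rewrite mulNr mulr_suml -sumrN; apply: eq_bigr => l _.
  rewrite (Canti l k) (Canti l i) (Canti l j); exact: (@cyclic_mul_arith R).
by rewrite jac0 oppr0 mul0r.
Qed.

Section LocalPotentials.
Variables (R : realType) (n : nat) (G : topGroupType) (A : atlas 'rV[R]_n G).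
Local Notation V := 'rV[R]_n.
Variables (E : 'M[R]_n) (C : 'I_n -> 'I_n -> 'I_n -> R).
Hypotheses (hL : lie_group A) (uE : E \in unitmx) (hC : structure_constants A E C).
Let pA := premanifoldG hL.
Let cc_at q : charts A (chart_at A q).
Proof. by have [[_ _ /(_ q)[]]] := hL. Qed.
Let dd_at q : dom (chart_at A q) q.
Proof. by have [[_ _ /(_ q)[]]] := hL. Qed.
Let co U := @copen_open R n G A hL U.
Local Notation D := (frameD A E).
Local Notation T := (frameT A E).
Local Notation Th := (Theta A E).
Implicit Types (c : chart V G) (U : set G) (q : G) (s : V) (b : 'M[R]_n).

Let Dcst i (a : R) q : D i (fun=> a : R^o) q = 0. Proof. exact: D_cst. Qed.

(** A 1-form with constant frame components s has exterior derivative -s_k C_ij^k in the frame, and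
    closedness in a single chart makes it vanish. *)
Lemma cocycle1_of_closed s :
  (forall c x i j, charts A c -> img c setT x ->
     pd i (fun x => \sum_k Th c x j k * s 0 k : R^o) x =
     pd j (fun x => \sum_k Th c x i k * s 0 k : R^o) x) ->
  cocycle1 C s.
Proof.
move=> closed i j; set c := chart_at A 1%g; have cc : charts A c := cc_at 1%g.
have d1 : dom c 1%g := dd_at 1%g; have oU := open_dom hL cc.
have oi := co oU cc; have iT x : img c (dom c) x -> img c setT x by exact: imgS.
pose Om a x : R^o := \sum_k Th c x a k * s 0 k.
have sOm a : smooth_on (img c (dom c)) (Om a).
  apply: (smooth_sum _ oi) => k _; apply: (smoothM oi _ (@smooth_cst _ _ R^o _ (s 0 k))).
  by apply: smoothS (smooth_Theta hL uE a k cc); exact: imgS.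
have omE l q : dom c q -> s 0 l = \sum_m vmat A (Ehat A E) c (cmap c q) l m * Om m (cmap c q).
  by move=> dq; rewrite (theta_pull hL uE _ _ cc) //; apply: iT; exact: img_cmap.
have := frame_curl hL hC cc oU (@subset_refl _ _) sOm (om := fun l _ => s 0 l) omE i j d1.
rewrite !Dcst subrr sub0r [X in _ = X]big1 => [/eqP|a _]; last first.
  by rewrite big1 // => m _; rewrite closed ?subrr ?mulr0 //; exact: img_cmap.
rewrite oppr_eq0 => /eqP e; apply: (etrans _ e); apply: eq_bigr => k _; exact: mulrC.
Qed.

(** The cocycle identity is read off from a local potential, as d(da) = 0, rather than from
    derivatives of the coordinate components of b. *)
Lemma cocycle2_of_curl U b (a : 'I_n -> G -> R^o) q : open U -> U q ->
  b^T = - b -> (forall i, smooth_fun A U (a i)) ->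
  (forall i j q, U q -> D i (a j) q - D j (a i) q - \sum_k C i j k * a k q = b i j) ->
  cocycle2 C b.
Proof.
move=> oU Uq ab sa curl; split=> // i j k.
have sD i' j' : smooth_fun A U (D i' (a j')) := smoothD_ E hL i' oU (sa j').
have sCa i' j' l : smooth_fun A U (fun q => C i' j' l * a l q : R^o).
  exact: (smooth_scale hL (C i' j' l) oU (sa l)).
have sC i' j' : smooth_fun A U (fun q => \sum_l C i' j' l * a l q : R^o).
  exact: (smooth_fun_sum _ (co oU) (sCa i' j')).
have sDD i' j' : smooth_fun A U (fun q => D i' (a j') q - D j' (a i') q : R^o).
  exact: (smooth_funB (co oU) (sD i' j') (sD j' i')).
pose P x y z := D x (D y (a z)) q.
pose Q x y := D x (a y) q.
have e1 l i' j' : P l i' j' - P l j' i' - \sum_m C i' j' m * Q l m = 0.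
  rewrite -[RHS](Dcst l (b i' j') q).
  have e : forall p, U p -> D i' (a j') p - D j' (a i') p - \sum_k C i' j' k * a k p = b i' j'.
    by move=> p; exact: curl.
  rewrite (D_eq E hL oU l (fun p Up => curl i' j' p Up) (smooth_funB (co oU) (sDD i' j') (sC i' j')) Uq).
  rewrite (D_sub E hL oU l (sDD i' j') (sC i' j') Uq) (D_sub E hL oU l (sD i' j') (sD j' i') Uq).
  rewrite (D_sum E hL oU l _ (sCa i' j') Uq); congr (_ - _); apply: eq_bigr => m _.
  by rewrite (D_scale E hL oU l (C i' j' m) (sa m) Uq).
have e2 x y z : P x y z - P y x z = \sum_l C x y l * Q l z := D_comm hL hC oU x y (sa z) Uq.
have e3 l m : Q l m - Q m l = b l m + \sum_p C l m p * a p q.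
  by rewrite -(curl l m q Uq) subrK.
have abE x y : b x y = - b y x.
  by have := congr1 (fun B : 'M[R]_n => B y x) ab; rewrite !mxE.
apply: (@closed_curl_algebra R n C b P Q (fun p => a p q)) => //.
- exact: (C_anti hL uE hC).
- exact: (jacobi hL uE hC).
Qed.

(** All potentials are taken on one coordinate ball around p: phi and a for the closed forms s and
    b, and the f_i from a. *)
Lemma local_potentials s b p : b^T = - b ->
  (forall c x, charts A c -> img c setT x ->
    let sa a x : R^o := \sum_i Th c x a i * s 0 i in
    let B i j x : R^o := (Th c x *m b *m (Th c x)^T) i j in
    (forall i j, pd i (sa j) x = pd j (sa i) x) /\
    (forall i j k, pd k (B i j) x + pd i (B j k) x + pd j (B k i) x = 0)) ->
  exists U (a f : 'I_n -> G -> R^o) (phi : G -> R^o),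
    [/\ [/\ open U, connected U & U p],
        [/\ forall i, smooth_fun A U (a i), forall i, smooth_fun A U (f i) & smooth_fun A U phi],
        forall i j q, U q -> D i (a j) q - D j (a i) q - \sum_k C i j k * a k q = b i j,
        forall i q, U q -> D i phi q = s 0 i &
        forall i j q, U q -> D j (f i) q = T i (a j) q].
Proof.
move=> ab closed.
have c1 : cocycle1 C s.
  apply: cocycle1_of_closed => c x i j cc ix; have [h _] := closed c x cc ix; exact: h.
have [c [U [x [r [cc [oU cU Up Uc] iU]]]]] := ball_chart hL p.
have [phi [sphi phiE]] : exists phi : G -> R^o, smooth_fun A U phi /\ forall i q, U q -> D i phi q = s 0 i.
  apply: (frame_poincare1 hL uE hC cc oU Uc iU (om := fun i _ => s 0 i)) => [i|i j q Uq].
    exact: smooth_fun_cst.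
  rewrite !Dcst subrr sub0r -[RHS]oppr0; congr (- _); rewrite -[RHS](c1 i j).
  by apply: eq_bigr => k _; exact: mulrC.
have [a [sa curl]] : exists a : 'I_n -> G -> R^o, (forall i, smooth_fun A U (a i)) /\
    forall i j q, U q -> D i (a j) q - D j (a i) q - \sum_k C i j k * a k q = b i j.
  apply: (frame_poincare2 hL uE hC cc oU Uc iU ab) => B i j k y iy.
  by have [_ h] := closed c y cc (imgS (@subsetT _ U) iy); exact: h.
have sT i j : smooth_fun A U (T i (a j)) := smoothT_ E hL i oU (sa j).
(* T_i commutes with the left frame, so the curl of T_i a is T_i of the curl of a, which is T_i of a
   constant. Hence the form with components T_i a_j is closed and f_i is a potential of it. *)
have /choice[f fP] i : exists f : G -> R^o, smooth_fun A U f /\ forall j q, U q -> D j f q = T i (a j) q.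
  apply: (frame_poincare1 hL uE hC cc oU Uc iU (sT i)) => j k q Uq.
  have sD i' j' : smooth_fun A U (D i' (a j')) := smoothD_ E hL i' oU (sa j').
  have sCa l : smooth_fun A U (fun q => C j k l * a l q : R^o).
    exact: (smooth_scale hL (C j k l) oU (sa l)).
  have sC : smooth_fun A U (fun q => \sum_l C j k l * a l q : R^o).
    exact: (smooth_fun_sum _ (co oU) sCa).
  have sDD : smooth_fun A U (fun q => D j (a k) q - D k (a j) q : R^o).
    exact: (smooth_funB (co oU) (sD j k) (sD k j)).
  have T0 : T i (fun=> b j k : R^o) q = 0 by rewrite frameTE DvC.
  rewrite -(TD_comm E hL oU i j (sa k) Uq) -(TD_comm E hL oU i k (sa j) Uq) -[RHS]T0.
  rewrite (T_eq E hL oU i (fun p Up => curl j k p Up) (smooth_funB (co oU) sDD sC) Uq) !frameTE.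
  rewrite (DvB pA _ (co oU) sDD sC Uq) (DvB pA _ (co oU) (sD j k) (sD k j) Uq); congr (_ - _).
  rewrite (Dv_sum pA _ _ (co oU) sCa Uq); apply: eq_bigr => l _.
  by rewrite (DvZ pA _ _ (co oU) (sa l) Uq) frameTE.
have sf i : smooth_fun A U (f i) by have [] := fP i.
have fE i j q : U q -> D j (f i) q = T i (a j) q by have [_ h] := fP i; exact: h.
by exists U, a, f, phi; split; [split|split| | |].
Qed.

End LocalPotentials.

Lemma affine_inj (R : realType) n (s c : R) (b d : 'I_n -> R) :
  (forall w : 'rV[R]_n, s + \sum_j b j * w 0 j = c + \sum_j w 0 j * d j) ->
  s = c /\ forall j, b j = d j.
Proof.
move=> H; have sc : s = c.
  have := H 0; rewrite !big1 ?addr0 // => j _; first by rewrite mxE mul0r.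
  by rewrite mxE mulr0.
split=> // k; have := H (basis_vec R k); rewrite sum_basis.
under eq_bigr => j _ do rewrite mulrC.
by rewrite sum_basis sc => /addrI.
Qed.

Lemma affine_arith (R : realFieldType) (l k p x : R) : l - k = p + x -> l = k + x + p.
Proof. by lra. Qed.

Section Cocycles.
Variables (R : realType) (n : nat) (C : 'I_n -> 'I_n -> 'I_n -> R).

Lemma cocycle2B (x y : 'M[R]_n) : cocycle2 C x -> cocycle2 C y -> cocycle2 C (x - y).
Proof.
move=> [ax cx] [ay cy]; split=> [|i j k].
  by rewrite linearB /= ax ay opprB addrC opprK.
transitivity (\sum_l (x i l * C j k l + x j l * C k i l + x k l * C i j l) -
              \sum_l (y i l * C j k l + y j l * C k i l + y k l * C i j l)).
  by rewrite -sumrB; apply: eq_bigr => l _; rewrite !mxE; ring.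
by rewrite cx cy subrr.
Qed.

Hypothesis Canti : forall i j k, C i j k = - C j i k.
Hypothesis jac : forall i j k m,
  \sum_l (C j k l * C i l m + C k i l * C j l m + C i j l * C k l m) = 0.

Lemma coboundary_cocycle (t : 'rV[R]_n) :
  cocycle2 C (\matrix_(i, j) (\sum_k t 0 k * C i j k)).
Proof.
split=> [|i j k].
  apply/matrixP => i j; rewrite !mxE -sumrN; apply: eq_bigr => k _.
  by rewrite Canti mulrN.
under eq_bigr => l _ do rewrite !mxE !mulr_suml -!big_split /=.
rewrite exchange_big big1 // => m _ /=.
transitivity (t 0 m * \sum_l (C j k l * C i l m + C k i l * C j l m + C i j l * C k l m)).
  by rewrite mulr_sumr; apply: eq_bigr => l _; ring.
by rewrite jac mulr0.
Qed.

End Cocycles.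

(** * Lagrangians with a given multiplier and their classes *)

Section ClassData.
Variables (R : realType) (n : nat) (G : topGroupType) (A : atlas 'rV[R]_n G).
Local Notation V := 'rV[R]_n.
Variables (E : 'M[R]_n) (C : 'I_n -> 'I_n -> 'I_n -> R) (Gam : G * V -> V * V).
Hypotheses (hL : lie_group A) (uE : E \in unitmx) (hC : structure_constants A E C).
Hypothesis hG : invariant_sode A Gam.
Let fV : findim V := @findim_rV R n.
Let pA := premanifoldG hL.
Let pT := premanifold_tatlas fV pA.
Let co U := @copen_open R n G A hL U.
Let coT U (oU : open U) := copen_tau pA (co oU).
Local Notation TA := (tatlas A).
Local Notation D := (frameD A E).
Local Notation T := (frameT A E).
Local Notation Eh := (Ehat A E).
Local Notation tw := (tW A E).
Local Notation form := Defs.form.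
Implicit Types (c : chart V G) (U : set G) (q : G) (v : G * V) (F : G * V -> R^o).

Lemma EL_eq U X F F' v : open U -> (forall v, U v.1 -> F v = F' v) ->
  smooth_fun TA (tau_preim U) F' -> smooth_fun TA (tau_preim U) (LV A X F') -> U v.1 ->
  EL A Gam X F v = EL A Gam X F' v.
Proof.
move=> oU e sF sL Uv.
have e' w : U w.1 -> F' w = F w by move=> Uw; rewrite e.
have eL w : U w.1 -> LV A X F' w = LV A X F w.
  by move=> Uw; exact: (esym (Dv_eq pT _ (coT oU) Uw e' sF)).
exact: (congr2 (fun s t : R => s - t) (Dv_eq pT _ (coT oU) Uv eL sL) (Dv_eq pT _ (coT oU) Uv e' sF)).
Qed.

Lemma LV_KW (K : V -> R^o) i v : smooth_on setT K ->
  LV A (Eh i) (fun v => K (tw v) : R^o) v = pd i K (tw v).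
Proof.
move=> sK; rewrite /LV (Dv_KW hL uE _ _ sK) (bigD1 i) //= (Dv_vlift_tW hL uE) eqxx mul1r.
by rewrite big1 ?addr0 // => j ji; rewrite (Dv_vlift_tW hL uE) eq_sym (negPf ji) mul0r.
Qed.

Variables (K : V -> R^o) (s : V) (b : 'M[R]_n).
Hypothesis sK : smooth_on setT K.
Hypothesis uK : forall w, hess K w \in unitmx.
Hypothesis epE : forall i w, eps A E C Gam K i w = s 0 i + \sum_j b i j * w 0 j.

Section LForm.
Variables (U : set G) (a : 'I_n -> G -> R^o) (phi : G -> R^o).
Hypotheses (oU : open U) (sa : forall i, smooth_fun A U (a i)) (sphi : smooth_fun A U phi).
Local Notation L := (lform A E K a phi).

Lemma LVLV_lform i j v : U v.1 -> LV A (Eh i) (LV A (Eh j) L) v = pd i (pd j K) (tw v).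
Proof.
move=> Uv; have sp := smooth_pd j sK.
have sKj := smooth_KW hL uE oU sp.
have saT := smooth_fun_tau fV pA (@findimR R) (co oU) (sa j).
rewrite {1}/LV (Dv_eq pT _ (coT oU) Uv (f := fun v => pd j K (tw v) + a j v.1)); last first.
- exact: (smooth_funD (coT oU) sKj saT).
- by move=> w Uw; rewrite (LV_lform hL uE oU sK sa sphi j Uw).
rewrite (DvD pT _ (coT oU) sKj saT Uv) (Dv_tau pA _ (co oU) (sa j) Uv) Dv0 addr0.
exact: (LV_KW i v sp).
Qed.

Lemma lform_lagrangian :
  (forall i j q, U q -> D i (a j) q - D j (a i) q - \sum_k C i j k * a k q = b i j) ->
  (forall i q, U q -> D i phi q = s 0 i) -> lagrangian A Gam U L.
Proof.
move=> curl Dphi; have sL := smooth_lform hL uE oU sK sa sphi.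
apply/lagrangianE; split=> // [|X sX v Uv].
  apply/(regularE hL uE oU sL) => v Uv.
  have -> : \matrix_(k, l) LV A (Eh k) (LV A (Eh l) L) v = hess K (tw v).
    by apply/matrixP => k l; rewrite !mxE (LVLV_lform k l Uv).
  exact: uK.
rewrite (EL_decomp hL uE hG oU sL sX Uv) big1 // => i _.
rewrite (EL_lform hL uE hC hG oU sK sa sphi i Uv) epE Dphi //.
under [X in _ - (X + _)]eq_bigr => k _ do rewrite curl // mulrC.
by rewrite [X in _ - X]addrC subrr mulr0.
Qed.

End LForm.

Variable g : G * V -> 'M[R]_n.
Hypothesis gK : forall i j v, form g v (Eh i v.1) (Eh j v.1) = pd i (pd j K) (tw v).

(** L and K(w) have the same vertical Hessian, so their difference N is affine on each fibre. The
    Euler-Lagrange equations then are affine in w, and comparing coefficients gives da = b and d phi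
    = s. *)
Lemma lagrangian_lform U L : open U -> lagrangian A Gam U L -> has_multiplier A E U L g ->
  exists (a : 'I_n -> G -> R^o) (phi : G -> R^o),
    [/\ (forall i, smooth_fun A U (a i)) /\ smooth_fun A U phi,
        forall v, U v.1 -> L v = lform A E K a phi v,
        forall i j q, U q -> D i (a j) q - D j (a i) q - \sum_k C i j k * a k q = b i j &
        forall i q, U q -> D i phi q = s 0 i].
Proof.
move=> oU /lagrangianE[sL _ EL0] /has_multiplierE hm.
pose N : G * V -> R^o := fun v => L v - K (tw v).
have sKW := smooth_KW hL uE oU sK.
have sN : smooth_fun TA (tau_preim U) N := smooth_funB (coT oU) sL sKW.
(* The coefficients of an affine function on a fibre are its vertical derivatives and its value at
   the zero vector; reading them on the zero section makes them smooth functions on U. *)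
pose a j : G -> R^o := fun q => LV A (Eh j) N (q, 0).
pose phi : G -> R^o := fun q => N (q, 0).
have sLN j := smooth_LV E hL j oU sN.
have sa j : smooth_fun A U (a j) := smooth_zero_section hL oU (sLN j).
have sphi : smooth_fun A U phi := smooth_zero_section hL oU sN.
have LVN j v : U v.1 -> LV A (Eh j) N v = LV A (Eh j) L v - pd j K (tw v).
  by move=> Uv; rewrite {1}/LV (DvB pT _ (coT oU) sL sKW Uv); congr (_ - _); exact: LV_KW.
have sLL j := smooth_LV E hL j oU sL.
have LVLVN i j v : U v.1 -> LV A (Eh i) (LV A (Eh j) N) v = 0.
  move=> Uv; have sKj := smooth_KW hL uE oU (smooth_pd j sK).
  rewrite {1}/LV (Dv_eq pT _ (coT oU) Uv (f := fun v => LV A (Eh j) L v - pd j K (tw v))); last first.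
  - exact: (smooth_funB (coT oU) (sLL j) sKj).
  - by move=> w Uw; rewrite LVN.
  rewrite (DvB pT _ (coT oU) (sLL j) sKj Uv); apply/eqP; rewrite subr_eq0; apply/eqP.
  apply: (etrans (esym (hm i j v Uv))); rewrite gK; apply: esym; exact: LV_KW _ _ (smooth_pd j sK).
have LE v : U v.1 -> L v = lform A E K a phi v.
  move=> Uv; have vE : (v.1, tw v *m eM A E v.1) = v.
    by rewrite (tWK hL uE); case: (v).
  move: vE; set q := v.1; set w := tw v => vE.
  have sfN := smooth_fib E hL oU sN Uv.
  have pdN j w' : pd j (fib A E N q) w' = fib A E (LV A (Eh j) N) q w' := pd_fib E hL sN Uv j w'.
  have H0 i j w' : pd i (pd j (fib A E N q)) w' = 0.
    have -> : pd j (fib A E N q) = fib A E (LV A (Eh j) N) q by apply/funext => y; exact: pdN.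
    by apply: (etrans (pd_fib E hL (sLN j) Uv i w')); apply: LVLVN.
  have := affine_of_hess0 sfN H0 w; rewrite {1}/fib vE /N -/w => e.
  rewrite /lform -/w -/q; have fib0 F : fib A E F q 0 = F (q, 0) by rewrite /fib mul0mx.
  under eq_bigr => j _ do rewrite mulrC.
  have e2 : \sum_j w 0 j * pd j (fib A E N q) 0 = \sum_j w 0 j * a j q.
    by apply: eq_bigr => j _; congr (_ * _); apply: (etrans (pdN j 0)); exact: fib0.
  exact: (@affine_arith R _ _ _ _ (etrans e (congr2 (fun s t : R => s + t) (fib0 N) e2))).
exists a, phi.
have slf := smooth_lform hL uE oU sK sa sphi.
have EL1 i v : U v.1 -> s 0 i + \sum_j b i j * tw v 0 j =
    D i phi v.1 + \sum_k tw v 0 k * (D i (a k) v.1 - D k (a i) v.1 - \sum_l C i k l * a l v.1).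
  move=> Uv; have sE : smooth_field A U (Eh i) by apply: smooth_fieldS; exact: (smooth_Ehat hL).
  have := EL0 _ sE v Uv; rewrite (EL_eq oU LE slf _ Uv); last exact: (smooth_LV E hL i oU slf).
  rewrite (EL_lform hL uE hC hG oU sK sa sphi i Uv) epE => /eqP.
  by rewrite subr_eq0 [X in _ == X]addrC => /eqP.
have aff i q : U q -> s 0 i = D i phi q /\
   forall k, b i k = D i (a k) q - D k (a i) q - \sum_l C i k l * a l q.
  move=> Uq; apply: affine_inj => w; have := EL1 i (q, w *m eM A E q) Uq.
  by rewrite (tW_mk hL uE).
split=> // [i j q Uq|i q Uq].
- by have [_ ->] := aff i q Uq.
- by have [->] := aff i q Uq.
Qed.

Lemma lform_multiplier U a phi : open U -> (forall i, smooth_fun A U (a i)) -> smooth_fun A U phi ->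
  has_multiplier A E U (lform A E K a phi) g.
Proof. by move=> oU sa sphi; apply/has_multiplierE => i j v Uv; rewrite gK (LVLV_lform oU sa sphi i j Uv). Qed.

Hypothesis cG : connected [set: G].
Hypotheses (c1 : cocycle1 C s) (c2 : cocycle2 C b).

(** T_i phi is M applied to s, and M fixes 1-cocycles. *)
Lemma T_potential U phi i q : (forall i q, U q -> D i phi q = s 0 i) -> U q -> T i phi q = s 0 i.
Proof.
move=> Dphi Uq; rewrite (T_M hL uE) -(adM_cocycle1 hL uE hC cG q i c1).
by apply: eq_bigr => j _; rewrite Dphi.
Qed.

Lemma lform_class_data U (a f : 'I_n -> G -> R^o) phi : open U -> connected U -> U !=set0 ->
  (forall i, smooth_fun A U (a i)) -> (forall i, smooth_fun A U (f i)) -> smooth_fun A U phi ->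
  (forall i j q, U q -> D i (a j) q - D j (a i) q - \sum_k C i j k * a k q = b i j) ->
  (forall i q, U q -> D i phi q = s 0 i) ->
  (forall i j q, U q -> D j (f i) q = T i (a j) q) ->
  class_data A E Gam g U (lform A E K a phi) f s.
Proof.
move=> oU cU U0 sa sf sphi curl Dphi Df; split=> //.
- exact: lform_lagrangian.
- exact: lform_multiplier.
move=> i v Uv; rewrite lieDE; apply: (etrans (LC_Etilde_lform hL uE oU sK sa sphi i Uv)).
rewrite (T_potential i Dphi Uv); congr (_ + _); apply: eq_bigr => j _.
by rewrite qvelE lieDE -[Dv _ _ _ _]frameDE Df.
Qed.

(** For arbitrary class data L has the form [lform], so its derivatives along the complete lifts of
    [Etilde i] are known. Both expressions for them are affine in w: the constant terms give b' = s,
    and the linear ones D_j f_i = T_i a_j, as [alpha_class] requires. *)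
Lemma class_data_classes U L f b' : class_data A E Gam g U L f b' ->
  b' = s /\ exists al : 'M[R]_n, [/\ forall i j q, U q -> alpha A E C f i j q = al i j,
    cocycle2 C al & coboundary2 C (al + b)].
Proof.
move=> [[oU cU [q0 Uq0]] lag hm sf hf].
have [a [phi [[sa sphi] LE curl Dphi]]] := lagrangian_lform oU lag hm.
have slf := smooth_lform hL uE oU sK sa sphi.
have key i v : U v.1 -> b' 0 i + \sum_j D j (f i) v.1 * tw v 0 j =
    T i phi v.1 + \sum_j tw v 0 j * T i (a j) v.1.
  move=> Uv; have e1 := Dv_eq pT (clift A (Etilde A E i) v) (coT oU) Uv (fun w Uw => esym (LE w Uw)) slf.
  have e2 := LC_Etilde_lform hL uE oU sK sa sphi i Uv.
  have := etrans (esym (hf i v Uv)) (etrans e1 e2).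
  rewrite addrC [RHS]addrC => <-; congr (_ + _); apply: eq_bigr => j _.
  by rewrite qvelE lieDE -[Dv _ _ _ _]frameDE mulrC.
have aff i q : U q -> b' 0 i = T i phi q /\ forall j, D j (f i) q = T i (a j) q.
  move=> Uq; apply: affine_inj => w; have := key i (q, w *m eM A E q) Uq.
  by rewrite (tW_mk hL uE).
have bs : b' = s.
  apply/rowP => i; have [-> _] := aff i q0 Uq0; exact: (T_potential i Dphi Uq0).
split=> //.
have [|al alE cob] := alpha_class hL uE hC cG c2 oU cU _ sa sf curl (fun i j q Uq => (aff i q Uq).2 j).
  by exists q0.
exists al; split=> //.
have [ab cb] := c2; have [t tE] := cob.
(* Written as a coboundary minus b, al is seen to be a cocycle. *)
have -> : al = \matrix_(i, j) (\sum_k t 0 k * C i j k) - b.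
  by apply/matrixP => i j; rewrite !mxE -tE !mxE addrK.
exact: (cocycle2B (coboundary_cocycle (C_anti hL uE hC) (jacobi hL uE hC) t) c2).
Qed.

End ClassData.

Section Classes.
Variables (R : realType) (n : nat) (C : 'I_n -> 'I_n -> 'I_n -> R).

Lemma cocycle2N (x : 'M[R]_n) : cocycle2 C x -> cocycle2 C (- x).
Proof.
have c0 : cocycle2 C 0.
  split=> [|i j k]; first by rewrite trmx0 oppr0.
  by rewrite big1 // => l _; rewrite !mxE !mul0r !addr0.
by move=> cx; rewrite -[- x]sub0r; exact: cocycle2B.
Qed.

Lemma coboundary2B (x y : 'M[R]_n) : coboundary2 C x -> coboundary2 C y -> coboundary2 C (x - y).
Proof.
move=> [t tE] [u uE]; exists (t - u) => i j.
by rewrite !mxE tE uE -sumrB; apply: eq_bigr => k _; rewrite !mxE mulrBl.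
Qed.

Lemma coboundary2N (x : 'M[R]_n) : coboundary2 C x -> coboundary2 C (- x).
Proof.
move=> [t tE]; exists (- t) => i j.
by rewrite !mxE tE -sumrN; apply: eq_bigr => k _; rewrite !mxE mulNr.
Qed.

Lemma class1_eq (x y : 'rV[R]_n) : class1 C x y -> class1 C x = class1 C y.
Proof. by move=> [_ /eqP]; rewrite subr_eq0 => /eqP ->. Qed.

Lemma class2_eq (x y : 'M[R]_n) : class2 C x y -> class2 C x = class2 C y.
Proof.
move=> [_ h]; apply/seteqP; split=> z [cz hz]; split=> //.
  have -> : z - y = z - x - (y - x) by rewrite opprB addrA subrK.
  exact: coboundary2B.
have -> : z - x = z - y - - (y - x) by rewrite opprK addrA subrK.
apply: coboundary2B => //; exact: coboundary2N.
Qed.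

Lemma class1_refl (x : 'rV[R]_n) : cocycle1 C x -> class1 C x x.
Proof. by move=> cx; split=> //; rewrite /coboundary1 /= subrr. Qed.

Lemma class2_refl (x : 'M[R]_n) : cocycle2 C x -> class2 C x x.
Proof.
move=> cx; split=> //; rewrite subrr; exists 0 => i j.
by rewrite !mxE big1 // => k _; rewrite mxE mul0r.
Qed.

End Classes.

(** * Existence, uniqueness and vanishing of the classes *)

Section Main.
Variables (R : realType) (n : nat) (G : topGroupType) (A : atlas 'rV[R]_n G).
Local Notation V := 'rV[R]_n.
Variables (E : 'M[R]_n) (C : 'I_n -> 'I_n -> 'I_n -> R) (Gam : G * V -> V * V).
Hypotheses (hL : lie_group A) (cG : connected [set: G]).
Hypotheses (uE : E \in unitmx) (hC : structure_constants A E C).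
Hypothesis hG : invariant_sode A Gam.
Local Notation D := (frameD A E).
Local Notation T := (frameT A E).
Local Notation Eh := (Ehat A E).
Local Notation tw := (tW A E).
Local Notation form := Defs.form.
Implicit Types (g : G * V -> 'M[R]_n) (U : set G) (q : G) (v : G * V).

(** All that is remembered of g. In [md_local] the constants b_i of the class data are s itself,
    since degree one has no non-zero coboundaries to divide by. *)
Record multiplier_data g (K : V -> R^o) (s : V) (b : 'M[R]_n) : Prop := MultiplierData {
  md_smooth : smooth_on setT K;
  md_form : forall i j v, form g v (Eh i v.1) (Eh j v.1) = pd i (pd j K) (tw v);
  md_unit : forall w, hess K w \in unitmx;
  md_eps : forall i w, eps A E C Gam K i w = s 0 i + \sum_j b i j * w 0 j;
  md_cocycle1 : cocycle1 C s;
  md_cocycle2 : cocycle2 C b;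
  md_local : forall p, exists U L f, U p /\ class_data A E Gam g U L f s }.

Lemma multiplier_dataP g : invariant_multiplier A E Gam g ->
  exists K s b, multiplier_data g K s b.
Proof.
move=> ig; have [K [sK gK uK]] := mult_potential hL uE ig; have [_ _ Hg] := ig.
have se i : smooth_on setT (eps A E C Gam K i) := smooth_eps C hL uE hG i sK.
have [[_ _ /(_ 1%g)[cc d1] _ _] _ _ _ _] := hL.
have [s [b [bT epE]]] := antisym_jacobian se
  (fun i j w => helm_antisym hL uE hC hG sK gK cc Hg i j w (ex_intro _ _ (img_cmap d1 (I : setT 1%g)))).
have loc p := local_potentials hL uE hC p bT
  (fun c x cc ix => helm_closed hL uE hC hG sK gK cc Hg bT epE ix).
have c1 : cocycle1 C s.
  apply: (cocycle1_of_closed hL uE hC) => c x i j ccx ix.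
  by have [h _] := helm_closed hL uE hC hG sK gK ccx Hg bT epE ix; exact: h.
have c2 : cocycle2 C b.
  have [U [a [f [phi [[oU cU U1] [sa _ _] curl _ _]]]]] := loc 1%g.
  exact: (cocycle2_of_curl hL uE hC oU U1 bT sa curl).
exists K, s, b; split=> // p.
have [U [a [f [phi [[oU cU Up] [sa sf sphi] curl Dphi Df]]]]] := loc p.
exists U, (lform A E K a phi), f; split=> //.
apply: (lform_class_data hL uE hC hG sK uK epE gK cG c1 oU cU) => //.
by exists p.
Qed.

Lemma data_determines g K s b : multiplier_data g K s b ->
  determines A E C Gam g (class1 C s) (class2 C (- b)).
Proof.
move=> [sK gK uK epE c1 c2 loc]; split.
- by exists s.
- by exists (- b) => //; exact: cocycle2N.
- by move=> p; have [U [L [f h]]] := loc p; exists U, L, f, s.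
move=> U L f b' cd.
have [-> [al [alE cal cob]]] := class_data_classes hL uE hC hG sK epE gK cG c1 c2 cd.
exists al; split=> //; first exact: class1_refl.
by split=> //; rewrite opprK.
Qed.

(** [determines] constrains the classes through class data only. Data near the identity exist by
    [md_local], and the constant values of alpha on such data are shared by both descriptions, so
    the cosets coincide. *)
Lemma determines_unique g K s b c1 c2 : multiplier_data g K s b ->
  determines A E C Gam g c1 c2 -> c1 = class1 C s /\ c2 = class2 C (- b).
Proof.
move=> md [[x cx <-] [y cy <-] _ H].
have [sK gK uK epE cs cb loc] := md.
have [U [L [f [U1 cd]]]] := loc 1%g.
have [a [aE c1s c2a]] := H U L f s cd.
have [_ [al [alE cal cob]]] := class_data_classes hL uE hC hG sK epE gK cG cs cb cd.
have e : a = al by apply/matrixP => i j; rewrite -(aE i j _ U1) alE.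
split; first exact: class1_eq.
rewrite (class2_eq c2a) e; apply: esym; apply: class2_eq.
by split=> //; rewrite opprK.
Qed.

Let T0 i (a : R) q : T i (fun=> a : R^o) q = 0.
Proof. by rewrite frameTE DvC. Qed.

Let D0 i (a : R) q : D i (fun=> a : R^o) q = 0.
Proof. by rewrite frameDE DvC. Qed.

Lemma invariant_lform L : invariant_fun A L ->
  L = lform A E (fib A E L 1%g) (fun _ _ => 0) (fun=> 0) :> (G * V -> R^o).
Proof.
move=> iL; apply/funext => v; rewrite /lform big1 ?addr0 => [|j _]; last exact: mul0r.
exact: (inv_fun_tW hL uE iL).
Qed.

Lemma lform_invariant K t : invariant_fun A (lform A E K (fun j _ => t j) (fun=> 0)).
Proof. by move=> h v; rewrite /lform !(tW_inv hL uE). Qed.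

Lemma vanishing_classes g K s b c1 c2 : multiplier_data g K s b ->
  determines A E C Gam g c1 c2 ->
  classes_vanish C c1 c2 <-> s = 0 /\ coboundary2 C b.
Proof.
move=> md dt; have [-> ->] := determines_unique md dt.
have [sK gK uK epE cs cb loc] := md; split=> [[e1 e2]|[s0 hb]].
  have := class1_refl cs; rewrite e1 => -[_]; rewrite subr0 => ->; split=> //.
  have := class2_refl (cocycle2N cb); rewrite e2 => -[_]; rewrite subr0 => /coboundary2N.
  by rewrite opprK.
rewrite /classes_vanish s0; split=> //; apply: esym; apply: class2_eq.
by split; [exact: cocycle2N|rewrite subr0; exact: coboundary2N].
Qed.

Lemma invariant_lagrangian_iff g c1 c2 : invariant_multiplier A E Gam g ->
  determines A E C Gam g c1 c2 ->
  (exists L, [/\ invariant_fun A L, lagrangian A Gam setT L & has_multiplier A E setT L g])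
  <-> classes_vanish C c1 c2.
Proof.
move=> ig dt; have [K [s [b md]]] := multiplier_dataP ig.
rewrite (vanishing_classes md dt); have [sK gK uK epE cs cb loc] := md.
split=> [[L [iL lag hm]]|[s0 [t tE]]].
  have [sL _ _] := lag.
  have sl := smooth_fib E hL openT sL (I : setT 1%g).
  have s0 U : smooth_fun A U (fun=> 0 : R^o) by exact: smooth_fun_cst.
  (* L depends on w alone, which the complete lifts of [Etilde i] annihilate. This gives class data
     on the whole connected group with f = 0 and b = 0, hence alpha = 0. *)
  have cd : class_data A E Gam g setT L (fun _ _ => 0) 0.
    split=> //.
    - by split; [exact: openT|exact: cG|exists 1%g].
    - move=> i v _; rewrite lieDE (invariant_lform iL).
      apply: (etrans (LC_Etilde_lform hL uE openT sl (fun _ => s0 setT) (s0 setT) i I)).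
      rewrite T0 mxE; congr (_ + _); apply: eq_bigr => j _.
      by rewrite lieDE DvC !mulr0.
  have [<- [al [alE _ cob]]] := class_data_classes hL uE hC hG sK epE gK cG cs cb cd.
  split=> //; have al0 : al = 0.
    apply/matrixP => i j; rewrite -(alE i j 1%g I) /alpha !lieDE !DvC subrr add0r mxE.
    by rewrite big1 // => l _; rewrite mulr0.
  by move: cob; rewrite al0 add0r.
have sc (a : R) : smooth_fun A setT (fun=> a : R^o) by exact: smooth_fun_cst.
(* Constant a_j have exterior derivative -C_ij^k a_k, so a = -t realises b, the coboundary of t. *)
exists (lform A E K (fun j _ => - t 0 j) (fun=> 0)); split.
- exact: lform_invariant.
- apply: (lform_lagrangian hL uE hC hG sK uK epE openT (fun j => sc (- t 0 j)) (sc 0)).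
    move=> i j q _; rewrite !D0 subrr sub0r tE -sumrN; apply: eq_bigr => k _.
    by rewrite mulrN opprK mulrC.
  by move=> i q _; rewrite D0 s0 mxE.
- exact: (lform_multiplier hL uE sK gK openT (fun j => sc (- t 0 j)) (sc 0)).
Qed.

(** Writing L as K(w) makes its Euler-Lagrange expressions equal to [eps], which therefore vanishes;
    regularity makes the Hessian of K invertible. These are the hypotheses of [helm_suff_chart]. *)
Lemma invariant_lagrangian_multiplier L : invariant_fun A L -> lagrangian A Gam setT L ->
  exists2 g, invariant_multiplier A E Gam g & has_multiplier A E setT L g.
Proof.
move=> iL lag; have /lagrangianE[sL rL EL0] := lag.
pose K := fib A E L 1%g; have sK : smooth_on setT K := smooth_fib E hL openT sL (I : setT 1%g).
have LE := invariant_lform iL; rewrite -/K in LE.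
have s0 : smooth_fun A setT (fun=> 0 : R^o) by exact: smooth_fun_cst.
have LL i j v : LV A (Eh i) (LV A (Eh j) L) v = pd i (pd j K) (tw v).
  by rewrite LE; exact: (LVLV_lform hL uE sK openT (fun _ => s0) s0 i j I).
have uK w : hess K w \in unitmx.
  have := (regularE hL uE openT sL).1 rL (1%g, w *m eM A E 1%g) I.
  congr (_ \in unitmx); apply/matrixP => k l; rewrite !mxE; apply: (etrans (LL k l _)).
  by rewrite (tW_mk hL uE).
have ep0 i w : eps A E C Gam K i w = 0.
  have sE : smooth_field A setT (Eh i) := smooth_Ehat hL E i.
  have := EL0 _ sE (1%g, w *m eM A E 1%g) I; rewrite LE.
  rewrite (EL_lform hL uE hC hG openT sK (fun _ => s0) s0 i I) (tW_mk hL uE) D0 addr0.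
  rewrite big1 ?subr0 // => k _; rewrite !D0 subrr sub0r big1 ?oppr0 ?mulr0 // => l _.
  by rewrite mulr0.
(* The bilinear form whose frame components are the Hessian of K, converted to the preferred chart
   of the base point. *)
pose g v := invmx (eM A E v.1) *m hess K (tw v) *m (invmx (eM A E v.1))^T.
have gK i j v : form g v (Eh i v.1) (Eh j v.1) = pd i (pd j K) (tw v).
  have uM := eM_unit hL uE v.1.
  have rE k : Eh k v.1 = row k 1%:M *m eM A E v.1 by rewrite -row_mul mul1mx rowK.
  have e : row i 1%:M *m eM A E v.1 *m g v *m (row j 1%:M *m eM A E v.1)^T =
      row i 1%:M *m hess K (tw v) *m (row j 1%:M)^T.
    rewrite /g trmx_mul !mulmxA (mulmxK uM); congr (_ *m _).
    by rewrite -mulmxA -trmx_mul mulmxV // trmx1 mulmx1.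
  rewrite /Defs.form !rE e -row_mul mul1mx tr_row trmx1 col1 -colE.
  by rewrite [LHS]mxE [LHS]mxE [LHS]mxE.
exists g; last by apply/has_multiplierE => i j v _; rewrite gK LL.
split.
- move=> c i j cc; rewrite (img_tchartE hL cc).
  have sKc := smooth_KWc hL uE cc sK.
  have oO : open [set z : V * V | img c setT z.1] := @open_fst R V V _ (open_imgT hL cc).
  apply: (smooth_eq oO _ (smooth_dd (vdir R j) (smooth_dd (vdir R i) sKc))) => z Oz.
  by rewrite (gcoef_gg hL uE sK gK cc i j Oz).
- by move=> i j h v; rewrite !gK (tW_inv hL uE).
- move=> c z cc iz; rewrite (img_tchartE hL cc) in iz.
  exact: (helm_suff_chart hL uE hC hG sK gK cc ep0 uK iz).
Qed.

End Main.

Unset Implicit Arguments.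

(** Different multipliers of one field may have different classes. The criterion is therefore given
    for a fixed multiplier g, with an invariant Lagrangian having g as its Hessian, and for the
    field alone, where a multiplier with vanishing classes has to exist. The first clause makes the
    phrase about corresponding classes meaningful. *)
Theorem theorem1 (R : realType) (n : nat) (G : topGroupType)
    (A : atlas 'rV[R]_n G) (E : 'M[R]_n) (C : 'I_n -> 'I_n -> 'I_n -> R)
    (Gam : G * 'rV[R]_n -> 'rV[R]_n * 'rV[R]_n) :
  lie_group A -> connected [set: G] ->
  E \in unitmx -> structure_constants A E C ->
  invariant_sode A Gam ->
  [/\ (forall g, invariant_multiplier A E Gam g ->
         exists! c : set 'rV[R]_n * set 'M[R]_n,
           determines A E C Gam g c.1 c.2),
      (forall g c1 c2, invariant_multiplier A E Gam g ->
         determines A E C Gam g c1 c2 ->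
         ((exists L, [/\ invariant_fun A L, lagrangian A Gam setT L &
                         has_multiplier A E setT L g])
          <-> classes_vanish C c1 c2)) &
      (derivable_from_invariant A Gam <->
         exists g c1 c2, [/\ invariant_multiplier A E Gam g,
           determines A E C Gam g c1 c2 & classes_vanish C c1 c2])].
Proof.
move=> hL cG uE hC hG; split.
- move=> g ig; have [K [s [b md]]] := multiplier_dataP hL cG uE hC hG ig.
  exists (class1 C s, class2 C (- b)); split; first exact: data_determines md.
  by move=> [c1 c2] dt; have [/= -> ->] := determines_unique hL cG uE hC hG md dt.
- by move=> g c1 c2 ig dt; exact: invariant_lagrangian_iff.
- split=> [[L [iL lag]]|[g [c1 [c2 [ig dt cv]]]]].
    have [g ig hm] := invariant_lagrangian_multiplier hL uE hC hG iL lag.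
    have [K [s [b md]]] := multiplier_dataP hL cG uE hC hG ig.
    have dt := data_determines hL cG uE hC hG md.
    exists g, (class1 C s), (class2 C (- b)); split=> //.
    by apply/(invariant_lagrangian_iff hL cG uE hC hG ig dt); exists L.
  have [L [iL lag _]] := (invariant_lagrangian_iff hL cG uE hC hG ig dt).2 cv.
  by exists L.
Qed.
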